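(* Let $\tau=\frac{-b+\sqrt{-d}}{2a}$ where $a,b,c$ are mutually coprime integers with $a>0$, $a\tau^2+b\tau+c=0$ and $-d=b^2-4ac$, and suppose $\tau$ lies in $C_{\lambda,\infty}$. Then $$(1-2\lambda)\frac{F^2}{6}\left[2+\frac{(\lambda+1)(\lambda-2)}{\lambda^2-\lambda+1}s_2(\tau)\right]+\lambda(1-\lambda)\frac{dF^2}{d\lambda}=\frac{2a}{\pi\sqrt{d}},$$ where $\lambda=\lambda(\tau)$, $F={}_2F_1\!\left(\frac12,\frac12;1;\lambda\right)$, and $\frac{dF^2}{d\lambda}$ denotes the derivative of $x\mapsto{}_2F_1(\frac12,\frac12;1;x)^2$ evaluated at $x=\lambda(\tau)$.
   Context: $\mathfrak H$ is the upper half-plane, $q=e^{2\pi i\tau}$, $E_2=1-24\sum_{n\ge1}n\frac{q^n}{1-q^n}$, $E_4=1+240\sum_{n\ge1}n^3\frac{q^n}{1-q^n}$, $E_6=1-504\sum_{n\ge1}n^5\frac{q^n}{1-q^n}$, $E_2^*(\tau)=E_2(\tau)-\frac{3}{\pi\mathrm{Im}(\tau)}$, $s_2(\tau)=\frac{E_4(\tau)}{E_6(\tau)}E_2^*(\tau)$. ${}_2F_1$ is the Gauss hypergeometric function. $\lambda(\tau)=\left(\vartheta_2(\tau)/\vartheta_3(\tau)\right)^4$ is the modular lambda function ($\vartheta_2,\vartheta_3$ Jacobi theta functions), a Hauptmodul of $\Gamma(2)$. With $\mathcal{F}_{2C}=\{z\in\mathfrak{H}:|z+1|>1,|z-2|>1,|z-1/3|>1/3,|z-2/3|>1/3,|\mathrm{Re}(z-1/2)|<1\}$,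 $C_{\lambda,\infty}$ is the connected component of $\{\tau\in\mathcal F_{2C}:|\lambda(\tau)|<1\}$ whose closure contains the cusp $\infty$ (i.e. containing points of arbitrarily large imaginary part). *)

(* Defs.v *)
From Stdlib Require Export Reals ZArith.
From Coquelicot Require Export Coquelicot.

Open Scope R_scope.
Open Scope C_scope.

Definition Cexp (z : C) : C :=
  (exp (Re z) * cos (Im z), exp (Re z) * sin (Im z))%R.

(** Principal square root of a real number.  [sqrt] vanishes on negative reals,
    so exactly one component can be nonzero: [sqrt x] if [x >= 0] and
    [i * sqrt (- x)] if [x < 0]. *)
Definition Csqrt_real (x : R) : C := (sqrt x, sqrt (- x)).

(** Sum of a complex series, taken componentwise; see [CSeries_unique]. *)
Definition CSeries (u : nat -> C) : C :=
  (Series (fun n => Re (u n)), Series (fun n => Im (u n))).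

Lemma CSeries_unique (u : nat -> C) (l : C) :
  is_series (V := C_NormedModule) u l -> CSeries u = l.
Proof.
intros Hu.
assert (Hre : forall n, fst (sum_n u n) = sum_n (fun k => Re (u k)) n).
{ induction n as [|n IH].
  - now rewrite !sum_O.
  - now rewrite !sum_Sn, <- IH. }
assert (Him : forall n, snd (sum_n u n) = sum_n (fun k => Im (u k)) n).
{ induction n as [|n IH].
  - now rewrite !sum_O.
  - now rewrite !sum_Sn, <- IH. }
unfold CSeries; rewrite (surjective_pairing l); f_equal; apply is_series_unique.
- intros P [eps HP].
  destruct (Hu (ball l eps) (locally_ball l eps)) as [N HN].
  exists N; intros n Hn; apply HP; rewrite <- Hre; apply (HN n Hn).
- intros P [eps HP].
  destruct (Hu (ball l eps) (locally_ball l eps)) as [N HN].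
  exists N; intros n Hn; apply HP; rewrite <- Him; apply (HN n Hn).
Qed.

(** Sum over all integers: nonnegative indices, then the indices [-1, -2, ...]. *)
Definition CSeriesZ (u : Z -> C) : C :=
  CSeries (fun n => u (Z.of_nat n)) +
  CSeries (fun n => u (- Z.of_nat (S n))%Z).

Definition nome (tau : C) : C := Cexp (2 * PI * Ci * tau).

(** [lambert k q] is the sum over [n >= 1] of [n^k q^n / (1 - q^n)]. *)
Definition lambert (k : nat) (q : C) : C :=
  CSeries (fun n => RtoC (INR (S n)) ^ k * (q ^ S n / (1 - q ^ S n))).

Definition E2 (tau : C) : C := 1 - 24 * lambert 1 (nome tau).
Definition E4 (tau : C) : C := 1 + 240 * lambert 3 (nome tau).
Definition E6 (tau : C) : C := 1 - 504 * lambert 5 (nome tau).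

Definition E2star (tau : C) : C := E2 tau - RtoC (3 / (PI * Im tau)).

Definition s2 (tau : C) : C := E4 tau / E6 tau * E2star tau.

Definition theta2 (tau : C) : C :=
  CSeriesZ (fun n => Cexp (PI * Ci * tau * RtoC ((IZR n + 1 / 2) ^ 2))).
Definition theta3 (tau : C) : C :=
  CSeriesZ (fun n => Cexp (PI * Ci * tau * RtoC (IZR n ^ 2))).

Definition modular_lambda (tau : C) : C := (theta2 tau / theta3 tau) ^ 4.

(** Rising factorial [a (a + 1) ... (a + n - 1)]. *)
Fixpoint pochhammer (a : C) (n : nat) : C :=
  match n with
  | O => 1
  | S m => pochhammer a m * (a + RtoC (INR m))
  end.

(** Gauss's series; it is only meaningful on the unit disc [Cmod x < 1]. *)
Definition hyp2F1 (a b c x : C) : C :=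
  CSeries (fun n =>
    pochhammer a n * pochhammer b n / (pochhammer c n * RtoC (INR (fact n)))
    * x ^ n).

Definition F2C (z : C) : Prop :=
  (0 < Im z)%R /\
  (1 < Cmod (z + 1))%R /\
  (1 < Cmod (z - 2))%R /\
  (1 / 3 < Cmod (z - RtoC (1 / 3)))%R /\
  (1 / 3 < Cmod (z - RtoC (2 / 3)))%R /\
  (Rabs (Re (z - RtoC (1 / 2))) < 1)%R.

Definition Cconnected (S : C -> Prop) : Prop :=
  forall U V : C -> Prop,
    open U -> open V ->
    (forall z, S z -> U z \/ V z) ->
    (exists z, S z /\ U z) -> (exists z, S z /\ V z) ->
    exists z, S z /\ U z /\ V z.

(** The union of all connected subsets of [S] containing [z]. *)
Definition connected_component (S : C -> Prop) (z w : C) : Prop :=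
  exists K : C -> Prop,
    Cconnected K /\ (forall x, K x -> S x) /\ K z /\ K w.

Definition lambda_disc (z : C) : Prop :=
  F2C z /\ (Cmod (modular_lambda z) < 1)%R.

(** The component of [lambda_disc] whose closure contains the cusp at infinity:
    the points whose component has points of arbitrarily large imaginary part. *)
Definition C_lambda_infty (tau : C) : Prop :=
  lambda_disc tau /\
  forall M : R,
    exists w, connected_component lambda_disc tau w /\ (M < Im w)%R.

(* Main.v *)
(** The nome [p = exp (pi i tau)] is the working variable.  Write [a], [b], [c] for the fourth
    powers of [theta_2], [theta_3], [theta_4].  Rearranging lattice sums gives the passage from [p]
    to [p^2] in terms of theta constants, and a function with [f p = f (p^2)] that is continuous
    at [0] is constant.  This doubling argument yields Jacobi's derivative formulas, Halphen's
    differential equation and, once the Lambert series of the logarithmic derivative of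
    [theta_4(z)] is known, the formulas for [E2], [E4], [E6] in terms of theta constants.

    By these formulas [2F1(1/2,1/2;1;lambda)] and [theta_3^2] satisfy the same second order
    equation; their Wronskian vanishes at the cusp, so [2F1(lambda) = theta_3^2] propagates along
    the component of the cusp.  Hence [lambda (1 - lambda) dF^2/dlambda = (E2 - (1 - 2 lambda) F^2) / 3],
    and the left-hand side of the theorem collapses to [(E2 - E2star) / 3 = 1 / (pi Im tau)].

    The case [lambda = 1/2] needs care, since there [E6 = 0] and [s2] is a junk value.  The first
    summand vanishes anyway, and what is left is [E2(tau) = 3 / (pi Im tau)].  Iterating the AGM shows
    that the absolute value of the nome is determined by [lambda] on the component, so [Im tau = 1], and the
    value at [i] follows from [theta_3(i/t)^2 = t theta_3(it)^2], which in turn follows from the AGM and the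
    Gaussian integral. *)
Require Import Defs.
From Stdlib Require Import List Permutation Lia Lra Psatz ClassicalEpsilon FunctionalExtensionality.
Import ListNotations.

(** * Unordered sums *)

(** The nome turns the cusp into the interior point [p = 0] of the disc, where all initial values
    are explicit. Only [theta_3(p)] and [theta_4(p) = theta_3(- p)] occur as functions; the quarter
    power in [theta_2] disappears in its fourth power.

    With [b = theta_3^4], the Eisenstein series become [E4 = b^2 (lambda^2 - lambda + 1)] and [E6 =
    b^3 (1 + lambda)(2 - lambda)(1 - 2 lambda) / 2]. The fraction in front of [s2] is made to cancel
    against their quotient: its product with [E4 / E6] is [- 2 / ((1 - 2 lambda) b)]. Since
    [F^2 = b], the first summand equals [((1 - 2 lambda) F^2 - E2star) / 3]. The quadratic equation
    enters through [Im tau = sqrt d / (2 a)].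

    The delicate point is [F^2 = b]. The series [F] sees only [lambda], not [tau], so the equality
    has to be carried from the cusp through connected sets. Local constancy of the Wronskian and of
    the quotient makes it an open condition whose negation is open as well. *)

Lemma eq_dec_cl (I : Type) (x y : I) : {x = y} + {x <> y}.
Proof. apply excluded_middle_informative. Qed.

Definition lsum {I} (f : I -> C) (L : list I) : C :=
  fold_right (fun i s => f i + s) 0 L.

Definition rsum {I} (f : I -> R) (L : list I) : R :=
  fold_right (fun i s => (f i + s)%R) 0%R L.

(** Convergence along the finite subsets of the index type, ordered by inclusion. *)
Definition is_sum {I} (f : I -> C) (l : C) : Prop :=
  forall eps : R, (0 < eps)%R ->
  exists L0, forall L, NoDup L -> incl L0 L -> (Cmod (lsum f L - l) < eps)%R.

Definition abs_le {I} (f : I -> C) (M : R) : Prop :=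
  forall L, NoDup L -> (rsum (fun i => Cmod (f i)) L <= M)%R.

Definition abs_summable {I} (f : I -> C) : Prop := exists M, abs_le f M.

(** [epsilon] makes this total. Without a sum the value is arbitrary, so every use goes through
    [Csum_eq] or [Csum_correct]. *)
Definition Csum {I} (f : I -> C) : C := epsilon (inhabits (RtoC 0)) (is_sum f).

Lemma lsum_app {I} (f : I -> C) L1 L2 : lsum f (L1 ++ L2) = lsum f L1 + lsum f L2.
Proof. induction L1 as [|i L1 IH]; simpl; [ring | rewrite IH; ring]. Qed.

Lemma lsum_perm {I} (f : I -> C) L1 L2 : Permutation L1 L2 -> lsum f L1 = lsum f L2.
Proof.
induction 1; simpl; auto; [now rewrite IHPermutation | ring | congruence].
Qed.

Lemma rsum_perm {I} (f : I -> R) L1 L2 : Permutation L1 L2 -> rsum f L1 = rsum f L2.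
Proof.
induction 1; simpl; auto; [now rewrite IHPermutation | ring | congruence].
Qed.

Lemma lsum_plus {I} (f g : I -> C) L : lsum (fun i => f i + g i) L = lsum f L + lsum g L.
Proof. induction L as [|i L IH]; simpl; [ring | rewrite IH; ring]. Qed.

Lemma lsum_scal {I} (f : I -> C) c L : lsum (fun i => c * f i) L = c * lsum f L.
Proof. induction L as [|i L IH]; simpl; [ring | rewrite IH; ring]. Qed.

Lemma lsum_map {I J} (h : J -> I) (f : I -> C) L : lsum f (map h L) = lsum (fun j => f (h j)) L.
Proof. induction L as [|i L IH]; simpl; auto; now rewrite IH. Qed.

Lemma rsum_map {I J} (h : J -> I) (f : I -> R) L : rsum f (map h L) = rsum (fun j => f (h j)) L.
Proof. induction L as [|i L IH]; simpl; auto; now rewrite IH. Qed.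

Lemma rsum_app {I} (f : I -> R) L1 L2 : rsum f (L1 ++ L2) = (rsum f L1 + rsum f L2)%R.
Proof. induction L1 as [|i L1 IH]; simpl; [ring | rewrite IH; ring]. Qed.

Lemma rsum_le {I} (f g : I -> R) L : (forall i, f i <= g i)%R -> (rsum f L <= rsum g L)%R.
Proof. intros H; induction L as [|i L IH]; simpl; [lra | specialize (H i); lra]. Qed.

Lemma rsum_scal {I} (f : I -> R) c L : rsum (fun i => (c * f i)%R) L = (c * rsum f L)%R.
Proof. induction L as [|i L IH]; simpl; [ring | rewrite IH; ring]. Qed.

Lemma rsum_ge_0 {I} (f : I -> R) L : (forall i, 0 <= f i)%R -> (0 <= rsum f L)%R.
Proof. intros H; induction L as [|i L IH]; simpl; [lra | specialize (H i); lra]. Qed.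

Lemma Cmod_lsum {I} (f : I -> C) L : (Cmod (lsum f L) <= rsum (fun i => Cmod (f i)) L)%R.
Proof.
induction L as [|i L IH]; simpl; [rewrite Cmod_0; lra|].
eapply Rle_trans; [apply Cmod_triangle | lra].
Qed.

Lemma incl_NoDup_split {I} (L0 L : list I) :
  NoDup L0 -> incl L0 L -> exists L', Permutation L (L0 ++ L').
Proof.
revert L; induction L0 as [|i L0 IH]; intros L HN Hi; [now exists L|].
inversion HN; subst.
destruct (in_split i L) as [l1 [l2 ->]]; [apply Hi; now left|].
destruct (IH (l1 ++ l2)) as [L' HL']; auto.
{ intros j Hj. assert (j <> i) by (intros ->; tauto).
  specialize (Hi j (or_intror Hj)). apply in_app_iff in Hi. apply in_app_iff.
  simpl in Hi; intuition congruence. }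
exists L'. simpl. rewrite <- HL'. symmetry. apply Permutation_middle.
Qed.

Lemma rsum_incl {I} (f : I -> R) L0 L :
  (forall i, 0 <= f i)%R -> NoDup L0 -> incl L0 L -> (rsum f L0 <= rsum f L)%R.
Proof.
intros Hf HN Hi. destruct (incl_NoDup_split L0 L HN Hi) as [L' HL'].
rewrite (rsum_perm f _ _ HL'), rsum_app.
pose proof (rsum_ge_0 f L' Hf); lra.
Qed.

Lemma le_list_max (L : list nat) i : In i L -> (i <= fold_right max 0 L)%nat.
Proof.
induction L as [|j L IH]; simpl; [tauto|]. intros [->|Hi]; [lia | specialize (IH Hi); lia].
Qed.

Lemma rsum_nat_le (f : nat -> R) B : (forall n, (0 <= f n)%R) ->
  (forall N, (rsum f (seq 0 N) <= B)%R) -> forall L, NoDup L -> (rsum f L <= B)%R.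
Proof.
intros Hf HB L HN. eapply Rle_trans; [|apply (HB (S (fold_right max 0%nat L)))].
apply rsum_incl; auto. intros i Hi. apply in_seq. pose proof (le_list_max L i Hi). lia.
Qed.

(** Classical decidability of equality makes [nodup] available on every index type, so finite sets
    can be merged freely. *)
Definition nodupI {I} (L : list I) := nodup (eq_dec_cl I) L.

Lemma Cmod_diag x : Cmod (x - x) = 0%R.
Proof. replace (x - x) with (RtoC 0) by ring. apply Cmod_0. Qed.

Lemma is_sum_unique {I} (f : I -> C) l1 l2 : is_sum f l1 -> is_sum f l2 -> l1 = l2.
Proof.
intros H1 H2.
destruct (Req_dec (Cmod (l1 - l2)) 0) as [H|H].
{ apply Cmod_eq_0 in H. replace l1 with (l1 - l2 + l2) by ring. rewrite H; ring. }
exfalso. pose proof (Cmod_ge_0 (l1 - l2)).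
destruct (H1 (Cmod (l1 - l2) / 2)%R) as [L1 HL1]; [lra|].
destruct (H2 (Cmod (l1 - l2) / 2)%R) as [L2 HL2]; [lra|].
set (L := nodupI (L1 ++ L2)).
assert (HN : NoDup L) by apply NoDup_nodup.
specialize (HL1 L HN). specialize (HL2 L HN).
assert (Cmod (lsum f L - l1) < Cmod (l1 - l2) / 2)%R.
{ apply HL1. intros i Hi. apply nodup_In. apply in_app_iff; auto. }
assert (Cmod (lsum f L - l2) < Cmod (l1 - l2) / 2)%R.
{ apply HL2. intros i Hi. apply nodup_In. apply in_app_iff; auto. }
assert (Cmod (l1 - l2) <= Cmod (lsum f L - l1) + Cmod (lsum f L - l2))%R.
{ replace (l1 - l2) with (- (lsum f L - l1) + (lsum f L - l2)) by ring.
  eapply Rle_trans; [apply Cmod_triangle | rewrite Cmod_opp; lra]. }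
lra.
Qed.

Lemma Csum_eq {I} (f : I -> C) l : is_sum f l -> Csum f = l.
Proof.
intros H. apply (is_sum_unique f); auto.
unfold Csum. apply epsilon_spec. now exists l.
Qed.

Lemma is_sum_ext {I} (f g : I -> C) l : (forall i, f i = g i) -> is_sum f l -> is_sum g l.
Proof. intros H. replace g with f; auto. now apply functional_extensionality. Qed.

Lemma is_sum_eq {I} (f : I -> C) l l' : is_sum f l -> l = l' -> is_sum f l'.
Proof. now intros H <-. Qed.

Lemma is_sum_plus {I} (f g : I -> C) a b :
  is_sum f a -> is_sum g b -> is_sum (fun i => f i + g i) (a + b).
Proof.
intros Hf Hg eps He.
destruct (Hf (eps/2)%R) as [L1 H1]; [lra|]. destruct (Hg (eps/2)%R) as [L2 H2]; [lra|].
exists (L1 ++ L2). intros L HN Hi. apply incl_app_inv in Hi as [Hi1 Hi2].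
rewrite lsum_plus.
replace (lsum f L + lsum g L - (a + b)) with ((lsum f L - a) + (lsum g L - b)) by ring.
eapply Rle_lt_trans; [apply Cmod_triangle|].
specialize (H1 L HN Hi1); specialize (H2 L HN Hi2); lra.
Qed.

Lemma is_sum_scal {I} (f : I -> C) a c : is_sum f a -> is_sum (fun i => c * f i) (c * a).
Proof.
intros Hf eps He. pose proof (Cmod_ge_0 c).
destruct (Hf (eps / (Cmod c + 1))%R) as [L1 H1]; [apply Rdiv_lt_0_compat; lra|].
exists L1. intros L HN Hi. rewrite lsum_scal.
replace (c * lsum f L - c * a) with (c * (lsum f L - a)) by ring.
rewrite Cmod_mult. specialize (H1 L HN Hi).
apply Rle_lt_trans with ((Cmod c) * (eps / (Cmod c + 1)))%R.
{ apply Rmult_le_compat_l; lra. }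
apply Rmult_lt_reg_r with (Cmod c + 1)%R; [lra|]. field_simplify; lra.
Qed.

Lemma is_sum_opp {I} (f : I -> C) a : is_sum f a -> is_sum (fun i => - f i) (- a).
Proof.
intros H. apply (is_sum_scal f a (-(1))) in H.
apply (is_sum_ext (fun i => -(1) * f i)); [intros; ring|].
apply (is_sum_eq _ _ _ H); ring.
Qed.

Lemma is_sum_minus {I} (f g : I -> C) a b :
  is_sum f a -> is_sum g b -> is_sum (fun i => f i - g i) (a - b).
Proof. intros Hf Hg. apply is_sum_plus; auto. now apply is_sum_opp. Qed.

Lemma is_sum_0 {I} : is_sum (fun _ : I => RtoC 0) 0.
Proof.
intros eps He. exists nil. intros L _ _.
replace (lsum (fun _ : I => RtoC 0) L) with (RtoC 0); [now rewrite Cmod_diag|].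
induction L as [|i L IH]; simpl; auto. rewrite <- IH; ring.
Qed.

Lemma is_sum_bound {I} (f : I -> C) l M : is_sum f l -> abs_le f M -> (Cmod l <= M)%R.
Proof.
intros Hl HM. apply Rnot_lt_le; intros Hlt.
destruct (Hl (Cmod l - M)%R) as [L0 H0]; [lra|].
specialize (H0 (nodupI L0) (NoDup_nodup _ _)).
assert (Cmod (lsum f (nodupI L0) - l) < Cmod l - M)%R.
{ apply H0. intros i Hi. now apply nodup_In. }
specialize (HM (nodupI L0) (NoDup_nodup _ _)).
pose proof (Cmod_lsum f (nodupI L0)).
assert (Cmod l <= Cmod (lsum f (nodupI L0)) + Cmod (lsum f (nodupI L0) - l))%R.
{ replace l with (lsum f (nodupI L0) + - (lsum f (nodupI L0) - l)) at 1 by ring.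
  eapply Rle_trans; [apply Cmod_triangle | rewrite Cmod_opp; lra]. }
lra.
Qed.

(** The sum is the supremum of the finite partial sums; by monotonicity every larger finite set
    stays within [eps] of it. *)
Lemma is_sum_nonneg_exists {I} (g : I -> R) M :
  (forall i, 0 <= g i)%R -> (forall L, NoDup L -> (rsum g L <= M)%R) ->
  exists l : R, is_sum (fun i => RtoC (g i)) l.
Proof.
intros Hg HM.
destruct (completeness (fun x => exists L, NoDup L /\ x = rsum g L)) as [l [Hub Hlub]].
{ exists M. intros x [L [HL ->]]. now apply HM. }
{ exists 0%R. exists nil. split; [constructor | auto]. }
exists l. intros eps He.
assert (Hex : exists L0, NoDup L0 /\ (l - eps < rsum g L0)%R).
{ apply NNPP. intros Hn.
  assert (l <= l - eps)%R; [|lra].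
  apply Hlub. intros x [L [HL ->]]. apply Rnot_lt_le. intros Hlt. apply Hn. now exists L. }
destruct Hex as [L0 [HN0 HL0]]. exists L0. intros L HN Hi.
assert (E : lsum (fun i => RtoC (g i)) L = RtoC (rsum g L)).
{ clear. induction L as [|i L IH]; simpl; auto. rewrite IH. now rewrite RtoC_plus. }
rewrite E, <- RtoC_minus, Cmod_R.
pose proof (rsum_incl g L0 L Hg HN0 Hi).
assert (rsum g L <= l)%R by (apply Hub; now exists L).
apply Rabs_def1; lra.
Qed.

(** [g] is the difference of the nonnegative families [g + h] and [h]. *)
Lemma is_sum_real_exists {I} (g h : I -> R) M :
  (forall i, Rabs (g i) <= h i)%R -> (forall L, NoDup L -> (rsum h L <= M)%R) ->
  exists l : C, is_sum (fun i => RtoC (g i)) l.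
Proof.
intros Hgh HM.
assert (Hb : forall i, (0 <= h i /\ - h i <= g i <= h i)%R).
{ intros i. specialize (Hgh i). pose proof (Rabs_pos (g i)).
  unfold Rabs in *; destruct (Rcase_abs (g i)); lra. }
destruct (is_sum_nonneg_exists h M) as [l1 H1]; auto; [apply Hb|].
destruct (is_sum_nonneg_exists (fun i => (g i + h i)%R) (2 * M)) as [l2 H2].
{ intros i; specialize (Hb i); lra. }
{ intros L HL. apply Rle_trans with (rsum (fun i => (2 * h i)%R) L).
  - apply rsum_le. intros i; specialize (Hb i); lra.
  - rewrite rsum_scal. specialize (HM L HL); lra. }
exists (l2 - l1). apply (is_sum_ext (fun i => RtoC (g i + h i) - RtoC (h i))).
{ intros i. rewrite RtoC_plus. ring. }
now apply is_sum_minus.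
Qed.

Lemma abs_summable_is_sum {I} (f : I -> C) : abs_summable f -> exists l, is_sum f l.
Proof.
intros [M HM].
assert (Hre : forall i, (Rabs (Re (f i)) <= Cmod (f i))%R) by (intros; apply re_le_Cmod).
assert (Him : forall i, (Rabs (Im (f i)) <= Cmod (f i))%R).
{ intros i. eapply Rle_trans; [|apply Rmax_Cmod]. apply Rmax_r. }
destruct (is_sum_real_exists _ _ M Hre HM) as [l1 H1].
destruct (is_sum_real_exists _ _ M Him HM) as [l2 H2].
exists (l1 + Ci * l2).
apply (is_sum_ext (fun i => RtoC (Re (f i)) + Ci * RtoC (Im (f i)))).
{ intros i. destruct (f i) as [x y]. apply injective_projections; simpl; ring. }
apply is_sum_plus; auto. now apply is_sum_scal.
Qed.

Lemma Csum_correct {I} (f : I -> C) : abs_summable f -> is_sum f (Csum f).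
Proof.
intros H. destruct (abs_summable_is_sum f H) as [l Hl]. now rewrite (Csum_eq f l Hl).
Qed.

Lemma is_sum_reindex {I J} (h : J -> I) (g : I -> J) (f : I -> C) l :
  (forall j, g (h j) = j) -> (forall i, h (g i) = i) ->
  is_sum f l -> is_sum (fun j => f (h j)) l.
Proof.
intros Hgh Hhg Hf eps He. destruct (Hf eps He) as [L0 H0].
exists (map g L0). intros L HN Hi. rewrite <- lsum_map. apply H0.
- apply FinFun.Injective_map_NoDup; auto.
  intros x y E. rewrite <- (Hgh x), <- (Hgh y). now rewrite E.
- intros i Hin. rewrite <- (Hhg i). apply in_map. apply Hi. now apply in_map.
Qed.

Lemma abs_summable_inj {I J} (h : J -> I) (f : I -> C) :
  (forall x y, h x = h y -> x = y) -> abs_summable f -> abs_summable (fun j => f (h j)).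
Proof.
intros Hh [M HM]. exists M. intros L HN.
rewrite <- (rsum_map h (fun i => Cmod (f i))). apply HM.
now apply FinFun.Injective_map_NoDup.
Qed.

Lemma abs_summable_le {I} (f g : I -> C) :
  (forall i, (Cmod (f i) <= Cmod (g i))%R) -> abs_summable g -> abs_summable f.
Proof.
intros H [M HM]. exists M. intros L HN. eapply Rle_trans; [|apply (HM L HN)].
now apply rsum_le.
Qed.

Lemma abs_summable_scal {I} (f : I -> C) c : abs_summable f -> abs_summable (fun i => c * f i).
Proof.
intros [M HM]. exists (Cmod c * M)%R. intros L HN.
replace (fun i => Cmod (c * f i)) with (fun i => (Cmod c * Cmod (f i))%R).
- rewrite rsum_scal. apply Rmult_le_compat_l; [apply Cmod_ge_0 | now apply HM].
- apply functional_extensionality; intros; now rewrite Cmod_mult.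
Qed.

(** Enlarge a finite set [L0] of pairs to one whose first projections are [L],
    with each row long enough that its partial sum is close to the row sum. *)
Lemma row_cover {I J} (f : I -> J -> C) (g : I -> C) (L0 : list (I * J)) (d : R) (L : list I) :
  (0 < d)%R -> (forall i, is_sum (f i) (g i)) -> NoDup L ->
  exists LL : list (I * J), NoDup LL /\
    (forall x, In x LL -> In (fst x) L) /\
    (forall x, In x L0 -> In (fst x) L -> In x LL) /\
    (Cmod (lsum (fun x => f (fst x) (snd x)) LL - lsum g L) <= INR (length L) * d)%R.
Proof.
intros Hd Hrow. induction L as [|i L IH]; intros HN.
{ exists nil. repeat split; simpl; auto; [constructor|].
  rewrite Cmod_diag; lra. }
inversion HN; subst. destruct IH as [LL [HNL [Hf [H0 Hs]]]]; auto.
destruct (Hrow i d Hd) as [J0 HJ0].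
set (Ji := nodupI (J0 ++ map snd L0)).
assert (HNJ : NoDup Ji) by apply NoDup_nodup.
exists (map (fun j => (i, j)) Ji ++ LL). repeat split.
- apply NoDup_app; auto.
  + apply FinFun.Injective_map_NoDup; auto. intros x y E; congruence.
  + intros x Hx Hx2. apply in_map_iff in Hx as [j [<- _]]. apply Hf in Hx2. simpl in Hx2; tauto.
- intros x Hx. apply in_app_iff in Hx as [Hx|Hx].
  + apply in_map_iff in Hx as [j [<- _]]. now left.
  + right. now apply Hf.
- intros [x y] Hx Hx2. apply in_app_iff. simpl in Hx2. destruct Hx2 as [->|Hx2].
  + left. apply in_map_iff. exists y. split; auto. apply nodup_In. apply in_app_iff. right.
    apply in_map_iff. now exists (x, y).
  + right. now apply H0.
- rewrite lsum_app, lsum_map. cbn [fst snd].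
  assert (Hj : (Cmod (lsum (f i) Ji - g i) < d)%R).
  { apply HJ0; auto. intros j Hj. apply nodup_In, in_app_iff; auto. }
  change (lsum g (i :: L)) with (g i + lsum g L).
  change (length (i :: L)) with (S (length L)). rewrite S_INR.
  change (fun j => f i j) with (f i).
  replace (lsum (f i) Ji + lsum (fun x => f (fst x) (snd x)) LL - (g i + lsum g L))
    with ((lsum (f i) Ji - g i) + (lsum (fun x => f (fst x) (snd x)) LL - lsum g L)) by ring.
  eapply Rle_trans; [apply Cmod_triangle|]. lra.
Qed.

Lemma is_sum_fubini {I J} (f : I -> J -> C) (g : I -> C) l :
  is_sum (fun x : I * J => f (fst x) (snd x)) l ->
  (forall i, is_sum (f i) (g i)) -> is_sum g l.
Proof.
intros Hf Hrow eps He.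
destruct (Hf (eps/2)%R) as [L0 H0]; [lra|].
exists (map fst L0). intros L HN Hi.
(* Half of the tolerance is shared among the rows; [+ 1] keeps the divisor nonzero when [L] is
   empty. *)
set (d := (eps / 2 / (INR (length L) + 1))%R).
pose proof (pos_INR (length L)).
assert (Hd : (0 < d)%R) by (unfold d; apply Rdiv_lt_0_compat; lra).
destruct (row_cover f g L0 d L Hd Hrow HN) as [LL [HNL [Hfst [Hin Hs]]]].
assert (HL : (Cmod (lsum (fun x => f (fst x) (snd x)) LL - l) < eps / 2)%R).
{ apply H0; auto. intros x Hx. apply Hin; auto. apply Hi. now apply in_map. }
assert (INR (length L) * d <= eps / 2)%R.
{ replace (eps / 2)%R with ((INR (length L) + 1) * d)%R by (unfold d; field; lra).
  apply Rmult_le_compat_r; lra. }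
replace (lsum g L - l) with
  (- (lsum (fun x => f (fst x) (snd x)) LL - lsum g L)
   + (lsum (fun x => f (fst x) (snd x)) LL - l)) by ring.
eapply Rle_lt_trans; [apply Cmod_triangle|]. rewrite Cmod_opp. lra.
Qed.

Lemma rsum_prod {I J} (u : I -> R) (w : J -> R) L1 L2 :
  rsum (fun x : I * J => (u (fst x) * w (snd x))%R) (list_prod L1 L2) = (rsum u L1 * rsum w L2)%R.
Proof.
induction L1 as [|i L1 IH]; simpl; [ring|].
rewrite rsum_app, rsum_map, IH. cbn [fst snd]. rewrite rsum_scal. ring.
Qed.

(** A finite set of pairs lies in the rectangle of its two projections, over which the sum of moduli
    factors. *)
Lemma abs_summable_prod {I J} (f : I -> C) (g : J -> C) :
  abs_summable f -> abs_summable g -> abs_summable (fun x : I * J => f (fst x) * g (snd x)).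
Proof.
intros [M HM] [N HN]. exists (M * N)%R. intros L HL.
set (L1 := nodupI (map fst L)). set (L2 := nodupI (map snd L)).
assert (N1 : NoDup L1) by apply NoDup_nodup. assert (N2 : NoDup L2) by apply NoDup_nodup.
apply Rle_trans with (rsum (fun x : I * J => (Cmod (f (fst x)) * Cmod (g (snd x)))%R) (list_prod L1 L2)).
- eapply Rle_trans; [apply rsum_le; intros; rewrite Cmod_mult; apply Rle_refl|].
  apply rsum_incl; auto.
  + intros; apply Rmult_le_pos; apply Cmod_ge_0.
  + intros [x y] Hx. apply in_prod; apply nodup_In.
    * apply in_map_iff. now exists (x, y).
    * apply in_map_iff. now exists (x, y).
- rewrite (rsum_prod (fun i => Cmod (f i)) (fun j => Cmod (g j))).
  apply Rmult_le_compat; auto; apply rsum_ge_0; intros; apply Cmod_ge_0.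
Qed.

Lemma is_sum_prod {I J} (f : I -> C) (g : J -> C) a b :
  abs_summable f -> abs_summable g -> is_sum f a -> is_sum g b ->
  is_sum (fun x : I * J => f (fst x) * g (snd x)) (a * b).
Proof.
intros Hf Hg Ha Hb.
destruct (abs_summable_is_sum _ (abs_summable_prod f g Hf Hg)) as [l Hl].
replace (a * b) with l; auto.
apply (is_sum_unique (fun i => f i * b)).
- apply (is_sum_fubini (fun i j => f i * g j)); auto. intros i. now apply is_sum_scal.
- apply (is_sum_ext (fun i => b * f i)); [intros; ring|].
  apply (is_sum_eq _ (b * a)); [now apply is_sum_scal | ring].
Qed.

Lemma is_sum_sum {I J} (f : I + J -> C) a b :
  is_sum (fun i => f (inl i)) a -> is_sum (fun j => f (inr j)) b -> is_sum f (a + b).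
Proof.
intros Ha Hb eps He.
destruct (Ha (eps/2)%R) as [L1 H1]; [lra|]. destruct (Hb (eps/2)%R) as [L2 H2]; [lra|].
exists (map inl L1 ++ map inr L2). intros L HN Hi.
assert (Hs : exists M1 M2, Permutation L (map inl M1 ++ map inr M2)).
{ clear. induction L as [|[i|j] L [M1 [M2 IH]]].
  - now exists nil, nil.
  - exists (i :: M1), M2. simpl. now constructor.
  - exists M1, (j :: M2). rewrite IH. simpl. apply Permutation_middle. }
destruct Hs as [M1 [M2 HP]].
rewrite (lsum_perm _ _ _ HP), lsum_app, !lsum_map.
pose proof (Permutation_NoDup HP HN) as HN'.
assert (NoDup M1) by (apply NoDup_app_remove_r in HN'; now apply NoDup_map_inv in HN').
assert (NoDup M2) by (apply NoDup_app_remove_l in HN'; now apply NoDup_map_inv in HN').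
assert (Hin : forall x, In x (map inl L1 ++ map inr L2) -> In x (map inl M1 ++ map inr M2)).
{ intros x Hx. apply (Permutation_in _ HP). now apply Hi. }
assert (incl L1 M1).
{ intros i Hx. specialize (Hin (inl i)). rewrite !in_app_iff, !in_map_iff in Hin.
  destruct Hin as [[y [E Hy]]|[y [E Hy]]]; [left; now exists i | congruence | congruence]. }
assert (incl L2 M2).
{ intros i Hx. specialize (Hin (inr i)). rewrite !in_app_iff, !in_map_iff in Hin.
  destruct Hin as [[y [E Hy]]|[y [E Hy]]]; [right; now exists i | congruence | congruence]. }
match goal with |- (Cmod (?u + ?v - _) < _)%R =>
  replace (u + v - (a + b)) with ((u - a) + (v - b)) by ring end.
eapply Rle_lt_trans; [apply Cmod_triangle|].
specialize (H1 M1 H H3); specialize (H2 M2 H0 H4); lra.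
Qed.

(** Initial segments eventually contain any given finite set of indices, so unordered convergence
    yields the ordered convergence behind [CSeries]. *)
Lemma is_sum_nat_series (u : nat -> C) l :
  is_sum u l -> is_series (V := C_NormedModule) u l.
Proof.
intros H P [eps HP].
destruct (H eps (cond_pos eps)) as [L0 H0].
exists (fold_right max 0%nat L0). intros n Hn. apply HP.
assert (E : forall n, sum_n u n = lsum u (seq 0 (S n))).
{ clear. induction n as [|n IH].
  - rewrite sum_O. simpl. change (u 0%nat = u 0%nat + 0). ring.
  - rewrite sum_Sn, IH. rewrite (seq_S (S n)), lsum_app. simpl lsum at 3.
    change (lsum u (seq 0 (S n)) + u (S n) = lsum u (seq 0 (S n)) + (u (S n) + 0)). ring. }
rewrite E. apply C_NormedModule_mixin_compat1.
apply H0; [apply seq_NoDup|].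
intros i Hi. apply in_seq. pose proof (le_list_max L0 i Hi). lia.
Qed.

Lemma is_sum_CSeries (u : nat -> C) l : is_sum u l -> CSeries u = l.
Proof. intros H. apply CSeries_unique. now apply is_sum_nat_series. Qed.

Lemma is_sum_finite {I} (f : I -> C) L :
  NoDup L -> (forall i, ~ In i L -> f i = 0) -> is_sum f (lsum f L).
Proof.
intros HN H0 eps He. exists L. intros L' HN' Hi.
destruct (incl_NoDup_split L L' HN Hi) as [M HM].
rewrite (lsum_perm _ _ _ HM), lsum_app.
replace (lsum f M) with (RtoC 0).
{ replace (lsum f L + 0 - lsum f L) with (RtoC 0) by ring. now rewrite Cmod_0. }
pose proof (Permutation_NoDup HM HN') as HN2.
assert (HM0 : forall i, In i M -> f i = 0).
{ intros i Hin. apply H0. intros HL. clear -HN2 Hin HL.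
  induction L as [|j L IH]; [easy|]. inversion HN2; subst.
  destruct HL as [->|HL]; auto. apply H1. apply in_app_iff; auto. }
clear -HM0. induction M as [|j M IH]; simpl; auto.
rewrite HM0, <- IH; auto with datatypes. ring.
Qed.

Lemma is_sum_S (f : nat -> C) l : is_sum (fun n => f (S n)) l -> is_sum f (f 0%nat + l).
Proof.
intros H.
pose (h := fun x : nat => match x with O => inl tt | S n => inr n end : unit + nat).
pose (g := fun x : unit + nat => match x with inl _ => O | inr n => S n end).
apply (is_sum_ext (fun n => (fun x => f (g x)) (h n))); [now intros []|].
apply (is_sum_reindex h g (fun x => f (g x))); [now intros [] | now intros [[]|] |].
apply is_sum_sum; auto. cbn [g].
apply (is_sum_eq _ (lsum (fun _ : unit => f 0%nat) [tt])); [|simpl; ring].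
apply is_sum_finite; [repeat constructor; auto|]. intros [] Hn. destruct Hn. now left.
Qed.

Lemma is_sum_Z_split (u : Z -> C) l a b : is_sum u l ->
  is_sum (fun n => u (Z.of_nat n)) a -> is_sum (fun n => u (- Z.of_nat (S n))%Z) b -> l = a + b.
Proof.
intros Hl Ha Hb.
pose (h := fun x : nat + nat => match x with inl n => Z.of_nat n | inr n => (- Z.of_nat (S n))%Z end).
pose (g := fun z : Z => if Z.leb 0 z then inl (Z.to_nat z) else inr (Z.to_nat (- z - 1)) : nat + nat).
apply (is_sum_unique (fun x => u (h x))); [|now apply is_sum_sum].
apply (is_sum_reindex h g); auto.
- intros [n|n]; unfold g, h.
  + destruct (Z.leb_spec 0 (Z.of_nat n)); [f_equal; lia | lia].
  + destruct (Z.leb_spec 0 (- Z.of_nat (S n))); [lia | f_equal; lia].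
- intros z. unfold g, h. destruct (Z.leb_spec 0 z); lia.
Qed.

Lemma is_sum_CSeriesZ (u : Z -> C) l : abs_summable u -> is_sum u l -> CSeriesZ u = l.
Proof.
intros Hs Hl. unfold CSeriesZ.
pose proof (Csum_correct _ (abs_summable_inj Z.of_nat u ltac:(lia) Hs)) as S1.
pose proof (Csum_correct _ (abs_summable_inj (fun n => (- Z.of_nat (S n))%Z) u ltac:(cbv beta; lia) Hs)) as S2.
rewrite (is_sum_CSeries _ _ S1), (is_sum_CSeries _ _ S2).
symmetry. exact (is_sum_Z_split u l _ _ Hl S1 S2).
Qed.

Lemma is_sum_Z_fold (u : Z -> C) l : abs_summable u -> is_sum u l ->
  is_sum (fun k : nat => u (Z.of_nat (S k)) + u (- Z.of_nat (S k))%Z) (l - u 0%Z).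
Proof.
intros Hs Hl.
pose proof (Csum_correct _ (abs_summable_inj (fun n => Z.of_nat (S n)) u ltac:(cbv beta; lia) Hs)) as S1.
pose proof (Csum_correct _ (abs_summable_inj (fun n => (- Z.of_nat (S n))%Z) u ltac:(cbv beta; lia) Hs)) as S2.
rewrite (is_sum_Z_split u l _ _ Hl (is_sum_S (fun n => u (Z.of_nat n)) _ S1) S2).
refine (is_sum_eq _ _ _ (is_sum_plus _ _ _ _ S1 S2) _). simpl (Z.of_nat 0). ring.
Qed.

(** * Complex derivatives and power series *)

(** Coquelicot puts two different uniform structures on [C] (balls for [Cmod] and products of
    intervals), hence this elementary notion of neighbourhood. *)
Definition near (x : C) (P : C -> Prop) : Prop :=
  exists d : R, (0 < d)%R /\ forall y, (Cmod (y - x) < d)%R -> P y.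

Lemma near_and x (P Q : C -> Prop) : near x P -> near x Q -> near x (fun y => P y /\ Q y).
Proof.
intros [d [Hd HP]] [e [He HQ]]. exists (Rmin d e). split; [now apply Rmin_pos|].
intros y Hy. split; [apply HP | apply HQ]; eapply Rlt_le_trans; eauto; [apply Rmin_l | apply Rmin_r].
Qed.

Lemma near_imp x (P Q : C -> Prop) : (forall y, P y -> Q y) -> near x P -> near x Q.
Proof. intros H [d [Hd HP]]. exists d; split; auto. Qed.

Lemma near_self x (P : C -> Prop) : near x P -> P x.
Proof. intros [d [Hd HP]]. apply HP. now rewrite Cmod_diag. Qed.

Lemma Cmod_minus_sym x y : Cmod (x - y) = Cmod (y - x).
Proof. replace (x - y) with (- (y - x)) by ring. apply Cmod_opp. Qed.

Lemma Cmod_tri3 x y z : (Cmod (x - z) <= Cmod (x - y) + Cmod (y - z))%R.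
Proof. replace (x - z) with ((x - y) + (y - z)) by ring. apply Cmod_triangle. Qed.

Lemma near_near x (P : C -> Prop) : near x P -> near x (fun y => near y P).
Proof.
intros [d [Hd HP]]. exists (d/2)%R. split; [lra|]. intros y Hy. exists (d/2)%R. split; [lra|].
intros z Hz. apply HP. eapply Rle_lt_trans; [apply (Cmod_tri3 z y x)|]. lra.
Qed.

Definition ct (f : C -> C) (x : C) : Prop :=
  forall eps : R, (0 < eps)%R -> near x (fun y => (Cmod (f y - f x) < eps)%R).

Lemma ct_const c x : ct (fun _ => c) x.
Proof.
intros eps He. exists 1%R. split; [lra|]. intros y _. now rewrite Cmod_diag.
Qed.

Lemma ct_id x : ct (fun y => y) x.
Proof. intros eps He. exists eps; auto. Qed.

Lemma ct_plus f g x : ct f x -> ct g x -> ct (fun y => f y + g y) x.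
Proof.
intros Hf Hg eps He.
generalize (near_and x _ _ (Hf (eps/2)%R ltac:(lra)) (Hg (eps/2)%R ltac:(lra))).
apply near_imp. intros y [H1 H2].
replace (f y + g y - (f x + g x)) with ((f y - f x) + (g y - g x)) by ring.
eapply Rle_lt_trans; [apply Cmod_triangle|]. lra.
Qed.

Lemma ct_mult f g x : ct f x -> ct g x -> ct (fun y => f y * g y) x.
Proof.
intros Hf Hg eps He.
pose proof (Cmod_ge_0 (f x)) as P1. pose proof (Cmod_ge_0 (g x)) as P2.
set (k := (Cmod (f x) + Cmod (g x) + 1)%R).
assert (Hk : (0 < k)%R) by (unfold k; lra).
set (d := Rmin 1 (eps / k)).
assert (Hd : (0 < d)%R) by (apply Rmin_pos; [lra | now apply Rdiv_lt_0_compat]).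
generalize (near_and x _ _ (Hf d Hd) (Hg d Hd)).
apply near_imp. intros y [H1 H2].
replace (f y * g y - f x * g x) with
  ((f y - f x) * (g y - g x) + (f x * (g y - g x) + g x * (f y - f x))) by ring.
eapply Rle_lt_trans; [apply Cmod_triangle|].
eapply Rle_lt_trans; [apply Rplus_le_compat_l; apply Cmod_triangle|].
rewrite !Cmod_mult.
assert (D1 : (d <= 1)%R) by apply Rmin_l.
assert (D2 : (d * k <= eps)%R).
{ apply Rle_trans with (eps / k * k)%R.
  - apply Rmult_le_compat_r; [lra | apply Rmin_r].
  - right; field; lra. }
pose proof (Cmod_ge_0 (f y - f x)). pose proof (Cmod_ge_0 (g y - g x)).
unfold k in D2. nra.
Qed.

Lemma ct_nz f x : ct f x -> f x <> 0 -> near x (fun y => (Cmod (f x) / 2 < Cmod (f y))%R).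
Proof.
intros Hf Hx. apply Cmod_gt_0 in Hx.
generalize (Hf (Cmod (f x) / 2)%R ltac:(lra)). apply near_imp. intros y Hy.
assert (Cmod (f x) <= Cmod (f y) + Cmod (f y - f x))%R; [|lra].
replace (f x) with (f y + - (f y - f x)) at 1 by ring.
eapply Rle_trans; [apply Cmod_triangle|]. rewrite Cmod_opp; lra.
Qed.

Lemma ct_inv f x : ct f x -> f x <> 0 -> ct (fun y => / f y) x.
Proof.
intros Hf Hx eps He. pose proof (proj1 (Cmod_gt_0 _) Hx) as Px.
set (m := Cmod (f x)) in *.
assert (Hd : (0 < eps * (m * (m / 2)))%R) by (repeat apply Rmult_lt_0_compat; lra).
generalize (near_and x _ _ (ct_nz f x Hf Hx) (Hf _ Hd)). apply near_imp.
intros y [H1 H2]. fold m in H1.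
assert (Hy : f y <> 0) by (apply Cmod_gt_0; lra).
replace (/ f y - / f x) with (- (f y - f x) * / (f x * f y)) by (field; auto).
rewrite Cmod_mult, Cmod_opp, Cmod_inv, Cmod_mult by (now apply Cmult_neq_0). fold m.
assert (0 < m * Cmod (f y))%R by (apply Rmult_lt_0_compat; lra).
apply Rmult_lt_reg_r with (m * Cmod (f y))%R; auto.
rewrite Rmult_assoc, Rinv_l, Rmult_1_r by lra.
eapply Rlt_le_trans; [exact H2|]. apply Rmult_le_compat_l; [lra|].
apply Rmult_le_compat_l; lra.
Qed.

Lemma ct_comp f g x : ct f (g x) -> ct g x -> ct (fun y => f (g y)) x.
Proof.
intros Hf Hg eps He. destruct (Hf eps He) as [d [Hd H]].
generalize (Hg d Hd). apply near_imp. intros y Hy. now apply H.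
Qed.

Lemma ct_ext_loc f g x : near x (fun y => f y = g y) -> ct f x -> ct g x.
Proof.
intros H Hf eps He. generalize (near_and _ _ _ H (Hf eps He)). apply near_imp.
intros y [E Hy]. rewrite <- E, <- (near_self _ _ H). exact Hy.
Qed.

Lemma ct_ext f g x : (forall y, f y = g y) -> ct f x -> ct g x.
Proof. intros H. replace g with f; auto. now apply functional_extensionality. Qed.

(** Carathéodory's form of complex differentiability. *)
Definition cd (f : C -> C) (x l : C) : Prop :=
  exists phi, ct phi x /\ phi x = l /\ near x (fun y => f y = f x + (y - x) * phi y).

Lemma cd_eq f x l l' : cd f x l -> l = l' -> cd f x l'.
Proof. now intros H <-. Qed.

Lemma cd_ext_loc f g x l : near x (fun y => f y = g y) -> cd f x l -> cd g x l.
Proof.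
intros H [phi [H1 [H2 H3]]]. exists phi. repeat split; auto.
generalize (near_and _ _ _ H H3). apply near_imp. intros y [E Hy].
now rewrite <- E, <- (near_self _ _ H).
Qed.

Lemma cd_ext f g x l : (forall y, f y = g y) -> cd f x l -> cd g x l.
Proof. intros H. replace g with f; auto. now apply functional_extensionality. Qed.

Lemma cd_ct f x l : cd f x l -> ct f x.
Proof.
intros [phi [H1 [H2 H3]]].
apply (ct_ext_loc (fun y => f x + (y - x) * phi y)).
{ generalize H3; apply near_imp; auto. }
apply ct_plus; [apply ct_const|]. apply ct_mult; auto.
apply (ct_plus (fun y => y) (fun _ => - x)); [apply ct_id | apply ct_const].
Qed.

Lemma cd_const c x : cd (fun _ => c) x 0.
Proof.
exists (fun _ => RtoC 0). repeat split; [apply ct_const|]. exists 1%R; split; [lra|]. intros; cbv beta; ring.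
Qed.

Lemma cd_id x : cd (fun y => y) x 1.
Proof.
exists (fun _ => RtoC 1). repeat split; [apply ct_const|]. exists 1%R; split; [lra|]. intros; cbv beta; ring.
Qed.

Lemma cd_plus f g x a b : cd f x a -> cd g x b -> cd (fun y => f y + g y) x (a + b).
Proof.
intros [p [P1 [P2 P3]]] [q [Q1 [Q2 Q3]]]. exists (fun y => p y + q y).
repeat split; [now apply ct_plus | congruence |].
generalize (near_and _ _ _ P3 Q3). apply near_imp. intros y [-> ->]. ring.
Qed.

Lemma cd_mult f g x a b : cd f x a -> cd g x b ->
  cd (fun y => f y * g y) x (a * g x + f x * b).
Proof.
intros Hf Hg. pose proof (cd_ct _ _ _ Hg) as Cg.
destruct Hf as [p [P1 [P2 P3]]], Hg as [q [Q1 [Q2 Q3]]].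
exists (fun y => p y * g y + f x * q y).
repeat split.
- apply ct_plus; apply ct_mult; auto. apply ct_const.
- congruence.
- generalize (near_and _ _ _ P3 Q3). apply near_imp. intros y [-> E].
  rewrite E. ring.
Qed.

Lemma cd_scal f x a c : cd f x a -> cd (fun y => c * f y) x (c * a).
Proof.
intros H. eapply cd_eq; [apply (cd_mult (fun _ => c) f x 0 a); auto; apply cd_const|]. ring.
Qed.

Lemma cd_opp f x a : cd f x a -> cd (fun y => - f y) x (- a).
Proof.
intros H. apply (cd_ext (fun y => -(1) * f y)); [intros; ring|].
eapply cd_eq; [apply cd_scal; exact H | ring].
Qed.

Lemma cd_minus f g x a b : cd f x a -> cd g x b -> cd (fun y => f y - g y) x (a - b).
Proof. intros Hf Hg. apply cd_plus; auto. now apply cd_opp. Qed.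

Lemma cd_inv f x a : cd f x a -> f x <> 0 -> cd (fun y => / f y) x (- a / (f x * f x)).
Proof.
intros Hf Hx. pose proof (cd_ct _ _ _ Hf) as Cf.
destruct Hf as [p [P1 [P2 P3]]].
exists (fun y => - p y * / (f x * f y)). repeat split.
- apply ct_mult.
  + apply (ct_ext (fun y => -(1) * p y)); [intros; ring|].
    apply ct_mult; auto. apply ct_const.
  + apply ct_inv; [apply ct_mult; auto; apply ct_const | now apply Cmult_neq_0].
- rewrite P2. reflexivity.
- generalize (near_and _ _ _ P3 (ct_nz f x Cf Hx)). apply near_imp. intros y [E Hy].
  pose proof (Cmod_ge_0 (f x)).
  assert (f y <> 0) by (apply Cmod_gt_0; lra).
  apply (f_equal (fun z => z - f x)) in E.
  replace (f x + (y - x) * p y - f x) with ((y - x) * p y) in E by ring.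
  replace ((y - x) * (- p y * / (f x * f y))) with (- ((y - x) * p y) * / (f x * f y)) by ring.
  rewrite <- E. field. auto.
Qed.

Lemma cd_comp f g x a b : cd f (g x) a -> cd g x b -> cd (fun y => f (g y)) x (b * a).
Proof.
intros Hf Hg. pose proof (cd_ct _ _ _ Hg) as Cg.
destruct Hf as [p [P1 [P2 P3]]], Hg as [q [Q1 [Q2 Q3]]].
exists (fun y => q y * p (g y)). repeat split.
- apply ct_mult; auto. now apply ct_comp.
- congruence.
- destruct P3 as [d [Hd P3]].
  generalize (near_and _ _ _ Q3 (Cg d Hd)). apply near_imp. intros y [E Hy].
  rewrite (P3 _ Hy) at 1. rewrite E at 1. ring.
Qed.

Lemma cd_pow f x a n : cd f x a -> cd (fun y => f y ^ n) x (RtoC (IZR (Z.of_nat n)) * f x ^ (pred n) * a).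
Proof.
intros H. rewrite <- INR_IZR_INZ. induction n as [|n IH].
- eapply cd_eq; [exact (cd_const 1 x) | simpl; ring].
- eapply cd_eq; [apply (cd_mult f (fun y => f y ^ n)); eauto|].
  rewrite S_INR, RtoC_plus. destruct n as [|n]; [simpl; ring|].
  change (pred (S (S n))) with (S n). change (pred (S n)) with n. rewrite Cpow_S. ring.
Qed.

Lemma cd_unique f x a b : cd f x a -> cd f x b -> a = b.
Proof.
intros [p [P1 [P2 P3]]] [q [Q1 [Q2 Q3]]].
destruct (Req_dec (Cmod (a - b)) 0) as [H|H].
{ apply Cmod_eq_0 in H. replace a with (a - b + b) by ring. rewrite H; ring. }
exfalso. pose proof (Cmod_ge_0 (a - b)).
set (e := (Cmod (a - b) / 2)%R).
assert (He : (0 < e)%R) by (unfold e; lra).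
destruct (near_and _ _ _ (near_and _ _ _ P3 Q3) (near_and _ _ _ (P1 e He) (Q1 e He))) as [d [Hd HH]].
(* One point of the neighbourhood other than [x] suffices: both difference quotients coincide there,
   yet lie within half of [Cmod (a - b)] of [a] and of [b]. *)
set (y := x + RtoC (d / 2)).
assert (Hy : y - x = RtoC (d / 2)) by (unfold y; ring).
destruct (HH y) as [[E1 E2] [L1 L2]].
{ rewrite Hy, Cmod_R, Rabs_pos_eq; lra. }
assert (Hnz : y - x <> 0).
{ rewrite Hy. intros E. apply RtoC_inj in E. lra. }
assert (E : p y = q y).
{ rewrite E1 in E2.
  replace (p y) with (/ (y - x) * (f x + (y - x) * p y - f x)) by (field; auto).
  rewrite E2. field; auto. }
rewrite E, P2 in L1. rewrite Q2 in L2.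
pose proof (Cmod_tri3 a (q y) b) as H1. rewrite (Cmod_minus_sym a (q y)) in H1. unfold e in *. lra.
Qed.

(** A second order Taylor bound is what termwise estimates of power series provide; this converts it
    into differentiability. *)
Lemma cd_of_quadratic f x l M :
  near x (fun y => (Cmod (f y - f x - (y - x) * l) <= M * Cmod (y - x) ^ 2)%R) -> cd f x l.
Proof.
intros H.
(* The Carathéodory factor is the difference quotient, completed by the value [l] at [x]. *)
exists (fun y => if eq_dec_cl C y x then l else (f y - f x) / (y - x)).
assert (E : (if eq_dec_cl C x x then l else (f x - f x) / (x - x)) = l).
{ destruct (eq_dec_cl C x x); congruence. }
repeat split; auto.
- intros eps He. cbv beta. rewrite E.
  destruct H as [d [Hd H]].
  exists (Rmin d (eps / (Rabs M + 1))). pose proof (Rabs_pos M).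
  split; [apply Rmin_pos; auto; apply Rdiv_lt_0_compat; lra|].
  intros y Hy. destruct (eq_dec_cl C y x) as [->|Hn].
  { now rewrite Cmod_diag. }
  assert (Hnz : y - x <> 0).
  { intros Z. apply Hn. replace y with (y - x + x) by ring. rewrite Z; ring. }
  pose proof (proj1 (Cmod_gt_0 _) Hnz) as Hp.
  specialize (H y (Rlt_le_trans _ _ _ Hy (Rmin_l _ _))).
  replace ((f y - f x) / (y - x) - l) with ((f y - f x - (y - x) * l) * / (y - x)) by (field; auto).
  rewrite Cmod_mult, Cmod_inv by auto.
  pose proof (Rlt_le_trans _ _ _ Hy (Rmin_r _ _)) as Hy2.
  apply Rmult_lt_reg_r with (Cmod (y - x)); auto.
  rewrite Rmult_assoc, Rinv_l, Rmult_1_r by lra.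
  eapply Rle_lt_trans; [exact H|].
  simpl. rewrite Rmult_1_r, <- Rmult_assoc. apply Rmult_lt_compat_r; auto.
  apply Rle_lt_trans with (Rabs M * Cmod (y - x))%R.
  { apply Rmult_le_compat_r; [lra | apply Rle_abs]. }
  apply Rle_lt_trans with (Rabs M * (eps / (Rabs M + 1)))%R.
  { apply Rmult_le_compat_l; lra. }
  apply Rmult_lt_reg_r with (Rabs M + 1)%R; [lra|]. field_simplify; lra.
- exists 1%R. split; [lra|]. intros y _. destruct (eq_dec_cl C y x) as [->|Hn]; [ring|].
  field. intros Z. apply Hn. replace y with (y - x + x) by ring. rewrite Z; ring.
Qed.

(** Passage to the library derivative of the final statement: the error of the linear approximation
    is [(y - x) * (phi y - phi x)]. *)
Lemma cd_is_derive f x l : cd f x l -> is_derive (K := C_AbsRing) (V := C_NormedModule) f x l.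
Proof.
intros [phi [H1 [H2 H3]]]. split.
- apply is_linear_scal_l.
- intros x' Hx'. pose proof (@is_filter_lim_locally_unique C_AbsRing (AbsRing_NormedModule C_AbsRing) x x' Hx') as E'. subst x'. intros eps.
  generalize (near_and _ _ _ H3 (H1 eps (cond_pos eps))). intros [d [Hd H]].
  exists (mkposreal d Hd). intros y Hy. change (Cmod (y - x) < d)%R in Hy.
  destruct (H y Hy) as [E Hl].
  change (Cmod (f y - f x - (y - x) * l) <= eps * Cmod (y - x))%R.
  rewrite E, <- H2. replace (f x + (y - x) * phi y - f x - (y - x) * phi x) with
    ((y - x) * (phi y - phi x)) by ring.
  rewrite Cmod_mult, Rmult_comm. apply Rmult_le_compat_r; [apply Cmod_ge_0 | lra].
Qed.

Definition seg (x y : C) (s : R) : C := x + RtoC s * (y - x).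

Lemma cd_real_derive f (x : R) l : cd f (RtoC x) l ->
  is_derive (fun y : R => Re (f (RtoC y))) x (Re l).
Proof.
intros [phi [H1 [H2 H3]]]. apply is_derive_Reals. intros eps He.
destruct (near_and _ _ _ H3 (H1 eps He)) as [d [Hd HH]].
exists (mkposreal d Hd). intros h Hh0 Hh. simpl in Hh.
assert (Eh : RtoC (x + h) - RtoC x = RtoC h) by (rewrite RtoC_plus; ring).
destruct (HH (RtoC (x + h))) as [E L]; [now rewrite Eh, Cmod_R|].
rewrite E, Eh.
replace ((Re (f (RtoC x) + RtoC h * phi (RtoC (x + h)))%C - Re (f (RtoC x))) / h - Re l)%R
  with (Re (phi (RtoC (x + h)) - phi (RtoC x))).
- eapply Rle_lt_trans; [apply re_le_Cmod | exact L].
- rewrite H2. destruct (f (RtoC x)), (phi (RtoC (x + h))), l. simpl. field. auto.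
Qed.

Lemma Re_const_unit_interval f : (forall s : R, (0 <= s <= 1)%R -> ct f s) ->
  (forall s : R, (0 < s < 1)%R -> cd f s 0) -> Re (f 0) = Re (f 1).
Proof.
intros Hc Hd. destruct (MVT_gen (fun s : R => Re (f s)) 0 1 (fun _ => 0%R)) as [c [_ Hcc]]; [| |lra].
- intros s Hs. rewrite Rmin_left, Rmax_right in Hs by lra. apply (cd_real_derive f s 0). now apply Hd.
- intros s Hs. rewrite Rmin_left, Rmax_right in Hs by lra. intros eps He.
  destruct (Hc s Hs eps He) as [d [Hdp HH]]. exists d. split; [exact Hdp|]. intros t [_ Ht].
  eapply Rle_lt_trans; [apply (re_le_Cmod (f t - f s))|]. apply HH. now rewrite <- RtoC_minus, Cmod_R.
Qed.

(** The mean value theorem is real, so it is applied to the real parts of [f] and of [Ci * f] along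
    the segment. The derivative is asked for at interior points only, which later allows an endpoint
    at the origin. *)
Lemma const_on_segment f x y :
  (forall s, (0 <= s <= 1)%R -> ct f (seg x y s)) ->
  (forall s, (0 < s < 1)%R -> cd f (seg x y s) 0) -> f x = f y.
Proof.
intros Hc Hd. set (h := fun z => x + z * (y - x)).
assert (Hh : forall z, cd h z (y - x)).
{ intros z. eapply cd_eq; [apply cd_plus; [apply cd_const | apply (cd_mult (fun z => z) (fun _ => y - x)); [apply cd_id | apply cd_const]]|]. ring. }
assert (G : forall k, Re (k * f x) = Re (k * f y)).
{ intros k. replace (f x) with (f (h 0)) by (unfold h; f_equal; ring).
  replace (f y) with (f (h 1)) by (unfold h; f_equal; ring).
  apply (Re_const_unit_interval (fun z => k * f (h z))).
  - intros s Hs. apply ct_mult; [apply ct_const|]. apply ct_comp; [now apply Hc | exact (cd_ct _ _ _ (Hh s))].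
  - intros s Hs. eapply cd_eq; [apply cd_scal, (cd_comp f h _ 0 (y - x)); [now apply Hd | apply Hh] | ring]. }
pose proof (G 1) as G1. pose proof (G Ci) as G2.
destruct (f x) as [u v], (f y) as [u' v']. simpl in *. f_equal; lra.
Qed.

(** With [d = y - x], the remainders satisfy [D_(m+1) = m x^(m-1) d^2 + y D_m], and
    [m + m^2 <= (m + 1)^2] closes the induction. The factor [r ^ 2] on the left avoids the exponent
    [m - 2]. *)
Lemma Cpow_taylor2 (x y : C) (r : R) (m : nat) :
  (0 < r)%R -> (Cmod x <= r)%R -> (Cmod y <= r)%R ->
  (Cmod (y ^ m - x ^ m - (y - x) * (RtoC (INR m) * x ^ pred m)) * r ^ 2
     <= INR m ^ 2 * r ^ m * Cmod (y - x) ^ 2)%R.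
Proof.
intros Hr Hx Hy. induction m as [|m IH].
- simpl. replace (1 - 1 - (y - x) * (RtoC 0 * 1)) with (RtoC 0) by ring. rewrite Cmod_0. lra.
- set (d := y - x) in *.
  replace (y ^ S m - x ^ S m - d * (RtoC (INR (S m)) * x ^ pred (S m))) with
    (RtoC (INR m) * x ^ pred m * d ^ 2 + y * (y ^ m - x ^ m - d * (RtoC (INR m) * x ^ pred m))).
  2:{ rewrite S_INR, RtoC_plus. unfold d. destruct m as [|m]; [simpl; ring|].
      change (pred (S m)) with m. change (pred (S (S m))) with (S m). rewrite !Cpow_S. ring. }
  set (D := y ^ m - x ^ m - d * (RtoC (INR m) * x ^ pred m)) in *.
  pose proof (pos_INR m) as Hm. pose proof (Cmod_ge_0 d) as Hd0. pose proof (Cmod_ge_0 D) as HD.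
  apply Rle_trans with ((Cmod (RtoC (INR m) * x ^ pred m * d ^ 2) + Cmod (y * D)) * r ^ 2)%R.
  { apply Rmult_le_compat_r; [apply pow2_ge_0 | apply Cmod_triangle]. }
  rewrite !Cmod_mult, !Cmod_pow, Cmod_R, Rabs_pos_eq by auto.
  assert (H1 : (INR m * Cmod x ^ pred m * r ^ 2 <= INR m * r ^ S m)%R).
  { destruct m as [|m]; [simpl; lra|]. change (pred (S m)) with m.
    replace (r ^ S (S m))%R with (r ^ m * r ^ 2)%R by (simpl; ring).
    rewrite Rmult_assoc. apply Rmult_le_compat_l; auto.
    apply Rmult_le_compat_r; [apply pow2_ge_0|]. apply pow_incr. split; auto. apply Cmod_ge_0. }
  assert (H2 : (Cmod y * Cmod D * r ^ 2 <= r * (INR m ^ 2 * r ^ m * Cmod d ^ 2))%R).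
  { rewrite Rmult_assoc. apply Rmult_le_compat; auto; [apply Cmod_ge_0|].
    apply Rmult_le_pos; auto. apply pow2_ge_0. }
  rewrite Rmult_plus_distr_r.
  apply Rle_trans with (INR m * r ^ S m * Cmod d ^ 2 + r * (INR m ^ 2 * r ^ m * Cmod d ^ 2))%R.
  { apply Rplus_le_compat; auto.
    replace (INR m * Cmod x ^ pred m * Cmod d ^ 2 * r ^ 2)%R with
      (INR m * Cmod x ^ pred m * r ^ 2 * Cmod d ^ 2)%R by ring.
    apply Rmult_le_compat_r; auto. apply pow2_ge_0. }
  replace (INR m * r ^ S m * Cmod d ^ 2 + r * (INR m ^ 2 * r ^ m * Cmod d ^ 2))%R with
    ((INR m + INR m ^ 2) * r ^ S m * Cmod d ^ 2)%R by (simpl; ring).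
  apply Rmult_le_compat_r; [apply pow2_ge_0|]. apply Rmult_le_compat_r; [apply pow_le; lra|].
  rewrite S_INR. nra.
Qed.

(** The index type and the exponent map are arbitrary, so a theta series over [Z] is a power series
    without collecting equal exponents. *)
Definition pseries {I} (a : I -> C) (e : I -> nat) (x : C) : C := Csum (fun i => a i * x ^ e i).

(** The weight [(e + 1)^2] dominates both the termwise derivative and the second order remainder of
    [Cpow_taylor2]. *)
Definition pseries_conv {I} (a : I -> C) (e : I -> nat) : Prop :=
  forall r : R, (0 < r < 1)%R -> abs_summable (fun i => a i * RtoC ((INR (e i) + 1) ^ 2 * r ^ e i)).

Definition dpseries {I} (a : I -> C) (e : I -> nat) (x : C) : C :=
  Csum (fun i => a i * (RtoC (INR (e i)) * x ^ pred (e i))).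

Lemma pseries_conv_le {I} (a : I -> C) (e : I -> nat) (b : I -> C) r :
  pseries_conv a e -> (0 < r < 1)%R ->
  (forall i, (Cmod (b i) <= (INR (e i) + 1) ^ 2 * r ^ e i)%R) ->
  abs_summable (fun i => a i * b i).
Proof.
intros H Hr Hb. apply (abs_summable_le _ (fun i => a i * RtoC ((INR (e i) + 1) ^ 2 * r ^ e i))).
- intros i. rewrite !Cmod_mult. apply Rmult_le_compat_l; [apply Cmod_ge_0|].
  rewrite Cmod_R. eapply Rle_trans; [apply Hb | apply Rle_abs].
- now apply H.
Qed.

Lemma mid_radius (x : C) : (Cmod x < 1)%R ->
  (0 < (1 + Cmod x) / 2 < 1)%R /\ (Cmod x < (1 + Cmod x) / 2)%R.
Proof. intros H. pose proof (Cmod_ge_0 x). lra. Qed.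

Lemma pseries_abs {I} (a : I -> C) (e : I -> nat) x :
  pseries_conv a e -> (Cmod x < 1)%R -> abs_summable (fun i => a i * x ^ e i).
Proof.
intros H Hx. destruct (mid_radius x Hx) as [H1 H2].
apply (pseries_conv_le a e _ _ H H1). intros i. rewrite Cmod_pow.
rewrite <- (Rmult_1_l (Cmod x ^ e i)). pose proof (pos_INR (e i)).
apply Rmult_le_compat; [lra | apply pow_le, Cmod_ge_0 | nra | ].
apply pow_incr. split; [apply Cmod_ge_0 | lra].
Qed.

Lemma is_sum_pseries {I} (a : I -> C) (e : I -> nat) x :
  pseries_conv a e -> (Cmod x < 1)%R -> is_sum (fun i => a i * x ^ e i) (pseries a e x).
Proof. intros H Hx. apply Csum_correct. now apply pseries_abs. Qed.

Lemma dpseries_abs {I} (a : I -> C) (e : I -> nat) x :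
  pseries_conv a e -> (Cmod x < 1)%R ->
  abs_summable (fun i => a i * (RtoC (INR (e i)) * x ^ pred (e i))).
Proof.
intros H Hx. destruct (mid_radius x Hx) as [H1 H2]. set (r := ((1 + Cmod x) / 2)%R) in *.
apply (abs_summable_le _ (fun i => RtoC (/ r) * (a i * RtoC ((INR (e i) + 1) ^ 2 * r ^ e i)))).
2:{ apply abs_summable_scal. now apply H. }
intros i. rewrite !Cmod_mult, Cmod_pow, !Cmod_R.
assert (0 < / r)%R by (apply Rinv_0_lt_compat; lra).
rewrite (Rabs_pos_eq (/ r)) by lra. pose proof (pos_INR (e i)).
rewrite (Rabs_pos_eq (INR _)) by auto.
rewrite (Rabs_pos_eq (_ * _)).
2:{ apply Rmult_le_pos; [nra | apply pow_le; lra]. }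
rewrite <- Rmult_assoc, (Rmult_comm (/ r)), Rmult_assoc.
rewrite (Rmult_assoc (Cmod (a i))).
apply Rmult_le_compat_l; [apply Cmod_ge_0|].
destruct (e i) as [|m] eqn:E.
{ simpl. rewrite Rmult_0_l. apply Rmult_le_pos; lra. }
change (pred (S m)) with m.
replace ((INR (S m) + 1) ^ 2 * r ^ S m * / r)%R with ((INR (S m) + 1) ^ 2 * r ^ m)%R
  by (change (r ^ S m)%R with (r * r ^ m)%R; field; lra).
apply Rmult_le_compat; [exact H3 | apply pow_le, Cmod_ge_0 | nra | ].
apply pow_incr. split; [apply Cmod_ge_0 | lra].
Qed.

(** The bound of [Cpow_taylor2] is summed over the terms at a radius strictly between [Cmod x] and
    1. *)
Lemma cd_pseries {I} (a : I -> C) (e : I -> nat) x :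
  pseries_conv a e -> (Cmod x < 1)%R -> cd (pseries a e) x (dpseries a e x).
Proof.
intros H Hx. destruct (mid_radius x Hx) as [H1 H2]. set (r := ((1 + Cmod x) / 2)%R) in *.
destruct (H r H1) as [M HM].
apply (cd_of_quadratic _ _ _ (M / r ^ 2)).
exists (r - Cmod x)%R. split; [lra|]. intros y Hy.
assert (Hyr : (Cmod y <= r)%R).
{ replace y with (x + (y - x)) by ring. eapply Rle_trans; [apply Cmod_triangle | lra]. }
pose proof (is_sum_pseries a e x H Hx) as S1.
pose proof (is_sum_pseries a e y H ltac:(lra)) as S2.
pose proof (Csum_correct _ (dpseries_abs a e x H Hx)) as S3. fold (dpseries a e x) in S3.
pose proof (is_sum_minus _ _ _ _ (is_sum_minus _ _ _ _ S2 S1) (is_sum_scal _ _ (y - x) S3)) as S4.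
apply (is_sum_bound _ _ _ S4).
intros L HN. specialize (HM L HN).
assert (Hr2 : (0 < r ^ 2)%R) by (apply pow_lt; lra).
apply Rle_trans with (rsum (fun i => (Cmod (y - x) ^ 2 / r ^ 2 *
  Cmod (a i * RtoC ((INR (e i) + 1) ^ 2 * r ^ e i)))%R) L).
- apply rsum_le. intros i.
  replace (a i * y ^ e i - a i * x ^ e i - (y - x) * (a i * (RtoC (INR (e i)) * x ^ pred (e i))))
    with (a i * (y ^ e i - x ^ e i - (y - x) * (RtoC (INR (e i)) * x ^ pred (e i)))) by ring.
  rewrite !Cmod_mult.
  replace (Cmod (y - x) ^ 2 / r ^ 2 * (Cmod (a i) * Cmod (RtoC ((INR (e i) + 1) ^ 2 * r ^ e i))))%R
    with (Cmod (a i) * (Cmod (y - x) ^ 2 / r ^ 2 * Cmod (RtoC ((INR (e i) + 1) ^ 2 * r ^ e i))))%R by ring.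
  apply Rmult_le_compat_l; [apply Cmod_ge_0|].
  apply Rmult_le_reg_r with (r ^ 2)%R; auto.
  eapply Rle_trans; [apply Cpow_taylor2; lra|].
  pose proof (pos_INR (e i)).
  assert (0 <= r ^ e i)%R by (apply pow_le; lra).
  rewrite Cmod_R, Rabs_pos_eq by (apply Rmult_le_pos; [apply pow2_ge_0 | auto]).
  replace (Cmod (y - x) ^ 2 / r ^ 2 * ((INR (e i) + 1) ^ 2 * r ^ e i) * r ^ 2)%R with
    ((INR (e i) + 1) ^ 2 * r ^ e i * Cmod (y - x) ^ 2)%R by (field; lra).
  apply Rmult_le_compat_r; [apply pow2_ge_0|]. apply Rmult_le_compat_r; auto. nra.
- rewrite rsum_scal.
  replace (M / r ^ 2 * Cmod (y - x) ^ 2)%R with (Cmod (y - x) ^ 2 / r ^ 2 * M)%R by (field; lra).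
  apply Rmult_le_compat_l; auto.
  apply Rmult_le_pos; [apply pow2_ge_0 | left; now apply Rinv_0_lt_compat].
Qed.

Lemma geom_bound (r : R) : (0 <= r < 1)%R -> forall L, NoDup L -> (rsum (fun n => r ^ n) L <= / (1 - r))%R.
Proof.
intros Hr. apply rsum_nat_le; [intros; apply pow_le; lra|]. intros N.
assert (E : (rsum (fun n => r ^ n) (seq 0 N) = (1 - r ^ N) / (1 - r))%R).
{ induction N as [|N IH]; [simpl; field; lra|].
  rewrite seq_S, rsum_app, IH. simpl. field. lra. }
rewrite E. unfold Rdiv. rewrite <- (Rmult_1_l (/ (1 - r))) at 2.
apply Rmult_le_compat_r; [left; apply Rinv_0_lt_compat; lra|].
pose proof (pow_le r N (proj1 Hr)). lra.
Qed.

(** Each of the [n + 1] powers [t^0, ..., t^n] is at least [t^n], and together they stay below the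
    geometric series. *)
Lemma pow_lin_bound (t : R) (n : nat) : (0 <= t < 1)%R -> ((INR n + 1) * t ^ n <= / (1 - t))%R.
Proof.
intros Ht. eapply Rle_trans; [|apply (geom_bound t Ht (seq 0 (S n)) (seq_NoDup _ _))].
assert (G : forall m k, (k <= S n)%nat -> (m = k) -> (INR k * t ^ n <= rsum (fun n => t ^ n) (seq 0 k))%R).
{ intros m k Hk ->. induction k as [|k IH]; [simpl; lra|].
  rewrite seq_S, rsum_app, S_INR.
  assert (t ^ n <= t ^ k)%R.
  { replace n with (k + (n - k))%nat by lia. rewrite pow_add.
    rewrite <- (Rmult_1_r (t ^ k)) at 2. apply Rmult_le_compat_l; [apply pow_le; lra|].
    rewrite <- (pow1 (n - k)). apply pow_incr; lra. }
  specialize (IH ltac:(lia)). simpl rsum. lra. }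
rewrite <- S_INR. now apply (G (S n)).
Qed.

Lemma geom_poly_summable (k : nat) (r : R) :
  (0 <= r < 1)%R -> abs_summable (fun n : nat => RtoC ((INR n + 1) ^ k * r ^ n)).
Proof.
revert r; induction k as [|k IH]; intros r Hr.
- exists (/ (1 - r))%R. intros L HN. eapply Rle_trans; [|apply (geom_bound r Hr L HN)].
  apply rsum_le. intros n. rewrite Cmod_R, Rabs_pos_eq; simpl; rewrite Rmult_1_l; [lra|].
  apply pow_le; lra.
(* Writing [r^n = s^n s^n], one factor absorbs [n + 1] and the other carries the induction
   hypothesis. *)
- set (s := sqrt r).
  assert (Hs : (0 <= s < 1)%R).
  { split; [apply sqrt_pos|]. rewrite <- sqrt_1. apply sqrt_lt_1; lra. }
  assert (Hss : (s * s = r)%R) by (apply sqrt_sqrt; lra).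
  apply (abs_summable_le _ (fun n => RtoC (/ (1 - s)) * RtoC ((INR n + 1) ^ k * s ^ n))).
  2:{ apply abs_summable_scal. now apply IH. }
  intros n. rewrite <- RtoC_mult, !Cmod_R.
  pose proof (pos_INR n). pose proof (pow_le s n (proj1 Hs)).
  assert (0 <= (INR n + 1) ^ k)%R by (apply pow_le; lra).
  assert (0 < / (1 - s))%R by (apply Rinv_0_lt_compat; lra).
  rewrite <- Hss, Rpow_mult_distr.
  rewrite !Rabs_pos_eq.
  + simpl. replace ((INR n + 1) * (INR n + 1) ^ k * (s ^ n * s ^ n))%R with
      (((INR n + 1) * s ^ n) * ((INR n + 1) ^ k * s ^ n))%R by ring.
    apply Rmult_le_compat_r; [now apply Rmult_le_pos | now apply pow_lin_bound].
  + repeat apply Rmult_le_pos; auto; lra.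
  + simpl. repeat apply Rmult_le_pos; auto; lra.
Qed.

(** Absolute value is injective on each half-line, hence the bound [M + M]. *)
Lemma abs_summable_Z_of_nat (u : nat -> C) :
  abs_summable u -> abs_summable (fun z : Z => u (Z.abs_nat z)).
Proof.
intros [M HM]. exists (M + M)%R. intros L HN.
assert (E : rsum (fun z => Cmod (u (Z.abs_nat z))) L =
  (rsum (fun n => Cmod (u n)) (map Z.abs_nat (filter (fun z => Z.leb 0 z) L)) +
   rsum (fun n => Cmod (u n)) (map Z.abs_nat (filter (fun z => negb (Z.leb 0 z)) L)))%R).
{ clear. induction L as [|z L IH]; simpl; [ring|].
  rewrite IH. destruct (Z.leb 0 z); simpl; ring. }
rewrite E. apply Rplus_le_compat; apply HM.
- apply NoDup_map_NoDup_ForallPairs; [|now apply NoDup_filter].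
  intros x y Hx Hy. apply filter_In in Hx, Hy. destruct Hx as [_ Hx], Hy as [_ Hy].
  apply Z.leb_le in Hx, Hy. lia.
- apply NoDup_map_NoDup_ForallPairs; [|now apply NoDup_filter].
  intros x y Hx Hy. apply filter_In in Hx, Hy. destruct Hx as [_ Hx], Hy as [_ Hy].
  apply Bool.negb_true_iff, Z.leb_gt in Hx, Hy. lia.
Qed.

(** * Theta series as lattice sums *)

Ltac cnz := repeat split; auto; try (let Z := fresh in intros Z; apply RtoC_inj in Z; lra).

Lemma zpow_add (x : C) a b : (0 <= a)%Z -> (0 <= b)%Z ->
  x ^ Z.to_nat a * x ^ Z.to_nat b = x ^ Z.to_nat (a + b).
Proof. intros. rewrite <- Cpow_add_r. f_equal. lia. Qed.

Lemma zpow_mul (x : C) (k : nat) a : (0 <= a)%Z ->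
  (x ^ k) ^ Z.to_nat a = x ^ Z.to_nat (Z.of_nat k * a).
Proof. intros. rewrite <- Cpow_mult_r. f_equal. nia. Qed.

Definition theta_exp (n : Z) : nat := Z.to_nat (n * n).

(** [T 0] is [theta_3] as a function of the nome [p = exp (pi i tau)]; replacing [p] by [- p] gives [theta_4]. *)
Definition T (j : nat) : C -> C := pseries (fun n : Z => RtoC (IZR n ^ j)) theta_exp.
Definition dT (j : nat) : C -> C := dpseries (fun n : Z => RtoC (IZR n ^ j)) theta_exp.

(** [theta_2 = p^(1/4) * Psi p]. *)
Definition Psi : C -> C := pseries (fun _ : Z => RtoC 1) (fun n => Z.to_nat (n * n + n)).

(** Exponents of at most quadratic growth turn the weight into a fourth power of [|n| + 1]; at least
    linear growth gives [r^e <= r^|n| / r]. The successors accommodate [n^2 + n], which vanishes at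
    [n = -1]. *)
Lemma pseries_conv_Z (a : Z -> C) (e : Z -> nat) (k : nat) :
  (forall n, (Cmod (a n) <= (INR (Z.abs_nat n) + 1) ^ k)%R) ->
  (forall n, (S (e n) <= (Z.abs_nat n + 1) * (Z.abs_nat n + 1))%nat) ->
  (forall n, (Z.abs_nat n <= S (e n))%nat) -> pseries_conv a e.
Proof.
intros Ha He1 He2 r Hr.
apply (abs_summable_le _ (fun n => RtoC (/ r) *
  (fun m : nat => RtoC ((INR m + 1) ^ (k + 4) * r ^ m)) (Z.abs_nat n))).
2:{ apply abs_summable_scal. apply (abs_summable_Z_of_nat (fun m => RtoC ((INR m + 1) ^ (k + 4) * r ^ m))).
    apply geom_poly_summable. lra. }
intros n. specialize (Ha n); specialize (He1 n); specialize (He2 n).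
set (m := Z.abs_nat n) in *. pose proof (pos_INR m). pose proof (pos_INR (e n)).
cbv beta. rewrite !Cmod_mult, !Cmod_R.
assert (0 < / r)%R by (apply Rinv_0_lt_compat; lra).
rewrite (Rabs_pos_eq (/ r)) by lra.
rewrite !Rabs_pos_eq.
2:{ apply Rmult_le_pos; apply pow_le; lra. }
2:{ apply Rmult_le_pos; apply pow_le; lra. }
rewrite pow_add.
replace (/ r * ((INR m + 1) ^ k * (INR m + 1) ^ 4 * r ^ m))%R with
  ((INR m + 1) ^ k * ((INR m + 1) ^ 4 * (/ r * r ^ m)))%R by ring.
apply Rmult_le_compat; auto; [apply Cmod_ge_0 | apply Rmult_le_pos; apply pow_le; lra |].
apply Rmult_le_compat; [apply pow_le; lra | apply pow_le; lra | |].
- replace ((INR m + 1) ^ 4)%R with (((INR m + 1) * (INR m + 1)) ^ 2)%R by ring.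
  apply pow_incr. split; [lra|]. apply le_INR in He1.
  rewrite S_INR, mult_INR, !plus_INR in He1. simpl (INR 1) in He1. lra.
- apply Rmult_le_reg_l with r; [lra|]. rewrite <- Rmult_assoc, Rinv_r, Rmult_1_l by lra.
  change (r * r ^ e n)%R with (r ^ S (e n))%R.
  replace (S (e n)) with (m + (S (e n) - m))%nat by lia. rewrite pow_add.
  rewrite <- (Rmult_1_r (r ^ m)) at 2. apply Rmult_le_compat_l; [apply pow_le; lra|].
  rewrite <- (pow1 (S (e n) - m)). apply pow_incr; lra.
Qed.

Lemma T_conv j : pseries_conv (fun n : Z => RtoC (IZR n ^ j)) theta_exp.
Proof.
apply (pseries_conv_Z _ _ j); unfold theta_exp.
- intros n. rewrite Cmod_R, <- RPow_abs. apply pow_incr. split; [apply Rabs_pos|].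
  rewrite <- abs_IZR, INR_IZR_INZ, Zabs2Nat.id_abs. lra.
- intros n. nia.
- intros n. nia.
Qed.

Lemma Psi_conv : pseries_conv (fun _ : Z => RtoC 1) (fun n => Z.to_nat (n * n + n)).
Proof.
apply (pseries_conv_Z _ _ 0).
- intros n. rewrite Cmod_R, Rabs_R1. simpl; lra.
- intros n. nia.
- intros n. nia.
Qed.

Lemma is_sum_T j x : (Cmod x < 1)%R -> is_sum (fun n => RtoC (IZR n ^ j) * x ^ theta_exp n) (T j x).
Proof. apply is_sum_pseries, T_conv. Qed.

Lemma T_abs j x : (Cmod x < 1)%R -> abs_summable (fun n => RtoC (IZR n ^ j) * x ^ theta_exp n).
Proof. apply pseries_abs, T_conv. Qed.

Lemma is_sum_T0 x : (Cmod x < 1)%R -> is_sum (fun n => x ^ Z.to_nat (n * n)) (T 0 x).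
Proof.
intros Hx. generalize (is_sum_T 0 x Hx). apply is_sum_ext. intros n. simpl. unfold theta_exp. ring.
Qed.

Lemma T0_abs x : (Cmod x < 1)%R -> abs_summable (fun n => x ^ Z.to_nat (n * n)).
Proof.
intros Hx. apply (abs_summable_le _ (fun n => RtoC (IZR n ^ 0) * x ^ theta_exp n)); [|now apply T_abs].
intros n. simpl pow. rewrite Cmult_1_l. unfold theta_exp. lra.
Qed.

Lemma is_sum_Psi x : (Cmod x < 1)%R -> is_sum (fun n => x ^ Z.to_nat (n * n + n)) (Psi x).
Proof.
intros Hx. generalize (is_sum_pseries _ _ x Psi_conv Hx). apply is_sum_ext. intros n. ring.
Qed.

Lemma Psi_abs x : (Cmod x < 1)%R -> abs_summable (fun n => x ^ Z.to_nat (n * n + n)).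
Proof.
intros Hx. apply (abs_summable_le _ (fun n : Z => RtoC 1 * x ^ Z.to_nat (n * n + n))).
- intros n. rewrite Cmult_1_l. lra.
- now apply (pseries_abs _ _ x Psi_conv).
Qed.

Lemma cd_T j x : (Cmod x < 1)%R -> cd (T j) x (dT j x).
Proof. apply cd_pseries, T_conv. Qed.

(** The exponent [n^2] brought down by differentiation raises the weight [n^j] by two, so the family
    [T] is closed under [p d/dp]. *)
Lemma mul_dT j x : (Cmod x < 1)%R -> x * dT j x = T (j + 2) x.
Proof.
intros Hx. symmetry. apply Csum_eq.
pose proof (Csum_correct _ (dpseries_abs _ _ x (T_conv j) Hx)) as S.
apply (is_sum_scal _ _ x) in S. revert S. apply is_sum_ext. intros n.
assert (E : RtoC (INR (theta_exp n)) = RtoC (IZR n ^ 2)).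
{ unfold theta_exp. rewrite INR_IZR_INZ, Z2Nat.id by nia. rewrite mult_IZR. f_equal. simpl; ring. }
rewrite pow_add, RtoC_mult, <- E.
destruct (theta_exp n) as [|m] eqn:En; [simpl; ring|].
change (pred (S m)) with m. rewrite Cpow_S. ring.
Qed.

Lemma T_at_0 j : T j 0 = RtoC (0 ^ j).
Proof.
apply Csum_eq. eapply is_sum_eq; [apply (is_sum_finite _ [0%Z])|].
- repeat constructor; auto.
- intros n Hn. unfold theta_exp. replace (Z.to_nat (n * n)) with (S (pred (Z.to_nat (n * n)))).
  + rewrite Cpow_S. ring.
  + assert (n <> 0)%Z by (intros ->; apply Hn; now left). nia.
- simpl. ring.
Qed.

Lemma dT_at_0 j : dT j 0 = RtoC (1 + (-1) ^ j).
Proof.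
apply Csum_eq. eapply is_sum_eq; [apply (is_sum_finite _ [1%Z; (-1)%Z])|].
- repeat constructor; simpl; intuition lia.
- intros n Hn. unfold theta_exp. destruct (Z.eq_dec n 0) as [->|H0]; [simpl; ring|].
  replace (pred (Z.to_nat (n * n))) with (S (pred (pred (Z.to_nat (n * n))))).
  + rewrite Cpow_S. ring.
  + assert (n <> 1 /\ n <> -1)%Z by (split; intros ->; apply Hn; simpl; auto). nia.
- simpl. unfold theta_exp. simpl. rewrite pow1, RtoC_plus. ring.
Qed.

(** * Doubling identities for theta constants *)

Lemma Cmod_pow_lt_1 x n : (Cmod x < 1)%R -> (0 < n)%nat -> (Cmod (x ^ n) < 1)%R.
Proof.
intros Hx Hn. rewrite Cmod_pow. apply Rle_lt_trans with (Cmod x ^ 1)%R; [|lra].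
replace n with (1 + pred n)%nat by lia. rewrite pow_add.
rewrite <- (Rmult_1_r (Cmod x ^ 1)) at 2. pose proof (Cmod_ge_0 x).
apply Rmult_le_compat_l; [lra|]. rewrite <- (pow1 (pred n)). apply pow_incr; lra.
Qed.

(** Pairs [(m, n)] of equal parity are [(u + v, u - v)] with [m^2 + n^2 = 2 u^2 + 2 v^2]. Those of
    opposite parity are [(u + v + 1, u - v)] with [m^2 + n^2 = 2 (u^2 + u) + 2 (v^2 + v) + 1]. *)
Lemma T0_square p : (Cmod p < 1)%R ->
  T 0 p ^ 2 = T 0 (p ^ 2) ^ 2 + p * Psi (p ^ 2) ^ 2.
Proof.
intros Hp. assert (Hp2 : (Cmod (p ^ 2) < 1)%R) by (apply Cmod_pow_lt_1; auto).
pose (f := fun x : Z * Z => p ^ Z.to_nat (fst x * fst x) * p ^ Z.to_nat (snd x * snd x)).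
assert (Hf : is_sum f (T 0 p * T 0 p)).
{ apply (is_sum_prod (fun n => p ^ Z.to_nat (n * n)) (fun n => p ^ Z.to_nat (n * n)));
  (now apply T0_abs) || (now apply is_sum_T0). }
pose (h := fun x : (Z * Z) + (Z * Z) => match x with
  | inl (u, v) => (u + v, u - v)%Z | inr (u, v) => (u + v + 1, u - v)%Z end).
pose (g := fun x : Z * Z => let (m, n) := x in
  if Z.even (m + n) then inl ((m + n) / 2, (m - n) / 2)%Z
  else inr ((m + n) / 2, (m - n) / 2)%Z : (Z * Z) + (Z * Z)).
apply (is_sum_reindex h g) in Hf.
- replace (T 0 p ^ 2) with (T 0 p * T 0 p) by ring.
  apply (is_sum_unique _ _ _ Hf).
  replace (T 0 (p ^ 2) ^ 2) with (T 0 (p ^ 2) * T 0 (p ^ 2)) by ring.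
  replace (Psi (p ^ 2) ^ 2) with (Psi (p ^ 2) * Psi (p ^ 2)) by ring.
  apply is_sum_sum.
  + pose proof (is_sum_prod _ _ _ _ (T0_abs _ Hp2) (T0_abs _ Hp2) (is_sum_T0 _ Hp2) (is_sum_T0 _ Hp2)) as H.
    revert H. apply is_sum_ext. intros [u v]. unfold f, h. cbn [fst snd].
    rewrite !zpow_mul, !zpow_add by nia. rewrite ?zpow_add by apply Z.square_nonneg. f_equal. nia.
  + pose proof (is_sum_prod _ _ _ _ (Psi_abs _ Hp2) (Psi_abs _ Hp2) (is_sum_Psi _ Hp2) (is_sum_Psi _ Hp2)) as H.
    apply (is_sum_scal _ _ p) in H.
    revert H. apply is_sum_ext. intros [u v]. unfold f, h. cbn [fst snd].
    rewrite !zpow_mul, !zpow_add by nia. rewrite ?zpow_add by apply Z.square_nonneg.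
    rewrite <- (Cpow_S p). f_equal.
    assert (0 <= u * u + u /\ 0 <= v * v + v)%Z by (split; nia).
    replace ((u + v + 1) * (u + v + 1) + (u - v) * (u - v))%Z
      with (2 * (u * u + u) + 2 * (v * v + v) + 1)%Z by ring. lia.
- assert (D : forall u k, (((u * 2 + k) / 2 = u + k / 2)%Z)) by (intros; rewrite Z.add_comm, Z.div_add; lia).
  intros [[u v]|[u v]]; unfold g, h.
  + replace (u + v + (u - v))%Z with (u * 2 + 0)%Z by ring.
    replace (u + v - (u - v))%Z with (v * 2 + 0)%Z by ring.
    rewrite !D, Z.even_add, Z.even_mul, Bool.orb_true_r. simpl. now rewrite !Z.add_0_r.
  + replace (u + v + 1 + (u - v))%Z with (u * 2 + 1)%Z by ring.
    replace (u + v + 1 - (u - v))%Z with (v * 2 + 1)%Z by ring.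
    rewrite !D, Z.even_add, Z.even_mul, Bool.orb_true_r. simpl. now rewrite !Z.add_0_r.
- intros [m n]. unfold g, h.
  pose proof (Z.div_mod (m + n) 2 ltac:(lia)) as E1. pose proof (Z.div_mod (m - n) 2 ltac:(lia)) as E2.
  assert (Hmod : ((m - n) mod 2 = (m + n) mod 2)%Z).
  { replace (m + n)%Z with (m - n + n * 2)%Z by ring. now rewrite Z.mod_add by lia. }
  rewrite Zmod_even in E1. rewrite Hmod, Zmod_even in E2.
  destruct (Z.even (m + n)); f_equal; lia.
Qed.

(** Even and odd summation indices: [(2u)^2 = 4 u^2] and [(2u + 1)^2 = 4 (u^2 + u) + 1]. *)
Lemma T0_parity_split p : (Cmod p < 1)%R -> T 0 p = T 0 (p ^ 4) + p * Psi (p ^ 4).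
Proof.
intros Hp. assert (Hp4 : (Cmod (p ^ 4) < 1)%R) by (apply Cmod_pow_lt_1; auto; lia).
pose (h := fun x : Z + Z => match x with inl u => 2 * u | inr u => 2 * u + 1 end%Z).
pose (g := fun n : Z => if Z.even n then inl (n / 2)%Z else inr (n / 2)%Z : Z + Z).
pose proof (is_sum_T0 p Hp) as Hf.
apply (is_sum_reindex h g) in Hf.
- apply (is_sum_unique _ _ _ Hf). apply is_sum_sum.
  + generalize (is_sum_T0 _ Hp4). apply is_sum_ext. intros u. unfold h.
    rewrite zpow_mul by nia. f_equal. nia.
  + generalize (is_sum_scal _ _ p (is_sum_Psi _ Hp4)). apply is_sum_ext. intros u. unfold h.
    rewrite zpow_mul by nia. rewrite <- Cpow_S. f_equal.
    assert (0 <= u * u + u)%Z by nia.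
    replace ((2 * u + 1) * (2 * u + 1))%Z with (4 * (u * u + u) + 1)%Z by ring. lia.
- intros [u|u]; unfold g, h.
  + rewrite Z.mul_comm, Z.even_mul, Bool.orb_true_r, Z.div_mul by lia. reflexivity.
  + rewrite Z.mul_comm, Z.even_add, Z.even_mul, Bool.orb_true_r. simpl.
    rewrite Z.add_comm, Z.div_add by lia. reflexivity.
- intros n. unfold g, h. pose proof (Z.div_mod n 2 ltac:(lia)) as E. rewrite Zmod_even in E.
  destruct (Z.even n); lia.
Qed.

(** By the parity splitting the left side is [T 0 (p^4)^2 - p^2 Psi(p^4)^2], which is [T0_square] at
    [- p^2]. Together with [T0_sq_add] this makes squaring the nome an arithmetic-geometric mean
    step for [theta_3^2] and [theta_4^2]. *)
Lemma T0_mul_neg p : (Cmod p < 1)%R -> T 0 p * T 0 (- p) = T 0 (- p ^ 2) ^ 2.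
Proof.
intros Hp.
rewrite (T0_parity_split p Hp), (T0_parity_split (- p)) by now rewrite Cmod_opp.
rewrite (T0_square (- p ^ 2)) by (rewrite Cmod_opp; apply Cmod_pow_lt_1; auto).
replace ((- p) ^ 4) with (p ^ 4) by ring. replace ((- p ^ 2) ^ 2) with (p ^ 4) by ring. ring.
Qed.

Lemma T0_sq_add p : (Cmod p < 1)%R -> T 0 p ^ 2 + T 0 (- p) ^ 2 = 2 * T 0 (p ^ 2) ^ 2.
Proof.
intros Hp. rewrite (T0_square p Hp), (T0_square (- p)) by now rewrite Cmod_opp.
replace ((- p) ^ 2) with (p ^ 2) by ring. ring.
Qed.

Lemma T0_sq_sub p : (Cmod p < 1)%R -> T 0 p ^ 2 - T 0 (- p) ^ 2 = 2 * p * Psi (p ^ 2) ^ 2.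
Proof.
intros Hp. rewrite (T0_square p Hp), (T0_square (- p)) by now rewrite Cmod_opp.
replace ((- p) ^ 2) with (p ^ 2) by ring. ring.
Qed.

(** [T0_sq_sub] is compared with [(A + s B)^2 - (A - s B)^2 = 4 s A B], where [A + s B] is the
    parity splitting of [T 0 s]. *)
Lemma Psi_sq s : (Cmod s < 1)%R -> s <> 0 -> Psi (s ^ 2) ^ 2 = 2 * Psi (s ^ 4) * T 0 (s ^ 4).
Proof.
intros Hs H0. pose proof (T0_sq_sub s Hs) as E.
rewrite (T0_parity_split s Hs) in E. rewrite (T0_parity_split (- s)) in E by now rewrite Cmod_opp.
replace ((- s) ^ 4) with (s ^ 4) in E by ring.
replace (Psi (s ^ 2) ^ 2) with (/ (2 * s) * (2 * s * Psi (s ^ 2) ^ 2)).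
- rewrite <- E. field. cnz.
- field. cnz.
Qed.

(** Jacobi's identity [theta_3^4 - theta_4^4 = theta_2^4]; the nome [s^2] has to be a square for [Psi_sq] to apply. *)
Lemma Jacobi_quartic s : (Cmod s < 1)%R -> s <> 0 ->
  T 0 (s ^ 2) ^ 4 - T 0 (- s ^ 2) ^ 4 = s ^ 2 * Psi (s ^ 2) ^ 4.
Proof.
intros Hs H0. assert (Hs2 : (Cmod (s ^ 2) < 1)%R) by (apply Cmod_pow_lt_1; auto).
replace (T 0 (s ^ 2) ^ 4 - T 0 (- s ^ 2) ^ 4) with
  ((T 0 (s ^ 2) ^ 2 - T 0 (- s ^ 2) ^ 2) * (T 0 (s ^ 2) ^ 2 + T 0 (- s ^ 2) ^ 2)) by ring.
rewrite T0_sq_add, T0_sq_sub by auto.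
replace (Psi (s ^ 2) ^ 4) with ((Psi (s ^ 2) ^ 2) ^ 2) by ring.
rewrite (Psi_sq s Hs H0). replace ((s ^ 2) ^ 2) with (s ^ 4) by ring. ring.
Qed.

(** * Logarithmic derivatives of theta series by doubling the nome *)

Ltac numsimp := cbn [Z.of_nat Pos.of_succ_nat Pos.succ pred Nat.add].
Tactic Notation "numsimp" "in" hyp(H) := cbn [Z.of_nat Pos.of_succ_nat Pos.succ pred Nat.add] in H.

(** The operator [p d/dp]: unlike the derivative itself it preserves the family [T]. *)
Definition pd (f : C -> C) (p l : C) : Prop := exists l', cd f p l' /\ p * l' = l.

Lemma pd_eq f x l l' : pd f x l -> l = l' -> pd f x l'.
Proof. now intros H <-. Qed.

Lemma pd_const c x : pd (fun _ => c) x 0.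
Proof. exists 0. split; [apply cd_const | ring]. Qed.

Lemma pd_plus f g x a b : pd f x a -> pd g x b -> pd (fun y => f y + g y) x (a + b).
Proof. intros [a' [Ha <-]] [b' [Hb <-]]. exists (a' + b'). split; [now apply cd_plus | ring]. Qed.

Lemma pd_minus f g x a b : pd f x a -> pd g x b -> pd (fun y => f y - g y) x (a - b).
Proof. intros [a' [Ha <-]] [b' [Hb <-]]. exists (a' - b'). split; [now apply cd_minus | ring]. Qed.

Lemma pd_opp f x a : pd f x a -> pd (fun y => - f y) x (- a).
Proof. intros [a' [Ha <-]]. exists (- a'). split; [now apply cd_opp | ring]. Qed.

Lemma pd_mult f g x a b : pd f x a -> pd g x b -> pd (fun y => f y * g y) x (a * g x + f x * b).
Proof.
intros [a' [Ha <-]] [b' [Hb <-]]. eexists. split; [apply (cd_mult _ _ _ _ _ Ha Hb) | ring].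
Qed.

Lemma pd_inv f x a : pd f x a -> f x <> 0 -> pd (fun y => / f y) x (- a / (f x * f x)).
Proof.
intros [a' [Ha <-]] H0. eexists. split; [apply (cd_inv _ _ _ Ha H0) | field; auto].
Qed.

Lemma pd_div f g x a b : pd f x a -> pd g x b -> g x <> 0 ->
  pd (fun y => f y / g y) x ((a * g x - f x * b) / (g x * g x)).
Proof.
intros Ha Hb H0. eapply pd_eq; [apply (pd_mult f (fun y => / g y)); [apply Ha | apply (pd_inv _ _ _ Hb H0)]|].
field; auto.
Qed.

Lemma pd_pow f x a n : pd f x a -> pd (fun y => f y ^ n) x (RtoC (IZR (Z.of_nat n)) * f x ^ pred n * a).
Proof. intros [a' [Ha <-]]. eexists. split; [apply (cd_pow _ _ _ n Ha) | ring]. Qed.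

Lemma pd_comp f g x a b : cd f (g x) a -> pd g x b -> pd (fun y => f (g y)) x (b * a).
Proof. intros Ha [b' [Hb <-]]. eexists. split; [apply (cd_comp _ _ _ _ _ Ha Hb) | ring]. Qed.

Lemma pd_id x : pd (fun y => y) x x.
Proof. exists 1. split; [apply cd_id | ring]. Qed.

Lemma pd_T j x : (Cmod x < 1)%R -> pd (fun y => T j y) x (T (j + 2) x).
Proof. intros Hx. exists (dT j x). split; [now apply cd_T | now apply mul_dT]. Qed.

(** The second hypothesis says that [g] has logarithmic derivative [b]: it is 1 for [- y] and 2 for
    [y ^ 2]. *)
Lemma pd_T_comp j g x b : (Cmod (g x) < 1)%R -> pd g x (b * g x) ->
  pd (fun y => T j (g y)) x (b * T (j + 2) (g x)).
Proof.
intros Hx Hg. eapply pd_eq; [apply (pd_comp (T j) g _ _ _ (cd_T j _ Hx) Hg)|].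
rewrite <- mul_dT by auto. ring.
Qed.

Lemma pd_T_opp j x : (Cmod x < 1)%R -> pd (fun y => T j (- y)) x (T (j + 2) (- x)).
Proof.
intros Hx. eapply pd_eq; [apply (pd_T_comp j (fun y => - y) x 1)|].
- now rewrite Cmod_opp.
- eapply pd_eq; [apply pd_opp, pd_id | ring].
- ring.
Qed.

Lemma pd_T_sq j x : (Cmod x < 1)%R -> pd (fun y => T j (y ^ 2)) x (2 * T (j + 2) (x ^ 2)).
Proof.
intros Hx. apply (pd_T_comp j (fun y => y ^ 2) x 2).
- now apply Cmod_pow_lt_1; auto.
- eapply pd_eq; [apply pd_pow, pd_id | numsimp; ring].
Qed.

Lemma pd_T_opp_sq j x : (Cmod x < 1)%R -> pd (fun y => T j (- y ^ 2)) x (2 * T (j + 2) (- x ^ 2)).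
Proof.
intros Hx. apply (pd_T_comp j (fun y => - y ^ 2) x 2).
- rewrite Cmod_opp. now apply Cmod_pow_lt_1; auto.
- eapply pd_eq; [apply pd_opp, pd_pow, pd_id | numsimp; ring].
Qed.

Lemma near_disc x : (Cmod x < 1)%R -> near x (fun y => (Cmod y < 1)%R).
Proof.
intros Hx. exists (1 - Cmod x)%R. split; [lra|]. intros y Hy.
replace y with (x + (y - x)) by ring. eapply Rle_lt_trans; [apply Cmod_triangle | lra].
Qed.

(** The device by which an identity of theta functions on the disc is differentiated. *)
Lemma pd_unique_disc f g x a b : (Cmod x < 1)%R ->
  (forall y, (Cmod y < 1)%R -> f y = g y) -> pd f x a -> pd g x b -> a = b.
Proof.
intros Hx Hfg [a' [Ha <-]] [b' [Hb <-]]. f_equal.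
apply (cd_unique g x); auto. apply (cd_ext_loc f); auto.
generalize (near_disc x Hx). apply near_imp. auto.
Qed.

Ltac pd_step :=
  lazymatch goal with
  | |- pd (fun y => y) _ _ => apply pd_id
  | |- pd (fun y => T ?j y) _ _ => apply pd_T
  | |- pd (T ?j) _ _ => apply pd_T
  | |- pd (fun y => T ?j (- y)) _ _ => apply pd_T_opp
  | |- pd (fun y => T ?j (y ^ 2)) _ _ => apply pd_T_sq
  | |- pd (fun y => T ?j (- y ^ 2)) _ _ => apply pd_T_opp_sq
  | |- pd (fun y => @?f y + @?g y) _ _ => apply (pd_plus f g)
  | |- pd (fun y => @?f y - @?g y) _ _ => apply (pd_minus f g)
  | |- pd (fun y => - @?f y) _ _ => apply (pd_opp f)
  | |- pd (fun y => @?f y ^ ?n) _ _ => apply (pd_pow f)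
  | |- pd (fun y => @?f y / @?g y) _ _ => apply (pd_div f g)
  | |- pd (fun y => @?f y * @?g y) _ _ => apply (pd_mult f g)
  | |- pd (fun y => ?c) _ _ => apply (pd_const c)
  end; cbv beta.
Ltac pd_auto := repeat pd_step.

(** * Iterated squaring of the nome *)

Lemma dbl_S (p : C) n : p ^ (2 ^ S n) = (p ^ (2 ^ n)) ^ 2.
Proof. rewrite <- Cpow_mult_r. f_equal. simpl. lia. Qed.

Lemma dbl_disc p n : (Cmod p < 1)%R -> (Cmod (p ^ (2 ^ n)) < 1)%R.
Proof. intros Hp. apply Cmod_pow_lt_1; auto. induction n; simpl; lia. Qed.

Lemma pow2_ge n : (n <= 2 ^ n)%nat.
Proof. induction n; simpl; [lia|]. assert (0 < 2 ^ n)%nat by (clear; induction n; simpl; lia). lia. Qed.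

Lemma dbl_near (P : C -> Prop) p : (Cmod p < 1)%R -> near 0 P ->
  exists N, forall n, (N <= n)%nat -> P (p ^ (2 ^ n)).
Proof.
intros Hp [d [Hd HP]].
destruct (pow_lt_1_zero (Cmod p)) with (y := d) as [N HN]; auto.
{ rewrite Rabs_pos_eq; auto. apply Cmod_ge_0. }
exists N. intros n Hn. apply HP. rewrite Cmod_minus_sym. replace (0 - p ^ 2 ^ n) with (- p ^ 2 ^ n) by ring.
rewrite Cmod_opp, Cmod_pow. pose proof (pow2_ge n).
specialize (HN (2 ^ n)%nat ltac:(lia)). rewrite Rabs_pos_eq in HN; auto.
apply pow_le, Cmod_ge_0.
Qed.

Lemma Cmod_small_eq a b : (forall eps, (0 < eps)%R -> (Cmod (a - b) < eps)%R) -> a = b.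
Proof.
intros H. assert (E : a - b = 0).
{ apply Cmod_eq_0. apply Rle_antisym; [|apply Cmod_ge_0]. apply Rnot_lt_le. intros Hp.
  specialize (H _ Hp). lra. }
replace a with (a - b + b) by ring. rewrite E. ring.
Qed.

Lemma dbl_limit (f : C -> C) p c : (Cmod p < 1)%R -> ct f 0 ->
  (exists N, forall n, (N <= n)%nat -> f (p ^ (2 ^ n)) = c) -> f 0 = c.
Proof.
intros Hp Hf [N Hc]. apply Cmod_small_eq. intros eps He.
destruct (dbl_near _ p Hp (Hf eps He)) as [M HM].
specialize (HM (max M N) ltac:(lia)). rewrite Hc in HM by lia. now rewrite Cmod_minus_sym.
Qed.

Lemma dbl_invariant (f : C -> C) : ct f 0 ->
  (forall p, (Cmod p < 1)%R -> f p = f (p ^ 2)) -> forall p, (Cmod p < 1)%R -> f p = f 0.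
Proof.
intros Hf H p Hp. symmetry. apply (dbl_limit f p); auto. exists 0%nat. intros n _.
induction n as [|n IH]; [simpl; f_equal; ring|].
rewrite dbl_S, <- H by now apply dbl_disc. exact IH.
Qed.

Lemma Cmod_0_lt_1 : (Cmod 0 < 1)%R.
Proof. rewrite Cmod_0. lra. Qed.

Lemma T0_at_0 : T 0 0 = 1.
Proof. rewrite T_at_0. reflexivity. Qed.

Lemma C2_nz : RtoC 2 <> 0.
Proof. cnz. Qed.

(** By [T0_mul_neg] a zero of [theta_4] at [x] forces one at [x^2], hence along the iterated squares
    and, in the limit, at 0, where the value is 1. *)
Lemma T0_nonzero p : (Cmod p < 1)%R -> T 0 p <> 0.
Proof.
intros Hp HZ.
assert (C1 : ct (fun x => T 0 (- x)) 0).
{ apply (ct_comp (T 0) (fun x => - x)).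
  - replace (- 0) with (RtoC 0) by ring. apply (cd_ct _ _ _ (cd_T 0 0 Cmod_0_lt_1)).
  - apply (cd_ct _ _ (- (1))). apply cd_opp, cd_id. }
assert (Hq : (Cmod (- p) < 1)%R) by now rewrite Cmod_opp.
(* The iteration starts at [- p], where [theta_4] takes the value [T 0 p]. *)
assert (E : (fun x => T 0 (- x)) 0 = 0).
{ apply (dbl_limit (fun x => T 0 (- x)) (- p)); auto. exists 0%nat. intros n _.
  induction n as [|n IH].
  - simpl. rewrite <- HZ. f_equal. ring.
  - rewrite dbl_S. set (x := (- p) ^ 2 ^ n) in *.
    assert (Hx : (Cmod x < 1)%R) by now apply dbl_disc.
    pose proof (T0_mul_neg x Hx) as E. rewrite IH in E.
    apply NNPP. intros Hn. apply (Cpow_nz _ 2 Hn). rewrite <- E. ring. }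
cbv beta in E. replace (- 0) with (RtoC 0) in E by ring. rewrite T0_at_0 in E.
apply RtoC_inj in E. lra.
Qed.

(** This is [theta_2^4], by [Jacobi_quartic]. *)
Definition th2 (p : C) : C := T 0 p ^ 4 - T 0 (- p) ^ 4.

Lemma disc_opp p : (Cmod p < 1)%R -> (Cmod (- p) < 1)%R.
Proof. now rewrite Cmod_opp. Qed.

Lemma disc_sq p : (Cmod p < 1)%R -> (Cmod (p ^ 2) < 1)%R.
Proof. intros H. apply Cmod_pow_lt_1; auto. Qed.

#[local] Hint Resolve disc_opp disc_sq T0_nonzero Cmod_0_lt_1 C2_nz : core.

Lemma th2_sq p : (Cmod p < 1)%R -> 4 * th2 (p ^ 2) = (T 0 p ^ 2 - T 0 (- p) ^ 2) ^ 2.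
Proof.
intros Hp. unfold th2.
transitivity ((2 * T 0 (p ^ 2) ^ 2) ^ 2 - 4 * (T 0 (- p ^ 2) ^ 2) ^ 2); [ring|].
rewrite <- T0_sq_add, <- T0_mul_neg by auto. ring.
Qed.

Lemma th2_factor p : (Cmod p < 1)%R ->
  th2 p = (T 0 p ^ 2 - T 0 (- p) ^ 2) * (2 * T 0 (p ^ 2) ^ 2).
Proof. intros Hp. rewrite <- T0_sq_add by auto. unfold th2. ring. Qed.

Lemma cd_T_opp j x : (Cmod x < 1)%R -> cd (fun y => T j (- y)) x (- dT j (- x)).
Proof.
intros Hx. eapply cd_eq; [apply (cd_comp (T j) (fun y => - y)); [apply cd_T; auto | apply cd_opp, cd_id]|].
ring.
Qed.

Lemma cd_div f g x a b : cd f x a -> cd g x b -> g x <> 0 ->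
  cd (fun y => f y / g y) x ((a * g x - f x * b) / (g x * g x)).
Proof.
intros Ha Hb H0. eapply cd_eq; [apply (cd_mult f (fun y => / g y)); [apply Ha | apply (cd_inv _ _ _ Hb H0)]|].
field; auto.
Qed.

Ltac cd_step :=
  lazymatch goal with
  | |- cd (fun y => y) _ _ => apply cd_id
  | |- cd (fun y => T ?j y) _ _ => apply cd_T
  | |- cd (T ?j) _ _ => apply cd_T
  | |- cd (fun y => T ?j (- y)) _ _ => apply cd_T_opp
  | |- cd (fun y => @?f y + @?g y) _ _ => apply (cd_plus f g)
  | |- cd (fun y => @?f y - @?g y) _ _ => apply (cd_minus f g)
  | |- cd (fun y => - @?f y) _ _ => apply (cd_opp f)
  | |- cd (fun y => @?f y ^ ?n) _ _ => apply (cd_pow f)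
  | |- cd (fun y => @?f y / @?g y) _ _ => apply (cd_div f g)
  | |- cd (fun y => @?f y * @?g y) _ _ => apply (cd_mult f g)
  | |- cd (fun y => ?c) _ _ => apply (cd_const c)
  end; cbv beta.
Ltac cd_auto := repeat cd_step.

Lemma Copp_0 : - RtoC 0 = 0.
Proof. ring. Qed.

(** Leading term [16 p] of [theta_2^4]; here 16 is [2^4], because the indices 0 and -1 both
    contribute to the lowest power in [theta_2]. *)
Lemma cd_th2_0 : cd th2 0 16.
Proof.
unfold th2. eapply cd_eq; [cd_auto; rewrite ?Copp_0; auto|].
rewrite !Copp_0, dT_at_0, !T0_at_0. numsimp. simpl pow. replace (1 + 1)%R with 2%R by ring. ring.
Qed.

Lemma th2_at_0 : th2 0 = 0.
Proof. unfold th2. rewrite Copp_0. ring. Qed.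

Lemma cd_at_0 f l : cd f 0 l -> f 0 = 0 ->
  exists phi, ct phi 0 /\ phi 0 = l /\ near 0 (fun y => f y = y * phi y).
Proof.
intros [phi [H1 [H2 H3]]] H0. exists phi. repeat split; auto.
generalize H3. apply near_imp. intros y ->. rewrite H0. ring.
Qed.

(** A zero would pass from [x] to [x^2] through [th2_factor] and [th2_sq], and zeros accumulating at
    0 contradict the nonzero derivative there. *)
Lemma th2_nonzero p : (Cmod p < 1)%R -> p <> 0 -> th2 p <> 0.
Proof.
intros Hp Hp0 HZ.
assert (Hn : forall n, th2 (p ^ (2 ^ n)) = 0).
{ induction n as [|n IH]; [simpl; rewrite <- HZ; f_equal; ring|].
  rewrite dbl_S. set (x := p ^ 2 ^ n) in *. assert (Hx : (Cmod x < 1)%R) by now apply dbl_disc.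
  pose proof (th2_sq x Hx) as E1. rewrite th2_factor in IH by auto.
  replace (th2 (x ^ 2)) with (4 * th2 (x ^ 2) / 4) by (field; cnz). rewrite E1.
  replace (T 0 x ^ 2 - T 0 (- x) ^ 2) with (RtoC 0); [field; cnz|].
  set (k := 2 * T 0 (x ^ 2) ^ 2) in *.
  assert (Hk : k <> 0) by (apply Cmult_neq_0; auto; apply Cpow_nz; auto).
  replace (T 0 x ^ 2 - T 0 (- x) ^ 2) with ((T 0 x ^ 2 - T 0 (- x) ^ 2) * k / k) by (field; auto).
  rewrite IH. field; auto. }
destruct (cd_at_0 _ _ cd_th2_0 th2_at_0) as [phi [H1 [H2 H3]]].
assert (Hphi : phi 0 = 0).
{ apply (dbl_limit _ p); auto. destruct (dbl_near _ p Hp H3) as [N HN]. exists N. intros n Hle.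
  specialize (HN n Hle). cbv beta in HN. rewrite Hn in HN.
  assert (Hx : p ^ 2 ^ n <> 0) by now apply Cpow_nz.
  replace (phi (p ^ 2 ^ n)) with (p ^ 2 ^ n * phi (p ^ 2 ^ n) / p ^ 2 ^ n) by (field; auto).
  rewrite <- HN. field; auto. }
rewrite H2 in Hphi. apply RtoC_inj in Hphi. lra.
Qed.

(** Logarithmic derivatives of [theta_3] and [theta_4] under [p d/dp]. *)
Definition v3 (p : C) : C := T 2 p / T 0 p.
Definition v4 (p : C) : C := T 2 (- p) / T 0 (- p).

(** Logarithmic derivative of [T0_mul_neg]: one factor 2 comes from the square of the theta
    constant, the other from [p ^ 2]. Likewise [v3_dbl] differentiates [T0_sq_add]. *)
Lemma v4_dbl p : (Cmod p < 1)%R -> v3 p + v4 p = 4 * v4 (p ^ 2).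
Proof.
intros Hp. unfold v3, v4.
pose proof (pd_unique_disc _ _ p _ _ Hp T0_mul_neg ltac:(pd_auto; auto) ltac:(pd_auto; auto)) as E.
numsimp in E. pose proof (T0_mul_neg p Hp) as E2.
pose proof (T0_nonzero p Hp). pose proof (T0_nonzero (- p) ltac:(auto)).
pose proof (T0_nonzero (- p ^ 2) ltac:(auto)).
transitivity (2 * T 0 (- p ^ 2) ^ 1 * (2 * T 2 (- p ^ 2)) / (T 0 (- p ^ 2) ^ 2)); [|field; cnz].
rewrite <- E, <- E2. field; cnz.
Qed.

Lemma v3_dbl p : (Cmod p < 1)%R ->
  2 * (T 0 p ^ 2 + T 0 (- p) ^ 2) * v3 (p ^ 2) = T 0 p ^ 2 * v3 p + T 0 (- p) ^ 2 * v4 p.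
Proof.
intros Hp. unfold v3, v4.
pose proof (pd_unique_disc _ _ p _ _ Hp T0_sq_add ltac:(pd_auto; auto) ltac:(pd_auto; auto)) as E.
pose proof (T0_sq_add p Hp) as E2.
pose proof (T0_nonzero p Hp). pose proof (T0_nonzero (- p) ltac:(auto)).
pose proof (T0_nonzero (p ^ 2) ltac:(auto)).
rewrite E2.
numsimp in E.
transitivity ((0 * T 0 (p ^ 2) ^ 2 + 2 * (2 * T 0 (p ^ 2) ^ 1 * (2 * T 2 (p ^ 2)))) / 2); [field; cnz|].
rewrite <- E. field; cnz.
Qed.

Lemma v_at_0 : v3 0 = 0 /\ v4 0 = 0.
Proof.
unfold v3, v4. rewrite Copp_0, T0_at_0, T_at_0.
simpl pow. rewrite Rmult_0_l. split; field; cnz.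
Qed.

(** Jacobi's derivative formula. The quotient [(v3 - v4) / th2] is unchanged by doubling, so it
    equals its limit [4 / 16] at the cusp. *)
Lemma v3_sub_v4 p : (Cmod p < 1)%R -> v3 p - v4 p = th2 p / 4.
Proof.
intros Hp. destruct (classic (p = 0)) as [->|Hp0].
{ destruct v_at_0 as [-> ->]. rewrite th2_at_0. field. }
assert (Hstep : forall x, (Cmod x < 1)%R -> x <> 0 ->
  (v3 x - v4 x) / th2 x = (v3 (x ^ 2) - v4 (x ^ 2)) / th2 (x ^ 2)).
{ intros x Hx Hx0.
  pose proof (th2_nonzero x Hx Hx0) as Ha.
  pose proof (th2_nonzero (x ^ 2) ltac:(auto) (Cpow_nz _ 2 Hx0)) as Ha2.
  pose proof (v4_dbl x Hx) as E4. pose proof (v3_dbl x Hx) as E3. pose proof (th2_sq x Hx) as E2.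
  pose proof (T0_sq_add x Hx) as ES. pose proof (T0_nonzero (x ^ 2) ltac:(auto)) as N2.
  set (S := T 0 x ^ 2 + T 0 (- x) ^ 2) in *. set (D := T 0 x ^ 2 - T 0 (- x) ^ 2) in *.
  assert (HS : S <> 0) by (rewrite ES; apply Cmult_neq_0; auto; apply Cpow_nz; auto).
  assert (Ea : th2 x = D * S) by (unfold th2, D, S; ring).
  assert (HD : D <> 0) by (intros Z; apply Ha; rewrite Ea, Z; ring).
  replace (th2 (x ^ 2)) with (D ^ 2 / 4) by (rewrite <- E2; field; cnz).
  replace (v4 (x ^ 2)) with ((v3 x + v4 x) / 4) by (rewrite E4; field; cnz).
  replace (v3 (x ^ 2)) with ((T 0 x ^ 2 * v3 x + T 0 (- x) ^ 2 * v4 x) / (2 * S))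
    by (rewrite <- E3; field; cnz).
  rewrite Ea.
  replace (T 0 x ^ 2) with ((S + D) / 2) by (unfold S, D; field; cnz).
  replace (T 0 (- x) ^ 2) with ((S - D) / 2) by (unfold S, D; field; cnz).
  field; cnz. }
assert (Hn : forall n, (v3 (p ^ (2 ^ n)) - v4 (p ^ (2 ^ n))) / th2 (p ^ (2 ^ n)) = (v3 p - v4 p) / th2 p).
{ induction n as [|n IH]; [simpl; replace (p * 1) with p by ring; auto|].
  rewrite dbl_S, <- Hstep; auto; [now apply dbl_disc | now apply Cpow_nz]. }
(* Near 0, [v3] behaves like [2 p] and [v4] like [- 2 p]. *)
assert (Hcd : cd (fun x => v3 x - v4 x) 0 4).
{ unfold v3, v4. eapply cd_eq; [cd_auto; rewrite ?Copp_0; auto|].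
  rewrite !Copp_0, !dT_at_0, !T_at_0. simpl pow. rewrite !Rmult_0_l.
  replace (1 + 1)%R with 2%R by ring. replace (1 + -1 * (-1 * 1))%R with 2%R by ring.
  field; cnz. }
destruct (cd_at_0 _ _ Hcd) as [f1 [F1 [F2 F3]]].
{ destruct v_at_0 as [-> ->]. ring. }
destruct (cd_at_0 _ _ cd_th2_0 th2_at_0) as [f2 [G1 [G2 G3]]].
assert (E : f1 0 * / f2 0 = (v3 p - v4 p) / th2 p).
{ apply (dbl_limit (fun x => f1 x * / f2 x) p); auto.
  - apply ct_mult; auto. apply ct_inv; auto. rewrite G2. cnz.
  - destruct (dbl_near _ p Hp (near_and _ _ _ F3 G3)) as [N HN]. exists N. intros n Hle.
    destruct (HN n Hle) as [E1 E2]. rewrite <- Hn with n. rewrite E1, E2.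
    assert (Hx : p ^ 2 ^ n <> 0) by now apply Cpow_nz.
    assert (Hx1 : f2 (p ^ 2 ^ n) <> 0).
    { intros Z. rewrite Z in E2. apply (th2_nonzero (p ^ 2 ^ n)); auto; [now apply dbl_disc|].
      rewrite E2. ring. }
    field. auto. }
cbv beta in E. rewrite F2, G2 in E.
pose proof (th2_nonzero p Hp Hp0).
replace (v3 p - v4 p) with ((v3 p - v4 p) / th2 p * th2 p) by (field; auto).
rewrite <- E. field; cnz.
Qed.

Lemma T_opp_opp j p : T j (- - p) = T j p.
Proof. f_equal. ring. Qed.

(** The defect in Halphen's equation [p v3' = 2 v3^2 + theta_2^4 theta_4^4 / 8]: it vanishes because
    doubling the nome divides it by 4, whereas it is [O(p)]. *)
Definition halphen (p : C) : C := T 4 p / T 0 p - 3 * v3 p ^ 2 - th2 p * T 0 (- p) ^ 4 / 8.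

Lemma pd_v3 p : (Cmod p < 1)%R -> pd v3 p (T 4 p / T 0 p - v3 p ^ 2).
Proof.
intros Hp. unfold v3. eapply pd_eq; [pd_auto; auto|]. numsimp.
field; auto.
Qed.

Lemma pd_v4 p : (Cmod p < 1)%R -> pd v4 p (T 4 (- p) / T 0 (- p) - v4 p ^ 2).
Proof.
intros Hp. unfold v4. eapply pd_eq; [pd_auto; auto|]. numsimp.
field; auto.
Qed.

Lemma pd_th3_4 p : (Cmod p < 1)%R -> pd (fun p => T 0 p ^ 4) p (4 * T 0 p ^ 4 * v3 p).
Proof. intros Hp. unfold v3. eapply pd_eq; [pd_auto; auto|]. numsimp. field; auto. Qed.

Lemma pd_th4_4 p : (Cmod p < 1)%R -> pd (fun p => T 0 (- p) ^ 4) p (4 * T 0 (- p) ^ 4 * v4 p).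
Proof. intros Hp. unfold v4. eapply pd_eq; [pd_auto; auto|]. numsimp. field; auto. Qed.

Lemma pd_th2 p : (Cmod p < 1)%R ->
  pd th2 p (4 * T 0 p ^ 4 * v3 p - 4 * T 0 (- p) ^ 4 * v4 p).
Proof. intros Hp. apply (pd_minus _ _ _ _ _ (pd_th3_4 p Hp) (pd_th4_4 p Hp)). Qed.

(** Applying [p d/dp] to [v3_sub_v4] relates the second derivatives at [p] and [- p]; the rest is
    algebra in the fourth powers. *)
Lemma halphen_even p : (Cmod p < 1)%R -> halphen (- p) = halphen p.
Proof.
intros Hp.
assert (E : T 4 p / T 0 p - v3 p ^ 2 - (T 4 (- p) / T 0 (- p) - v4 p ^ 2) =
  ((4 * T 0 p ^ 4 * v3 p - 4 * T 0 (- p) ^ 4 * v4 p) * 4 - th2 p * 0) / (4 * 4)).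
{ apply (pd_unique_disc (fun p => v3 p - v4 p) (fun p => th2 p / 4) p); auto.
  - apply v3_sub_v4.
  - apply pd_minus; [now apply pd_v3 | now apply pd_v4].
  - apply (pd_div th2 (fun _ => RtoC 4)); [now apply pd_th2 | apply pd_const | cnz]. }
unfold halphen. rewrite T_opp_opp.
replace (v3 (- p)) with (v4 p) by reflexivity.
pose proof (v3_sub_v4 p Hp) as Ed.
replace (th2 (- p)) with (- th2 p) by (unfold th2; rewrite T_opp_opp; ring).
replace (T 4 (- p) / T 0 (- p)) with (T 4 p / T 0 p - v3 p ^ 2 + v4 p ^ 2 -
   ((4 * T 0 p ^ 4 * v3 p - 4 * T 0 (- p) ^ 4 * v4 p) * 4 - th2 p * 0) / (4 * 4))
  by (rewrite <- E; ring).
replace (v3 p) with (v4 p + th2 p / 4) by (rewrite <- Ed; ring).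
unfold th2. field; cnz.
Qed.

(** The derivative of [v4_dbl] concerns [theta_4] at [p^2], that is, [theta_3] at [- p^2]; evenness
    moves the defect to that point. *)
Lemma halphen_dbl p : (Cmod p < 1)%R -> halphen p = 4 * halphen (p ^ 2).
Proof.
intros Hp. pose proof (halphen_even p Hp) as Ev.
rewrite <- (halphen_even (p ^ 2)) by auto.
assert (E : T 4 p / T 0 p - v3 p ^ 2 + (T 4 (- p) / T 0 (- p) - v4 p ^ 2) =
  0 * v4 (p ^ 2) + 4 * (2 * (T 4 (- p ^ 2) / T 0 (- p ^ 2) - v4 (p ^ 2) ^ 2))).
{ apply (pd_unique_disc (fun p => v3 p + v4 p) (fun p => 4 * v4 (p ^ 2)) p); auto.
  - apply v4_dbl.
  - apply pd_plus; [now apply pd_v3 | now apply pd_v4].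
  - apply (pd_mult (fun _ => RtoC 4) (fun p => v4 (p ^ 2))); [apply pd_const|].
    unfold v4. eapply pd_eq; [pd_auto; auto|]. numsimp. field; auto. }
unfold halphen in *. rewrite T_opp_opp in *.
replace (v3 (- p)) with (v4 p) in * by reflexivity.
replace (v3 (- p ^ 2)) with (v4 (p ^ 2)) in * by reflexivity.
pose proof (v3_sub_v4 p Hp) as Ed. pose proof (v4_dbl p Hp) as Es.
replace (th2 (- p)) with (- th2 p) in * by (unfold th2; rewrite T_opp_opp; ring).
replace (th2 (- p ^ 2)) with (- th2 (p ^ 2)) in * by (unfold th2; rewrite T_opp_opp; ring).
assert (Ep : th2 (p ^ 2) * T 0 (p ^ 2) ^ 4 = th2 p ^ 2 / 16).
{ transitivity ((4 * th2 (p ^ 2)) * (2 * T 0 (p ^ 2) ^ 2) ^ 2 / 16); [field; cnz|].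
  rewrite th2_sq, <- T0_sq_add by auto. unfold th2. field; cnz. }
set (A4 := T 4 p / T 0 p) in *. set (B4 := T 4 (- p) / T 0 (- p)) in *.
set (E4 := T 4 (- p ^ 2) / T 0 (- p ^ 2)) in *.
replace (- th2 (p ^ 2) * T 0 (p ^ 2) ^ 4 / 8) with (- (th2 (p ^ 2) * T 0 (p ^ 2) ^ 4) / 8) by (field; cnz).
rewrite Ep.
replace (v4 (p ^ 2)) with ((v3 p + v4 p) / 4) in * by (rewrite Es; field; cnz).
replace E4 with ((A4 - v3 p ^ 2 + (B4 - v4 p ^ 2)) / 8 + ((v3 p + v4 p) / 4) ^ 2)
  by (rewrite E; field; cnz).
replace B4 with (A4 - 3 * v3 p ^ 2 - th2 p * T 0 (- p) ^ 4 / 8 + 3 * v4 p ^ 2 + - th2 p * T 0 p ^ 4 / 8)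
  by (rewrite <- Ev; field; cnz).
replace (v3 p) with (v4 p + th2 p / 4) by (rewrite <- Ed; ring).
unfold th2. field; cnz.
Qed.

(** The exponent doubles while the prefactor only quadruples: with [m = 2^n] the product is
    [m^2 r^m]. *)
Lemma quartic_geom_small (r : R) : (0 <= r < 1)%R -> forall eps, (0 < eps)%R ->
  exists N, forall n, (N <= n)%nat -> (4 ^ n * r ^ (2 ^ n) < eps)%R.
Proof.
intros Hr eps He. destruct (geom_poly_summable 3 r Hr) as [M HM].
assert (HM' : forall m, ((INR m + 1) ^ 3 * r ^ m <= M)%R).
{ intros m. specialize (HM [m] ltac:(repeat constructor; auto)). unfold rsum in HM; cbn [fold_right] in HM.
  rewrite Cmod_R in HM. pose proof (Rle_abs ((INR m + 1) ^ 3 * r ^ m)). lra. }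
destruct (INR_unbounded (M / eps)) as [N HN]. exists N. intros n Hn.
pose proof (pow2_ge n) as H2. set (m := (2 ^ n)%nat) in *.
assert (E4 : (4 ^ n = INR m ^ 2)%R).
{ unfold m. rewrite pow_INR. replace (INR 2) with 2%R by (simpl; ring).
  rewrite <- pow_mult, Nat.mul_comm, pow_mult. f_equal. ring. }
rewrite E4. specialize (HM' m).
assert (Hm : (M / eps < INR m + 1)%R).
{ eapply Rlt_trans; [exact HN|]. assert (INR N <= INR m)%R by (apply le_INR; lia). lra. }
assert (HMlt : (M < eps * (INR m + 1))%R).
{ apply Rmult_lt_reg_r with (/ eps)%R; [now apply Rinv_0_lt_compat|].
  replace (eps * (INR m + 1) * / eps)%R with (INR m + 1)%R by (field; lra). exact Hm. }
pose proof (pos_INR m). pose proof (pow_le r m (proj1 Hr)).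
apply Rmult_lt_reg_l with (INR m + 1)%R; [lra|].
rewrite (Rmult_comm (INR m + 1) eps).
eapply Rle_lt_trans; [|exact HMlt]. eapply Rle_trans; [|exact HM'].
rewrite <- Rmult_assoc. apply Rmult_le_compat_r; auto. nra.
Qed.

Lemma halphen_zero p : (Cmod p < 1)%R -> halphen p = 0.
Proof.
intros Hp.
assert (Hn : forall n, halphen p = RtoC (4 ^ n) * halphen (p ^ (2 ^ n))).
{ induction n as [|n IH]; [simpl; replace (p * 1) with p by ring; ring|].
  rewrite IH, dbl_S, halphen_dbl by now apply dbl_disc.
  simpl pow. rewrite RtoC_mult. ring. }
assert (H0 : halphen 0 = 0).
{ unfold halphen. rewrite th2_at_0. destruct v_at_0 as [-> _]. rewrite !T_at_0. simpl pow.
  rewrite !Rmult_0_l. field; cnz. }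
assert (Hcd : exists l, cd halphen 0 l).
{ unfold halphen, th2, v3. eexists. cd_auto; rewrite ?Copp_0; auto; cnz. }
destruct Hcd as [l Hcd]. destruct (cd_at_0 _ _ Hcd H0) as [phi [F1 [F2 F3]]].
apply Cmod_small_eq. intros eps He.
pose proof (Cmod_ge_0 l) as Hl. set (K := (Cmod l + 1)%R).
destruct (dbl_near _ p Hp (near_and _ _ _ F3 (F1 1%R Rlt_0_1))) as [N1 HN1].
destruct (quartic_geom_small (Cmod p) (conj (Cmod_ge_0 p) Hp) (eps / K)) as [N2 HN2].
{ apply Rdiv_lt_0_compat; unfold K; lra. }
set (n := max N1 N2). specialize (HN1 n ltac:(lia)). specialize (HN2 n ltac:(lia)).
destruct HN1 as [E B]. rewrite (Hn n), E.
replace (RtoC (4 ^ n) * (p ^ 2 ^ n * phi (p ^ 2 ^ n)) - 0) with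
  (RtoC (4 ^ n) * p ^ 2 ^ n * phi (p ^ 2 ^ n)) by ring.
rewrite !Cmod_mult, Cmod_pow, Cmod_R, Rabs_pos_eq by (apply pow_le; lra).
assert (HK : (Cmod (phi (p ^ 2 ^ n)%C) <= K)%R).
{ rewrite F2 in B. replace (phi (p ^ 2 ^ n)) with (phi (p ^ 2 ^ n) - l + l) by ring.
  eapply Rle_trans; [apply Cmod_triangle | unfold K; lra]. }
apply Rle_lt_trans with (4 ^ n * Cmod p ^ 2 ^ n * K)%R.
- apply Rmult_le_compat_l; auto. apply Rmult_le_pos; apply pow_le; [lra | apply Cmod_ge_0].
- apply Rmult_lt_reg_r with (/ K)%R; [apply Rinv_0_lt_compat; unfold K; lra|].
  rewrite Rmult_assoc, Rinv_r, Rmult_1_r by (unfold K; lra). exact HN2.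
Qed.

(** Halphen's equation in solved form. With it, [p d/dp] maps polynomials in [v3], [v4] and the
    fourth powers of theta constants to such polynomials. *)
Lemma T4_div p : (Cmod p < 1)%R ->
  T 4 p = T 0 p * (3 * v3 p ^ 2 + th2 p * T 0 (- p) ^ 4 / 8).
Proof.
intros Hp. pose proof (halphen_zero p Hp) as E. unfold halphen in E.
transitivity (T 0 p * (T 4 p / T 0 p - 3 * v3 p ^ 2 - th2 p * T 0 (- p) ^ 4 / 8) +
  T 0 p * (3 * v3 p ^ 2 + th2 p * T 0 (- p) ^ 4 / 8)); [field; auto|].
rewrite E. ring.
Qed.

Lemma T4_opp_div p : (Cmod p < 1)%R ->
  T 4 (- p) = T 0 (- p) * (3 * v4 p ^ 2 - th2 p * T 0 p ^ 4 / 8).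
Proof.
intros Hp. rewrite (T4_div (- p)) by auto. rewrite T_opp_opp.
replace (v3 (- p)) with (v4 p) by reflexivity.
replace (th2 (- p)) with (- th2 p) by (unfold th2; rewrite T_opp_opp; ring). field; cnz.
Qed.

(** [p d/dp] applied to [T4_opp_div], with the second derivative eliminated by the same formula. *)
Lemma T6_opp_div p : (Cmod p < 1)%R ->
  T 6 (- p) = T 0 (- p) * (15 * v4 p ^ 3 - 15 / 8 * th2 p * T 0 p ^ 4 * v4 p
    - th2 p * T 0 p ^ 4 * (th2 p + T 0 p ^ 4) / 8).
Proof.
intros Hp.
pose proof (v3_sub_v4 p Hp) as Ed.
pose proof (pd_v4 p Hp) as P4. pose proof (pd_th2 p Hp) as P2. pose proof (pd_th3_4 p Hp) as P3.
assert (P : pd (fun p => T 0 (- p) * (3 * v4 p ^ 2 - th2 p * T 0 p ^ 4 / 8)) p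
  (T 2 (- p) * (3 * v4 p ^ 2 - th2 p * T 0 p ^ 4 / 8) + T 0 (- p) *
   (6 * v4 p * (T 4 (- p) / T 0 (- p) - v4 p ^ 2)
    - ((4 * T 0 p ^ 4 * v3 p - 4 * T 0 (- p) ^ 4 * v4 p) * T 0 p ^ 4 + th2 p * (4 * T 0 p ^ 4 * v3 p)) / 8))).
{ apply (pd_mult (fun p => T 0 (- p)) (fun p => 3 * v4 p ^ 2 - th2 p * T 0 p ^ 4 / 8)); [now apply pd_T_opp|].
  eapply pd_eq.
  - apply (pd_minus (fun p => 3 * v4 p ^ 2) (fun p => th2 p * T 0 p ^ 4 / 8)).
    + apply (pd_mult (fun _ => RtoC 3) (fun p => v4 p ^ 2)); [apply pd_const | apply (pd_pow v4 _ _ 2 P4)].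
    + apply (pd_div (fun p => th2 p * T 0 p ^ 4) (fun _ => RtoC 8)); [|apply pd_const | cnz].
      apply (pd_mult th2 (fun p => T 0 p ^ 4)); eauto.
  - numsimp. field; cnz. }
etransitivity; [exact (pd_unique_disc (fun p => T 4 (- p)) _ p _ _ Hp T4_opp_div (pd_T_opp 4 p Hp) P)|]. cbv beta.
rewrite T4_opp_div by auto.
replace (v3 p) with (v4 p + th2 p / 4) by (rewrite <- Ed; ring).
replace (T 2 (- p)) with (v4 p * T 0 (- p)) by (unfold v4; field; auto).
unfold th2. field; cnz.
Qed.

(** * Lambert series of the logarithmic derivative of theta_4 *)

Definition sg (n : Z) : C := if Z.even n then 1 else - (1).

Lemma sg_succ n : sg (n + 1) = - sg n.
Proof. unfold sg. rewrite Z.even_add. destruct (Z.even n); simpl; ring. Qed.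

Lemma sg_refl n : sg (1 - n) = - sg n.
Proof. unfold sg. rewrite Z.even_sub. destruct (Z.even n); simpl; ring. Qed.

Lemma opp_pow_sg (p : C) (n : nat) : (- p) ^ n = sg (Z.of_nat n) * p ^ n.
Proof.
induction n as [|n IH]; [unfold sg; simpl; ring|].
rewrite !Cpow_S, IH. replace (Z.of_nat (S n)) with (Z.of_nat n + 1)%Z by lia. rewrite sg_succ. ring.
Qed.

Lemma sg_square n : sg (n * n) = sg n.
Proof. unfold sg. rewrite Z.even_mul. destruct (Z.even n); auto. Qed.

Definition th4_term (p : C) (n : Z) : C := (- p) ^ theta_exp n.

Lemma th4_term_sg p n : th4_term p n = sg n * p ^ Z.to_nat (n * n).
Proof.
unfold th4_term, theta_exp. rewrite opp_pow_sg. f_equal.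
rewrite Z2Nat.id by nia. apply sg_square.
Qed.

Lemma th4_term_opp p n : th4_term p (- n) = th4_term p n.
Proof. unfold th4_term, theta_exp. do 2 f_equal. ring. Qed.

(** Half the hyperbolic cosecant of [k log (1 / p)] for [k = S i]; up to a constant these are the
    Fourier coefficients of the logarithmic derivative of [theta_4(z)]. *)
Definition csch (p : C) (i : nat) : C := p ^ S i / (1 - p ^ (2 * S i)).

Lemma one_sub_pow_nz (p : C) (k : nat) : (Cmod p < 1)%R -> (0 < k)%nat -> 1 - p ^ k <> 0.
Proof.
intros Hp Hk E. pose proof (Cmod_pow_lt_1 p k Hp Hk) as H.
replace (p ^ k) with (1 - (1 - p ^ k)) in H by ring. rewrite E in H.
replace (1 - 0) with (RtoC 1) in H by ring. rewrite Cmod_1 in H. lra.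
Qed.

Lemma one_sub_pow_le (p : C) (k : nat) : (Cmod p < 1)%R -> (0 < k)%nat ->
  (Cmod (/ (1 - p ^ k)) <= / (1 - Cmod p))%R.
Proof.
intros Hp Hk. rewrite Cmod_inv by now apply one_sub_pow_nz.
apply Rinv_le_contravar; [lra|].
assert (H1 : (Cmod (p ^ k) <= Cmod p)%R).
{ rewrite Cmod_pow. replace k with (S (pred k)) by lia. simpl.
  pose proof (Cmod_ge_0 p). apply Rle_trans with (Cmod p * 1)%R; [|lra]. apply Rmult_le_compat_l; auto.
  rewrite <- (pow1 (pred k)). apply pow_incr; lra. }
assert (H2 : (1 <= Cmod (1 - p ^ k) + Cmod (p ^ k))%R).
{ rewrite <- Cmod_1 at 1. replace (RtoC 1) with (1 - p ^ k + p ^ k) at 1 by ring. apply Cmod_triangle. }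
lra.
Qed.

Lemma lambert_type_abs (b : nat) (p : C) (m : nat -> nat) : (Cmod p < 1)%R -> (forall i, 0 < m i)%nat ->
  abs_summable (fun i => RtoC (INR (S i) ^ b) * (p ^ S i / (1 - p ^ m i))).
Proof.
intros Hp Hm. pose proof (Cmod_ge_0 p).
apply (abs_summable_le _ (fun i => RtoC (/ (1 - Cmod p)) * RtoC ((INR i + 1) ^ b * Cmod p ^ i))).
2:{ apply abs_summable_scal. apply geom_poly_summable. lra. }
intros i. unfold Cdiv. rewrite !Cmod_mult, !Cmod_R, S_INR, Cmod_pow.
pose proof (pos_INR i). assert (0 < / (1 - Cmod p))%R by (apply Rinv_0_lt_compat; lra).
assert (0 <= (INR i + 1) ^ b)%R by (apply pow_le; lra).
assert (0 <= Cmod p ^ i)%R by (apply pow_le; lra).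
rewrite !Rabs_pos_eq; auto; [|now apply Rmult_le_pos|lra].
replace (/ (1 - Cmod p) * ((INR i + 1) ^ b * Cmod p ^ i))%R with
  ((INR i + 1) ^ b * (Cmod p ^ i * / (1 - Cmod p)))%R by ring.
apply Rmult_le_compat_l; auto.
assert (Cmod p ^ S i <= Cmod p ^ i)%R by (simpl; nra).
apply Rmult_le_compat; auto; [apply pow_le; lra | apply Cmod_ge_0 | now apply one_sub_pow_le].
Qed.

Definition Kc (b : nat) (p : C) : C := Csum (fun i => RtoC (INR (S i) ^ b) * csch p i).

Lemma Kc_abs b p : (Cmod p < 1)%R -> abs_summable (fun i => RtoC (INR (S i) ^ b) * csch p i).
Proof. intros Hp. apply (lambert_type_abs b p (fun i => (2 * S i)%nat)); auto. lia. Qed.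

Lemma is_sum_Kc b p : (Cmod p < 1)%R -> is_sum (fun i => RtoC (INR (S i) ^ b) * csch p i) (Kc b p).
Proof. intros Hp. apply Csum_correct. now apply Kc_abs. Qed.

(** The resulting two-sided series vanishes by the symmetry [z -> 2n+1-z]. *)
Definition odd_term (p : C) (n z : Z) : C :=
  sg (n + 1 - z) * p ^ Z.to_nat ((n + 1 - z) * (n + 1 - z) - (n + 1 - z) + (n + 1)).

Lemma odd_term_abs p n : (Cmod p < 1)%R -> (0 <= n)%Z -> abs_summable (odd_term p n).
Proof.
intros Hp Hn.
apply (abs_summable_le _ (fun z => (fun u => p ^ Z.to_nat (u * u + u)) (z - (n + 1))%Z)).
2:{ apply (abs_summable_inj (fun z => (z - (n + 1))%Z) (fun u => p ^ Z.to_nat (u * u + u))); [lia | now apply Psi_abs]. }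
intros z. unfold odd_term. rewrite Cmod_mult.
assert (E : Cmod (sg (n + 1 - z)) = 1%R).
{ unfold sg. destruct (Z.even _); rewrite ?Cmod_opp; apply Cmod_1. }
rewrite E, Rmult_1_l, !Cmod_pow. pose proof (Cmod_ge_0 p).
set (u := (z - (n + 1))%Z). replace (n + 1 - z)%Z with (- u)%Z by (unfold u; ring).
assert (0 <= u * u + u)%Z by nia.
replace (- u * - u - - u + (n + 1))%Z with (u * u + u + (n + 1))%Z by ring.
rewrite Z2Nat.inj_add, pow_add by lia.
rewrite <- (Rmult_1_r (Cmod p ^ Z.to_nat (u * u + u))) at 2.
apply Rmult_le_compat_l; [apply pow_le; lra|].
rewrite <- (pow1 (Z.to_nat (n + 1))). apply pow_incr; lra.
Qed.

Lemma odd_term_sum p n : (Cmod p < 1)%R -> (0 <= n)%Z -> is_sum (odd_term p n) 0.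
Proof.
intros Hp Hn. pose proof (Csum_correct _ (odd_term_abs p n Hp Hn)) as S1.
set (l := Csum (odd_term p n)) in *.
pose proof S1 as S2.
apply (is_sum_reindex (fun z => (2 * n + 1 - z)%Z) (fun z => (2 * n + 1 - z)%Z)) in S2; try (intros; lia).
assert (S3 : is_sum (odd_term p n) (- l)).
{ apply is_sum_opp in S2. revert S2. apply is_sum_ext. intros z. unfold odd_term.
  replace (n + 1 - (2 * n + 1 - z))%Z with (1 - (n + 1 - z))%Z by ring. rewrite sg_refl.
  replace ((1 - (n + 1 - z)) * (1 - (n + 1 - z)) - (1 - (n + 1 - z)))%Z
    with ((n + 1 - z) * (n + 1 - z) - (n + 1 - z))%Z by ring. ring. }
assert (E : l = 0).
{ pose proof (is_sum_unique _ _ _ S1 S3) as E.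
  replace l with ((l + l) / 2) by field. rewrite E at 1. field. }
now rewrite <- E.
Qed.

(** Weighted by [p^(2n+1)], the ratio of [p^((n+1)^2)] to [p^(n^2)], row [n] combines with row
    [n + 1] so that the denominator [1 - p^(2k)] cancels. *)
Lemma th4_row_step p n i : (Cmod p < 1)%R -> (0 <= n)%Z ->
  csch p i * (th4_term p (n + 1 - Z.of_nat (S i)) - th4_term p (n + 1 + Z.of_nat (S i))) +
  p ^ Z.to_nat (2 * n + 1) *
    (csch p i * (th4_term p (n - Z.of_nat (S i)) - th4_term p (n + Z.of_nat (S i)))) =
  odd_term p n (Z.of_nat (S i)) + odd_term p n (- Z.of_nat (S i)).
Proof.
intros Hp Hn. pose proof (one_sub_pow_nz p (2 * S i) Hp ltac:(lia)) as H0.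
unfold csch. set (k := Z.of_nat (S i)).
replace (S i) with (Z.to_nat k) by (unfold k; lia).
replace (2 * Z.to_nat k)%nat with (Z.to_nat (2 * k)) in * by (unfold k; lia).
replace (2 * S i)%nat with (Z.to_nat (2 * k)) in * by (unfold k; lia).
assert (Hk : (1 <= k)%Z) by (unfold k; lia). clearbody k.
rewrite !th4_term_sg. unfold odd_term.
replace (n + 1 - k)%Z with (n - k + 1)%Z by ring.
replace (n + 1 - - k)%Z with (n + k + 1)%Z by ring.
replace (n + 1 + k)%Z with (n + k + 1)%Z by ring. rewrite !sg_succ.
set (P1 := p ^ Z.to_nat ((n - k + 1) * (n - k + 1))).
set (X := p ^ Z.to_nat ((n + k) * (n + k) + (2 * n + 1))).
set (y := p ^ Z.to_nat (2 * k)) in *. set (x := p ^ Z.to_nat k).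
assert (E1 : p ^ Z.to_nat ((n + k + 1) * (n + k + 1)) = y * X).
{ unfold y, X. rewrite !zpow_add by first [apply Z.square_nonneg | lia | nia]. do 2 f_equal. ring. }
assert (E2 : p ^ Z.to_nat (2 * n + 1) * p ^ Z.to_nat ((n - k) * (n - k)) = y * P1).
{ unfold y, P1. rewrite !zpow_add by first [apply Z.square_nonneg | lia | nia]. do 2 f_equal. ring. }
assert (E3 : p ^ Z.to_nat (2 * n + 1) * p ^ Z.to_nat ((n + k) * (n + k)) = X).
{ unfold X. rewrite !zpow_add by first [apply Z.square_nonneg | lia | nia]. do 2 f_equal. ring. }
assert (E4 : p ^ Z.to_nat ((n - k + 1) * (n - k + 1) - (n - k + 1) + (n + 1)) = x * P1).
{ unfold x, P1. rewrite !zpow_add by first [apply Z.square_nonneg | lia | nia]. do 2 f_equal. ring. }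
assert (E5 : p ^ Z.to_nat ((n + k + 1) * (n + k + 1) - (n + k + 1) + (n + 1)) = x * X).
{ unfold x, X. rewrite !zpow_add by first [apply Z.square_nonneg | lia | nia]. do 2 f_equal. ring. }
rewrite E1, E4, E5.
transitivity (x / (1 - y) * (- sg (n - k) * P1 - - sg (n + k) * (y * X)) +
  (x / (1 - y)) * (sg (n - k) * (p ^ Z.to_nat (2 * n + 1) * p ^ Z.to_nat ((n - k) * (n - k)))
   - sg (n + k) * (p ^ Z.to_nat (2 * n + 1) * p ^ Z.to_nat ((n + k) * (n + k))))); [field; auto|].
rewrite E2, E3. field; auto.
Qed.

(** The expansion of the logarithmic derivative of [theta_4(z)], compared coefficientwise. *)
Lemma th4_row_sum p n : (Cmod p < 1)%R -> is_sum (fun i : nat =>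
  csch p i * (th4_term p (n - Z.of_nat (S i)) - th4_term p (n + Z.of_nat (S i))))
  (- (RtoC (IZR n) * th4_term p n)).
Proof.
intros Hp.
assert (Hpos : forall m : nat, is_sum (fun i : nat =>
  csch p i * (th4_term p (Z.of_nat m - Z.of_nat (S i)) - th4_term p (Z.of_nat m + Z.of_nat (S i))))
  (- (RtoC (IZR (Z.of_nat m)) * th4_term p (Z.of_nat m)))).
{ induction m as [|m IH].
  - simpl (IZR (Z.of_nat 0)). refine (is_sum_eq _ _ _ (is_sum_ext _ _ _ _ is_sum_0) _); [|ring]. intros i.
    replace (Z.of_nat 0 - Z.of_nat (S i))%Z with (- (Z.of_nat 0 + Z.of_nat (S i)))%Z by lia.
    rewrite th4_term_opp. ring.
  - set (n' := Z.of_nat m) in *. assert (Hn' : (0 <= n')%Z) by (unfold n'; lia).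
    replace (Z.of_nat (S m)) with (n' + 1)%Z by (unfold n'; lia). clearbody n'.
    (* The two-sided sum is 0, so without its central term it equals minus that term,
       [th4_term p (n' + 1)]. This supplies the one by which the coefficient [n'] grows. *)
    pose proof (is_sum_Z_fold _ _ (odd_term_abs p n' Hp Hn') (odd_term_sum p n' Hp Hn')) as H1.
    pose proof (is_sum_minus _ _ _ _ H1 (is_sum_scal _ _ (p ^ Z.to_nat (2 * n' + 1)) IH)) as H2.
    cbv beta in H2. refine (is_sum_eq _ _ _ (is_sum_ext _ _ _ _ H2) _).
    + intros i. rewrite <- (th4_row_step p n' i Hp Hn'). ring.
    + unfold odd_term. rewrite !th4_term_sg. replace (n' + 1 - 0)%Z with (n' + 1)%Z by ring.
      replace ((n' + 1) * (n' + 1) - (n' + 1) + (n' + 1))%Z with ((n' + 1) * (n' + 1))%Z by ring.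
      replace (p ^ Z.to_nat ((n' + 1) * (n' + 1))) with
        (p ^ Z.to_nat (2 * n' + 1) * p ^ Z.to_nat (n' * n')).
      2:{ rewrite zpow_add by nia. do 2 f_equal. ring. }
      rewrite sg_succ, plus_IZR, RtoC_plus. ring. }
destruct (Z.le_gt_cases 0 n) as [H|H].
- specialize (Hpos (Z.to_nat n)). rewrite Z2Nat.id in Hpos; auto.
- specialize (Hpos (Z.to_nat (- n))). rewrite Z2Nat.id in Hpos by lia.
  apply is_sum_opp in Hpos. rewrite th4_term_opp, opp_IZR, RtoC_opp in Hpos.
  refine (is_sum_eq _ _ _ (is_sum_ext _ _ _ _ Hpos) _); [|ring]. intros i.
  replace (- n - Z.of_nat (S i))%Z with (- (n + Z.of_nat (S i)))%Z by ring.
  replace (- n + Z.of_nat (S i))%Z with (- (n - Z.of_nat (S i)))%Z by ring.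
  rewrite !th4_term_opp. ring.
Qed.

(** Rows are multiplied by [n^j] and summed over [n]. Shifting [n] by [k] moves the displacement
    from the theta term to the weight, which becomes [(m + k)^j] or [(m - k)^j]. *)
Lemma th4_double_sum p j S1 S2 : (Cmod p < 1)%R ->
  is_sum (fun x : Z * nat => (RtoC (IZR (fst x)) + RtoC (INR (S (snd x)))) ^ j *
    (th4_term p (fst x) * csch p (snd x))) S1 ->
  is_sum (fun x : Z * nat => (RtoC (IZR (fst x)) - RtoC (INR (S (snd x)))) ^ j *
    (th4_term p (fst x) * csch p (snd x))) S2 ->
  T (j + 1) (- p) = S2 - S1.
Proof.
intros Hp H1 H2.
apply (is_sum_reindex (fun x : Z * nat => (fst x - Z.of_nat (S (snd x)), snd x)%Z)
  (fun x : Z * nat => (fst x + Z.of_nat (S (snd x)), snd x)%Z)) in H1;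
  [|intros [m i]; cbn [fst snd]; f_equal; lia | intros [m i]; cbn [fst snd]; f_equal; lia].
apply (is_sum_reindex (fun x : Z * nat => (fst x + Z.of_nat (S (snd x)), snd x)%Z)
  (fun x : Z * nat => (fst x - Z.of_nat (S (snd x)), snd x)%Z)) in H2;
  [|intros [m i]; cbn [fst snd]; f_equal; lia | intros [m i]; cbn [fst snd]; f_equal; lia].
pose proof (is_sum_minus _ _ _ _ H1 H2) as H3. cbn [fst snd] in H3.
assert (H4 : is_sum (fun x : Z * nat => RtoC (IZR (fst x)) ^ j * (csch p (snd x) *
   (th4_term p (fst x - Z.of_nat (S (snd x))) - th4_term p (fst x + Z.of_nat (S (snd x)))))) (S1 - S2)).
{ revert H3. apply is_sum_ext. intros [n i]. cbn [fst snd].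
  rewrite minus_IZR, plus_IZR, RtoC_minus, RtoC_plus, <- INR_IZR_INZ.
  replace (RtoC (IZR n) - RtoC (INR (S i)) + RtoC (INR (S i))) with (RtoC (IZR n)) by ring.
  replace (RtoC (IZR n) + RtoC (INR (S i)) - RtoC (INR (S i))) with (RtoC (IZR n)) by ring. ring. }
apply (is_sum_fubini (fun n i => RtoC (IZR n) ^ j * (csch p i *
   (th4_term p (n - Z.of_nat (S i)) - th4_term p (n + Z.of_nat (S i)))))
  (fun n => RtoC (IZR n) ^ j * (- (RtoC (IZR n) * th4_term p n)))) in H4.
2:{ intros n. apply is_sum_scal. now apply th4_row_sum. }
apply is_sum_opp in H4.
replace (S2 - S1) with (- (S1 - S2)) by ring.
apply Csum_eq. revert H4. apply is_sum_ext. intros n. unfold th4_term.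
rewrite pow_add, RtoC_mult, !RtoC_pow. simpl (_ ^ 1). ring.
Qed.

Lemma th4_mono p a b : (Cmod p < 1)%R ->
  is_sum (fun x : Z * nat => RtoC (IZR (fst x)) ^ a * RtoC (INR (S (snd x))) ^ b *
    (th4_term p (fst x) * csch p (snd x))) (T a (- p) * Kc b p).
Proof.
intros Hp.
pose proof (is_sum_prod _ _ _ _ (T_abs a (- p) ltac:(auto)) (Kc_abs b p Hp)
  (is_sum_T a (- p) ltac:(auto)) (is_sum_Kc b p Hp)) as H.
revert H. apply is_sum_ext. intros [n i]. cbn [fst snd]. rewrite !RtoC_pow. unfold th4_term. ring.
Qed.

Lemma T2_opp_Kc p : (Cmod p < 1)%R -> T 2 (- p) = - (2 * T 0 (- p) * Kc 1 p).
Proof.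
intros Hp. pose proof (th4_mono p 1 0 Hp) as A. pose proof (th4_mono p 0 1 Hp) as B.
refine (eq_trans (th4_double_sum p 1 _ _ Hp (is_sum_ext _ _ _ _ (is_sum_plus _ _ _ _ A B))
  (is_sum_ext _ _ _ _ (is_sum_minus _ _ _ _ A B))) _); [intros x; ring | intros x; ring | ring].
Qed.

(** From [(m - k)^3 - (m + k)^3 = - (6 m^2 k + 2 k^3)]. *)
Lemma T4_opp_Kc p : (Cmod p < 1)%R ->
  T 4 (- p) = - (6 * T 2 (- p) * Kc 1 p + 2 * T 0 (- p) * Kc 3 p).
Proof.
intros Hp. pose proof (th4_mono p 3 0 Hp) as A0. pose proof (is_sum_scal _ _ 3 (th4_mono p 2 1 Hp)) as A1.
pose proof (is_sum_scal _ _ 3 (th4_mono p 1 2 Hp)) as A2. pose proof (th4_mono p 0 3 Hp) as A3.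
pose proof (is_sum_plus _ _ _ _ A0 A2) as B1. pose proof (is_sum_plus _ _ _ _ A1 A3) as B2.
refine (eq_trans (th4_double_sum p 3 _ _ Hp (is_sum_ext _ _ _ _ (is_sum_plus _ _ _ _ B1 B2))
  (is_sum_ext _ _ _ _ (is_sum_minus _ _ _ _ B1 B2))) _); [intros x; ring | intros x; ring | ring].
Qed.

(** From [(m - k)^5 - (m + k)^5 = - (10 m^4 k + 20 m^2 k^3 + 2 k^5)]. *)
Lemma T6_opp_Kc p : (Cmod p < 1)%R ->
  T 6 (- p) = - (10 * T 4 (- p) * Kc 1 p + 20 * T 2 (- p) * Kc 3 p + 2 * T 0 (- p) * Kc 5 p).
Proof.
intros Hp. pose proof (th4_mono p 5 0 Hp) as A0. pose proof (is_sum_scal _ _ 5 (th4_mono p 4 1 Hp)) as A1.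
pose proof (is_sum_scal _ _ 10 (th4_mono p 3 2 Hp)) as A2.
pose proof (is_sum_scal _ _ 10 (th4_mono p 2 3 Hp)) as A3.
pose proof (is_sum_scal _ _ 5 (th4_mono p 1 4 Hp)) as A4. pose proof (th4_mono p 0 5 Hp) as A5.
pose proof (is_sum_plus _ _ _ _ (is_sum_plus _ _ _ _ A0 A2) A4) as B1.
pose proof (is_sum_plus _ _ _ _ (is_sum_plus _ _ _ _ A1 A3) A5) as B2.
refine (eq_trans (th4_double_sum p 5 _ _ Hp (is_sum_ext _ _ _ _ (is_sum_plus _ _ _ _ B1 B2))
  (is_sum_ext _ _ _ _ (is_sum_minus _ _ _ _ B1 B2))) _); [intros x; ring | intros x; ring | ring].
Qed.

Lemma v4_Kc p : (Cmod p < 1)%R -> v4 p = - (2) * Kc 1 p.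
Proof. intros Hp. unfold v4. rewrite T2_opp_Kc by auto. field; auto. Qed.

(** Halphen's equation and the Lambert expansion both evaluate [T 4 (- p)]; in the comparison
    [3 v4^2] cancels. *)
Lemma Kc3 p : (Cmod p < 1)%R -> 16 * Kc 3 p = th2 p * T 0 p ^ 4.
Proof.
intros Hp. pose proof (T4_opp_Kc p Hp) as E. rewrite T4_opp_div in E by auto.
replace (T 2 (- p)) with (v4 p * T 0 (- p)) in E by (unfold v4; field; auto).
replace (Kc 1 p) with (- v4 p / 2) in E by (rewrite v4_Kc by auto; field; cnz).
transitivity (8 / T 0 (- p) * (- - (6 * (v4 p * T 0 (- p)) * (- v4 p / 2) + 2 * T 0 (- p) * Kc 3 p)
  + 3 * v4 p ^ 2 * T 0 (- p))); [field; cnz|].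
rewrite <- E. field; cnz.
Qed.

Lemma Kc5 p : (Cmod p < 1)%R -> 16 * Kc 5 p = th2 p * T 0 p ^ 4 * (th2 p + T 0 p ^ 4).
Proof.
intros Hp. pose proof (T6_opp_Kc p Hp) as E. rewrite T4_opp_div, T6_opp_div in E by auto.
replace (T 2 (- p)) with (v4 p * T 0 (- p)) in E by (unfold v4; field; auto).
replace (Kc 1 p) with (- v4 p / 2) in E by (rewrite v4_Kc by auto; field; cnz).
replace (Kc 3 p) with (th2 p * T 0 p ^ 4 / 16) in E by (rewrite <- Kc3 by auto; field; cnz).
match type of E with _ = - (?x + RtoC 2 * T 0 (- p) * Kc 5 p) =>
  transitivity (8 / T 0 (- p) * (- - (x + 2 * T 0 (- p) * Kc 5 p) - x)); [field; cnz|] end.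
rewrite <- E. field; cnz.
Qed.

Lemma lambert_abs k q : (Cmod q < 1)%R ->
  abs_summable (fun n => RtoC (INR (S n)) ^ k * (q ^ S n / (1 - q ^ S n))).
Proof.
intros Hq. pose proof (lambert_type_abs k q S Hq ltac:(intros; lia)) as H.
apply (abs_summable_le _ _) with (2 := H). intros i. rewrite RtoC_pow. lra.
Qed.

Lemma is_sum_lambert k q : (Cmod q < 1)%R ->
  is_sum (fun n => RtoC (INR (S n)) ^ k * (q ^ S n / (1 - q ^ S n))) (lambert k q).
Proof.
intros Hq. pose proof (Csum_correct _ (lambert_abs k q Hq)) as H.
unfold lambert. now rewrite (is_sum_CSeries _ _ H).
Qed.

(** Termwise [x / (1 - x) - x^2 / (1 - x^2) = x / (1 - x^2)]: squaring the nome changes a Lambert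
    series by [Kc]. *)
Lemma lambert_sub k p : (Cmod p < 1)%R -> lambert k p - lambert k (p ^ 2) = Kc k p.
Proof.
intros Hp. symmetry. apply Csum_eq.
generalize (is_sum_minus _ _ _ _ (is_sum_lambert k p Hp) (is_sum_lambert k (p ^ 2) ltac:(auto))).
apply is_sum_ext. intros i. rewrite RtoC_pow. unfold csch.
pose proof (one_sub_pow_nz p (S i) Hp ltac:(lia)) as N1.
pose proof (one_sub_pow_nz p (2 * S i) Hp ltac:(lia)) as N2.
rewrite <- Cpow_mult_r. set (x := p ^ S i) in *.
assert (E : p ^ (2 * S i) = x ^ 2) by (unfold x; rewrite <- Cpow_mult_r; f_equal; lia).
rewrite E in *. field. split; auto.
Qed.

Lemma lambert_0 k : lambert k 0 = 0.
Proof.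
apply (is_sum_unique _ _ _ (is_sum_lambert k 0 Cmod_0_lt_1)).
generalize (@is_sum_0 nat). apply is_sum_ext. intros i. rewrite Cpow_S. unfold Cdiv. ring.
Qed.

Lemma ct_lambert_0 k : ct (lambert k) 0.
Proof.
intros eps He. rewrite lambert_0.
destruct (geom_poly_summable k (1/2) ltac:(lra)) as [M HM].
assert (HM0 : (0 <= M)%R) by (apply (HM nil); constructor).
(* Radius [1/2] bounds the inverse denominators by 2; the other bound makes the total [2 |x| M]
   smaller than [eps]. *)
exists (Rmin (1/2) (eps / (2 * M + 1))). split.
{ apply Rmin_pos; [lra | apply Rdiv_lt_0_compat; lra]. }
intros x Hx. replace (x - 0) with x in Hx by ring.
pose proof (Rlt_le_trans _ _ _ Hx (Rmin_l _ _)) as X1.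
pose proof (Rlt_le_trans _ _ _ Hx (Rmin_r _ _)) as X2.
assert (Hx1 : (Cmod x < 1)%R) by lra. pose proof (Cmod_ge_0 x).
replace (lambert k x - 0) with (lambert k x) by ring.
apply Rle_lt_trans with (2 * Cmod x * M)%R.
- apply (is_sum_bound _ _ _ (is_sum_lambert k x Hx1)). intros L HN.
  apply Rle_trans with (rsum (fun n => (2 * Cmod x * Cmod (RtoC ((INR n + 1) ^ k * (1 / 2) ^ n)))%R) L).
  2:{ rewrite rsum_scal. apply Rmult_le_compat_l; [lra|]. now apply HM. }
  apply rsum_le. intros i. unfold Cdiv. rewrite !Cmod_mult, !Cmod_pow, !Cmod_R, S_INR.
  pose proof (pos_INR i).
  rewrite !(Rabs_pos_eq (INR i + 1)) by lra.
  assert (0 <= (INR i + 1) ^ k)%R by (apply pow_le; lra).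
  assert (0 <= (1 / 2) ^ i)%R by (apply pow_le; lra).
  rewrite Rabs_pos_eq by now apply Rmult_le_pos.
  replace (2 * Cmod x * ((INR i + 1) ^ k * (1 / 2) ^ i))%R with
    ((INR i + 1) ^ k * ((Cmod x * (1 / 2) ^ i) * 2))%R by ring.
  apply Rmult_le_compat_l; auto. apply Rmult_le_compat; auto.
  + apply pow_le; lra.
  + apply Cmod_ge_0.
  + simpl. apply Rmult_le_compat_l; auto. apply pow_incr. lra.
  + eapply Rle_trans; [apply one_sub_pow_le; auto; lia|].
    replace 2%R with (/ (1/2))%R by field. apply Rinv_le_contravar; lra.
- apply Rle_lt_trans with (Cmod x * (2 * M + 1))%R; [nra|].
  apply Rmult_lt_reg_r with (/ (2 * M + 1))%R; [apply Rinv_0_lt_compat; lra|].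
  rewrite Rmult_assoc, Rinv_r, Rmult_1_r by lra. exact X2.
Qed.

Lemma ct_lambert_sq_0 k : ct (fun p => lambert k (p ^ 2)) 0.
Proof.
apply (ct_comp (lambert k) (fun p => p ^ 2)).
- replace (0 ^ 2) with (RtoC 0) by ring. apply ct_lambert_0.
- apply (cd_ct _ _ _ (cd_pow (fun x => x) 0 _ 2 (cd_id 0))).
Qed.

(** * Eisenstein series in terms of theta constants *)

Lemma T0_dbl_quartic p : (Cmod p < 1)%R -> T 0 (p ^ 2) ^ 4 = (T 0 p ^ 2 + T 0 (- p) ^ 2) ^ 2 / 4.
Proof. intros Hp. rewrite T0_sq_add by auto. field; cnz. Qed.

Lemma th2_dbl p : (Cmod p < 1)%R -> th2 (p ^ 2) = (T 0 p ^ 2 - T 0 (- p) ^ 2) ^ 2 / 4.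
Proof. intros Hp. rewrite <- th2_sq by auto. field; cnz. Qed.

(** The defect [f] is invariant under squaring the nome: the Lambert series changes by [Kc 1], which
    [v4_Kc] turns into [v4], and [v4_dbl] with the mean formulas transforms the theta side. The
    argument is [p ^ 2] because [E2] is a series in [q = p^2]. *)
Lemma E2_theta p : (Cmod p < 1)%R -> 1 - 24 * lambert 1 (p ^ 2) = 12 * v4 p + th2 p + T 0 p ^ 4.
Proof.
intros Hp. set (f := fun p => 12 * v4 p + th2 p + T 0 p ^ 4 - 1 + 24 * lambert 1 (p ^ 2)).
assert (Ef : f p = 0).
{ rewrite (dbl_invariant f); auto.
  - unfold f. destruct v_at_0 as [_ ->]. rewrite th2_at_0, T0_at_0.
    replace (0 ^ 2) with (RtoC 0) by ring. rewrite lambert_0. ring.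
  - unfold f. apply ct_plus; [|apply ct_mult; [apply ct_const | apply ct_lambert_sq_0]].
    eapply cd_ct with (f := fun y => 12 * v4 y + th2 y + T 0 y ^ 4 - 1).
    unfold v4, th2. cd_auto; rewrite ?Copp_0; auto.
  - clear p Hp. intros p Hp. unfold f.
    replace (lambert 1 (p ^ 2)) with (Kc 1 (p ^ 2) + lambert 1 ((p ^ 2) ^ 2))
      by (rewrite <- lambert_sub by auto; ring).
    replace (Kc 1 (p ^ 2)) with (- v4 (p ^ 2) / 2) by (rewrite v4_Kc by auto; field; cnz).
    replace (v4 (p ^ 2)) with ((v3 p + v4 p) / 4) by (rewrite v4_dbl by auto; field; cnz).
    replace (v3 p) with (v4 p + th2 p / 4) by (rewrite <- v3_sub_v4 by auto; ring).
    rewrite T0_dbl_quartic, th2_dbl by auto. unfold th2. field; cnz. }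
transitivity (f p + 1 - 24 * lambert 1 (p ^ 2)); [rewrite Ef; ring | unfold f; ring].
Qed.

(** The same doubling invariance, with [Kc3] as the change of the Lambert series; only theta
    constants occur. *)
Lemma E4_theta p : (Cmod p < 1)%R ->
  1 + 240 * lambert 3 (p ^ 2) = T 0 p ^ 8 - T 0 p ^ 4 * T 0 (- p) ^ 4 + T 0 (- p) ^ 8.
Proof.
intros Hp. set (f := fun p => T 0 p ^ 8 - T 0 p ^ 4 * T 0 (- p) ^ 4 + T 0 (- p) ^ 8 - 1 - 240 * lambert 3 (p ^ 2)).
assert (Ef : f p = 0).
{ rewrite (dbl_invariant f); auto.
  - unfold f. rewrite Copp_0, T0_at_0.
    replace (0 ^ 2) with (RtoC 0) by ring. rewrite lambert_0. ring.
  - unfold f. apply (ct_ext (fun y => (T 0 y ^ 8 - T 0 y ^ 4 * T 0 (- y) ^ 4 + T 0 (- y) ^ 8 - 1) +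
      - (240) * lambert 3 (y ^ 2))); [intros; ring|].
    apply ct_plus; [|apply ct_mult; [apply ct_const | apply ct_lambert_sq_0]].
    eapply cd_ct. cd_auto; rewrite ?Copp_0; auto.
  - clear p Hp. intros p Hp. unfold f.
    replace (lambert 3 (p ^ 2)) with (16 * Kc 3 (p ^ 2) / 16 + lambert 3 ((p ^ 2) ^ 2)).
    2:{ rewrite <- lambert_sub by auto. field; cnz. }
    rewrite Kc3, th2_dbl by auto.
    replace (T 0 (p ^ 2) ^ 8) with ((T 0 (p ^ 2) ^ 4) ^ 2) by ring. rewrite T0_dbl_quartic by auto.
    replace (T 0 (- p ^ 2) ^ 8) with ((T 0 (- p ^ 2) ^ 2) ^ 4) by ring.
    replace (T 0 (- p ^ 2) ^ 4) with ((T 0 (- p ^ 2) ^ 2) ^ 2) by ring.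
    rewrite <- T0_mul_neg by auto. field; cnz. }
transitivity (f p + 1 + 240 * lambert 3 (p ^ 2)); [rewrite Ef; ring | unfold f; ring].
Qed.

Lemma E6_theta p : (Cmod p < 1)%R -> 1 - 504 * lambert 5 (p ^ 2) =
  (th2 p + T 0 p ^ 4) * (T 0 p ^ 4 + T 0 (- p) ^ 4) * (T 0 (- p) ^ 4 - th2 p) / 2.
Proof.
intros Hp. set (f := fun p => (th2 p + T 0 p ^ 4) * (T 0 p ^ 4 + T 0 (- p) ^ 4) * (T 0 (- p) ^ 4 - th2 p) / 2
   - 1 + 504 * lambert 5 (p ^ 2)).
assert (Ef : f p = 0).
{ rewrite (dbl_invariant f); auto.
  - unfold f. rewrite th2_at_0, Copp_0, T0_at_0.
    replace (0 ^ 2) with (RtoC 0) by ring. rewrite lambert_0. field; cnz.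
  - unfold f. apply ct_plus; [|apply ct_mult; [apply ct_const | apply ct_lambert_sq_0]].
    eapply cd_ct with (f := fun y => (th2 y + T 0 y ^ 4) * (T 0 y ^ 4 + T 0 (- y) ^ 4) * (T 0 (- y) ^ 4 - th2 y) / 2 - 1).
    unfold th2. cd_auto; rewrite ?Copp_0; auto.
  - clear p Hp. intros p Hp. unfold f.
    replace (lambert 5 (p ^ 2)) with (16 * Kc 5 (p ^ 2) / 16 + lambert 5 ((p ^ 2) ^ 2)).
    2:{ rewrite <- lambert_sub by auto. field; cnz. }
    rewrite Kc5, th2_dbl, T0_dbl_quartic by auto.
    replace (T 0 (- p ^ 2) ^ 4) with ((T 0 (- p ^ 2) ^ 2) ^ 2) by ring.
    rewrite <- T0_mul_neg by auto. unfold th2. field; cnz. }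
transitivity (f p + 1 - 504 * lambert 5 (p ^ 2)); [rewrite Ef; ring | unfold f; ring].
Qed.

(** * The hypergeometric equation along the modular lambda function *)

Definition hcoef (n : nat) : C :=
  pochhammer (RtoC (1 / 2)) n * pochhammer (RtoC (1 / 2)) n / (pochhammer 1 n * RtoC (INR (fact n))).

Definition hyp (x : C) : C := hyp2F1 (RtoC (1 / 2)) (RtoC (1 / 2)) 1 x.

Lemma poch_1 n : pochhammer 1 n = RtoC (INR (fact n)).
Proof.
induction n as [|n IH]; [reflexivity|].
cbn [pochhammer]. rewrite IH, fact_simpl, mult_INR, RtoC_mult, S_INR, RtoC_plus. ring.
Qed.

Lemma RtoC_nz (x : R) : x <> 0%R -> RtoC x <> 0.
Proof. intros H E. apply H. now apply RtoC_inj in E. Qed.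

Lemma fact_nz n : RtoC (INR (fact n)) <> 0.
Proof. apply RtoC_nz, INR_fact_neq_0. Qed.

Lemma hcoef_S n : (RtoC (INR n) + 1) ^ 2 * hcoef (S n) = (RtoC (INR n) + 1 / 2) ^ 2 * hcoef n.
Proof.
unfold hcoef. rewrite !poch_1, fact_simpl, mult_INR, RtoC_mult, S_INR, RtoC_plus. cbn [pochhammer].
pose proof (fact_nz n). assert (RtoC (INR n) + 1 <> 0).
{ rewrite <- RtoC_plus. apply RtoC_nz. pose proof (pos_INR n). lra. }
rewrite RtoC_div by lra. field. cnz.
Qed.

Lemma hcoef_0 : hcoef 0 = 1.
Proof. unfold hcoef. simpl. field. Qed.

Lemma hcoef_le_1 n : (Cmod (hcoef n) <= 1)%R.
Proof.
induction n as [|n IH].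
- rewrite hcoef_0, Cmod_1. lra.
- pose proof (f_equal Cmod (hcoef_S n)) as E. rewrite !Cmod_mult, !Cmod_pow in E.
  replace (RtoC (INR n) + 1 / 2) with (RtoC (INR n + 1 / 2)) in E by (rewrite RtoC_plus, RtoC_div by lra; auto).
  rewrite <- RtoC_plus, !Cmod_R in E. pose proof (pos_INR n).
  rewrite !Rabs_pos_eq in E by lra. pose proof (Cmod_ge_0 (hcoef (S n))). nra.
Qed.

Lemma hcoef_conv : pseries_conv hcoef (fun n => n).
Proof.
intros r Hr. apply (abs_summable_le _ (fun n => RtoC ((INR n + 1) ^ 2 * r ^ n))).
- intros n. rewrite Cmod_mult. rewrite <- (Rmult_1_l (Cmod (RtoC _))) at 2.
  apply Rmult_le_compat_r; [apply Cmod_ge_0 | apply hcoef_le_1].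
- apply geom_poly_summable. lra.
Qed.

Lemma hyp_pseries x : (Cmod x < 1)%R -> hyp x = pseries hcoef (fun n => n) x.
Proof. intros Hx. apply is_sum_CSeries. exact (is_sum_pseries _ _ x hcoef_conv Hx). Qed.

Definition dhyp (x : C) : C := dpseries hcoef (fun n => n) x.

Lemma cd_hyp x : (Cmod x < 1)%R -> cd hyp x (dhyp x).
Proof.
intros Hx. apply (cd_ext_loc (pseries hcoef (fun n => n))).
- generalize (near_disc x Hx). apply near_imp. intros y Hy. symmetry. now apply hyp_pseries.
- apply cd_pseries; auto. apply hcoef_conv.
Qed.

(** Coefficients of [x (1 - x) F'(x)]. *)
Definition gcoef (n : nat) : C :=
  RtoC (INR n) * hcoef n - match n with O => 0 | S m => RtoC (INR m) * hcoef m end.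

Lemma gcoef_conv : pseries_conv gcoef (fun n => n).
Proof.
intros r Hr. apply (abs_summable_le _ (fun n => 2 * RtoC ((INR n + 1) ^ 3 * r ^ n))).
2:{ apply abs_summable_scal, geom_poly_summable. lra. }
intros n. rewrite !Cmod_mult, !Cmod_R. pose proof (pos_INR n).
assert (0 <= r ^ n)%R by (apply pow_le; lra).
rewrite (Rabs_pos_eq 2), !Rabs_pos_eq by (try apply Rmult_le_pos; try apply pow_le; lra).
assert (Hg : (Cmod (gcoef n) <= 2 * (INR n + 1))%R).
{ unfold gcoef. eapply Rle_trans; [apply Cmod_triangle|]. rewrite Cmod_opp.
  assert (B : forall m, (Cmod (RtoC (INR m) * hcoef m) <= INR m)%R).
  { intros m. rewrite Cmod_mult, Cmod_R, Rabs_pos_eq by apply pos_INR.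
    rewrite <- (Rmult_1_r (INR m)) at 2. apply Rmult_le_compat_l; [apply pos_INR | apply hcoef_le_1]. }
  pose proof (B n). destruct n as [|m].
  - rewrite Cmod_0. lra.
  - pose proof (B m). rewrite S_INR in *. lra. }
replace (2 * ((INR n + 1) ^ 3 * r ^ n))%R with (2 * (INR n + 1) * ((INR n + 1) ^ 2 * r ^ n))%R by ring.
apply Rmult_le_compat_r; auto. apply Rmult_le_pos; auto. apply pow_le; lra.
Qed.

Lemma is_sum_dhyp x : (Cmod x < 1)%R ->
  is_sum (fun n => hcoef n * (RtoC (INR n) * x ^ pred n)) (dhyp x).
Proof. intros Hx. apply Csum_correct. exact (dpseries_abs _ _ x hcoef_conv Hx). Qed.

Lemma gcoef_sum x : (Cmod x < 1)%R -> pseries gcoef (fun n => n) x = x * (1 - x) * dhyp x.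
Proof.
intros Hx. apply Csum_eq.
pose proof (is_sum_scal _ _ x (is_sum_dhyp x Hx)) as S1.
assert (S1' : is_sum (fun n => RtoC (INR n) * hcoef n * x ^ n) (x * dhyp x)).
{ revert S1. apply is_sum_ext. intros [|m]; [simpl; ring|].
  change (pred (S m)) with m. rewrite Cpow_S. ring. }
pose proof (is_sum_scal _ _ x S1') as S2.
assert (S2' : is_sum (fun n => match n with O => 0 | S m => RtoC (INR m) * hcoef m end * x ^ n) (x * (x * dhyp x))).
{ refine (is_sum_eq _ _ _ (is_sum_S _ _ (is_sum_ext _ _ _ _ S2)) _).
  - intros n. rewrite Cpow_S. ring.
  - simpl. ring. }
refine (is_sum_eq _ _ _ (is_sum_ext _ _ _ _ (is_sum_minus _ _ _ _ S1' S2')) _); [|ring].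
intros n. unfold gcoef. ring.
Qed.

(** The hypergeometric equation in Sturm-Liouville form, [(x (1 - x) F')' = F / 4]. *)
Lemma cd_hyp_ode x : (Cmod x < 1)%R -> cd (fun y => y * (1 - y) * dhyp y) x (hyp x / 4).
Proof.
intros Hx. apply (cd_ext_loc (pseries gcoef (fun n => n))).
{ generalize (near_disc x Hx). apply near_imp. intros y Hy. now apply gcoef_sum. }
eapply cd_eq; [apply cd_pseries; auto; apply gcoef_conv|].
rewrite hyp_pseries by auto.
apply Csum_eq. refine (is_sum_eq _ _ _ (is_sum_S _ _
  (is_sum_ext _ _ _ _ (is_sum_scal _ _ (/ 4) (is_sum_pseries _ _ x hcoef_conv Hx)))) _).
- intros n. unfold gcoef. change (pred (S n)) with n. rewrite S_INR, RtoC_plus.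
  transitivity (((RtoC (INR n) + 1) ^ 2 * hcoef (S n) - (RtoC (INR n) + 1) * RtoC (INR n) * hcoef n) * x ^ n); [|ring].
  rewrite hcoef_S. field.
- simpl. field.
Qed.

Definition lam (p : C) : C := th2 p / T 0 p ^ 4.

Lemma one_sub_lam p : (Cmod p < 1)%R -> 1 - lam p = T 0 (- p) ^ 4 / T 0 p ^ 4.
Proof. intros Hp. unfold lam, th2. field; auto. Qed.

(** By [v3_sub_v4] the logarithmic derivative of [lambda] is [theta_4^4]. The factor
    [lambda (1 - lambda)] matches the leading coefficient of the hypergeometric operator, so its
    Sturm-Liouville form pulls back cleanly to the nome. *)
Lemma pd_lam p : (Cmod p < 1)%R -> pd lam p (lam p * (1 - lam p) * T 0 p ^ 4).
Proof.
intros Hp. pose proof (T0_nonzero p Hp). unfold lam.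
eapply pd_eq.
- apply (pd_div th2 (fun p => T 0 p ^ 4)); [now apply pd_th2 | now apply pd_th3_4 | now apply Cpow_nz].
- cbv beta. replace (v3 p) with (v4 p + th2 p / 4) by (rewrite <- v3_sub_v4 by auto; ring).
  unfold th2. field; cnz.
Qed.

(** The Wronskian of [hyp (lam p)] and [theta_3^2] under [p d/dp], divided by [theta_3^4]. By Abel's
    formula this normalisation makes it constant, and it is also the derivative of [Rt]. *)
Definition Wr (p : C) : C :=
  lam p * (1 - lam p) * dhyp (lam p) * T 0 p ^ 2 - 2 * hyp (lam p) * v3 p / T 0 p ^ 2.

Definition Rt (p : C) : C := hyp (lam p) / T 0 p ^ 2.

Definition Om (p : C) : Prop := (Cmod p < 1)%R /\ (Cmod (lam p) < 1)%R.

Lemma pd_ct f p l : pd f p l -> ct f p.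
Proof. intros [l' [H _]]. exact (cd_ct _ _ _ H). Qed.

Lemma near_Om p : Om p -> near p Om.
Proof.
intros [H1 H2]. apply near_and; [now apply near_disc|].
pose proof (pd_ct _ _ _ (pd_lam p H1)) as Hc.
generalize (Hc (1 - Cmod (lam p))%R ltac:(lra)). apply near_imp. intros y Hy.
replace (lam y) with (lam y - lam p + lam p) by ring.
eapply Rle_lt_trans; [apply Cmod_triangle | lra].
Qed.

Lemma pd_hyp_lam p : Om p -> pd (fun y => hyp (lam y)) p (lam p * (1 - lam p) * T 0 p ^ 4 * dhyp (lam p)).
Proof. intros [H1 H2]. apply pd_comp; [now apply cd_hyp | now apply pd_lam]. Qed.

Lemma pd_T0_sq p : (Cmod p < 1)%R -> pd (fun p => T 0 p ^ 2) p (2 * T 0 p ^ 2 * v3 p).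
Proof. intros Hp. unfold v3. eapply pd_eq; [pd_auto; auto|]. numsimp. field; auto. Qed.

Lemma pd_Rt p : Om p -> pd Rt p (Wr p).
Proof.
intros Ho. destruct Ho as [H1 H2] eqn:EH. pose proof (T0_nonzero p H1).
unfold Rt. eapply pd_eq.
- apply (pd_div (fun y => hyp (lam y)) (fun y => T 0 y ^ 2)); [now apply pd_hyp_lam | now apply pd_T0_sq | now apply Cpow_nz].
- cbv beta. unfold Wr. field; auto.
Qed.

(** The second derivative of [hyp] is removed by [cd_hyp_ode], that of [theta_3] by Halphen's
    equation; what remains cancels. *)
Lemma pd_Wr p : Om p -> pd Wr p 0.
Proof.
intros Ho. destruct Ho as [H1 H2] eqn:EH. pose proof (T0_nonzero p H1).
pose proof (pd_v3 p H1) as P3. rewrite T4_div in P3 by auto.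
pose proof (pd_T0_sq p H1) as PT. pose proof (pd_hyp_lam p Ho) as PF.
assert (PG : pd (fun y => lam y * (1 - lam y) * dhyp (lam y)) p
  (lam p * (1 - lam p) * T 0 p ^ 4 * (hyp (lam p) / 4))).
{ apply (pd_comp (fun x => x * (1 - x) * dhyp x) lam); [now apply cd_hyp_ode | now apply pd_lam]. }
unfold Wr. eapply pd_eq.
- apply (pd_minus (fun y => lam y * (1 - lam y) * dhyp (lam y) * T 0 y ^ 2)
    (fun y => 2 * hyp (lam y) * v3 y / T 0 y ^ 2)).
  + apply (pd_mult (fun y => lam y * (1 - lam y) * dhyp (lam y)) (fun y => T 0 y ^ 2)); eauto.
  + apply (pd_div (fun y => 2 * hyp (lam y) * v3 y) (fun y => T 0 y ^ 2)); eauto; [|now apply Cpow_nz].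
    apply (pd_mult (fun y => 2 * hyp (lam y)) v3); eauto.
    apply (pd_mult (fun _ => RtoC 2) (fun y => hyp (lam y))); eauto. apply pd_const.
- cbv beta. unfold lam, th2. field; cnz.
Qed.

(** * Local constancy of the Wronskian and of the quotient *)

Lemma seg_in_ball x y c d s : (Cmod (x - c) < d)%R -> (Cmod (y - c) < d)%R -> (0 <= s <= 1)%R ->
  (Cmod (seg x y s - c) < d)%R.
Proof.
intros Hx Hy Hs.
replace (seg x y s - c) with (RtoC (1 - s) * (x - c) + RtoC s * (y - c))
  by (unfold seg; rewrite RtoC_minus; ring).
eapply Rle_lt_trans; [apply Cmod_triangle|]. rewrite !Cmod_mult, !Cmod_R, !Rabs_pos_eq by lra.
destruct (Rle_lt_dec s (1/2)); nra.
Qed.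

(** [p d/dp] does not see the origin, so constancy is first obtained along segments whose
    interior avoids it. *)
Lemma pd_const_segment f x y :
  (forall s, (0 <= s <= 1)%R -> exists l, pd f (seg x y s) l) ->
  (forall s, (0 < s < 1)%R -> seg x y s <> 0 /\ pd f (seg x y s) 0) -> f x = f y.
Proof.
intros H1 H2. apply const_on_segment.
- intros s Hs. destruct (H1 s Hs) as [l Hl]. exact (pd_ct _ _ _ Hl).
- intros s Hs. destruct (H2 s Hs) as [Hn [l [Hl E]]].
  replace l with (RtoC 0) in Hl; auto.
  replace l with (seg x y s * l / seg x y s) by (field; auto). rewrite E. field; auto.
Qed.

Lemma pd_zero_near f p : near p (fun y => pd f y 0) -> near p (fun y => f y = f p).
Proof.
intros [d [Hd H]].
(* For [p <> 0] the radius [Cmod p] keeps segments from [p] away from the origin; for [p = 0] only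
   the endpoint of the segment meets it. *)
exists (if eq_dec_cl C p 0 then d else Rmin d (Cmod p)). split.
{ destruct (eq_dec_cl C p 0); auto. apply Rmin_pos; auto. now apply Cmod_gt_0. }
intros y Hy. destruct (classic (y = p)) as [->|Hyp]; auto. symmetry.
assert (Hyd : (Cmod (y - p) < d)%R).
{ destruct (eq_dec_cl C p 0); auto. eapply Rlt_le_trans; [exact Hy | apply Rmin_l]. }
assert (Hpd : (Cmod (p - p) < d)%R) by (now rewrite Cmod_diag).
apply pd_const_segment.
- intros s Hs. exists 0. apply H. now apply seg_in_ball.
- intros s Hs. split; [|apply H; apply seg_in_ball; auto; lra].
  destruct (eq_dec_cl C p 0) as [->|Hp].
  + unfold seg. replace (0 + RtoC s * (y - 0)) with (RtoC s * y) by ring.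
    apply Cmult_neq_0; auto. apply RtoC_nz. lra.
  + intros E. assert (L : (Cmod (seg p y s - p) < Cmod p)%R).
    { apply seg_in_ball; [| |lra].
      - rewrite Cmod_diag. now apply Cmod_gt_0.
      - eapply Rlt_le_trans; [exact Hy | apply Rmin_r]. }
    rewrite E in L. replace (0 - p) with (- p) in L by ring. rewrite Cmod_opp in L. lra.
Qed.

Lemma Wr_locally_const p : Om p -> near p (fun y => Wr y = Wr p).
Proof.
intros Ho. apply pd_zero_near. generalize (near_Om p Ho). apply near_imp. apply pd_Wr.
Qed.

Lemma Rt_locally_const p : Om p -> Wr p = 0 -> near p (fun y => Rt y = Rt p).
Proof.
intros Ho H0. apply pd_zero_near.
generalize (near_and _ _ _ (near_Om p Ho) (Wr_locally_const p Ho)). apply near_imp.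
intros y [H1 H2]. rewrite <- H0, <- H2. now apply pd_Rt.
Qed.

(** [Rt p = 1] says [2F1(lambda) = theta_3^2]; [Wr p = 0] is the derivative of this equation. *)
Definition branch (p : C) : Prop := Wr p = 0 /\ Rt p = 1.

Lemma lam_at_0 : lam 0 = 0.
Proof. unfold lam. rewrite th2_at_0, T0_at_0. field. Qed.

Lemma Om_0 : Om 0.
Proof. split; rewrite ?lam_at_0; auto. Qed.

Lemma hyp_at_0 : hyp 0 = 1.
Proof.
rewrite hyp_pseries by auto. apply Csum_eq.
eapply is_sum_eq; [apply (is_sum_finite _ [0%nat])|].
- repeat constructor; auto.
- intros [|n] Hn; [destruct Hn; now left|]. rewrite Cpow_S. ring.
- simpl. rewrite hcoef_0. ring.
Qed.

Lemma branch_0 : branch 0.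
Proof.
unfold branch, Wr, Rt. destruct v_at_0 as [-> _]. rewrite lam_at_0, hyp_at_0, T0_at_0. split; field.
Qed.

Lemma near_branch p : Om p -> branch p -> near p branch.
Proof.
intros Ho [H1 H2].
generalize (near_and _ _ _ (Wr_locally_const p Ho) (Rt_locally_const p Ho H1)). apply near_imp.
intros y [E1 E2]. split; congruence.
Qed.

(** [Rt] is locally constant only where [Wr] vanishes. Elsewhere the nonzero value of [Wr] persists
    and already excludes the branch. *)
Lemma near_not_branch p : Om p -> ~ branch p -> near p (fun y => ~ branch y).
Proof.
intros Ho Hn. destruct (classic (Wr p = 0)) as [H0|H0].
- generalize (Rt_locally_const p Ho H0). apply near_imp. intros y E [_ H2]. apply Hn. split; congruence.
- generalize (Wr_locally_const p Ho). apply near_imp. intros y E [H1 _]. congruence.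
Qed.

(** * The component of the cusp *)

Lemma Cexp_add a b : Cexp (a + b) = Cexp a * Cexp b.
Proof.
destruct a as [x y], b as [u v]. unfold Cexp. simpl.
rewrite exp_plus, cos_plus, sin_plus. apply injective_projections; simpl; ring.
Qed.

Lemma Cexp_0 : Cexp 0 = 1.
Proof. unfold Cexp. simpl. rewrite exp_0, cos_0, sin_0. apply injective_projections; simpl; ring. Qed.

Lemma Cexp_mul_nat (n : nat) z : Cexp (RtoC (INR n) * z) = Cexp z ^ n.
Proof.
induction n as [|n IH].
- simpl. replace (0 * z) with (RtoC 0) by ring. apply Cexp_0.
- rewrite S_INR, RtoC_plus, Cpow_S, <- IH, <- Cexp_add. f_equal. ring.
Qed.

Lemma Cmod_Cexp z : Cmod (Cexp z) = exp (Re z).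
Proof.
unfold Cmod, Cexp. simpl fst. simpl snd.
replace ((exp (Re z) * cos (Im z)) ^ 2 + (exp (Re z) * sin (Im z)) ^ 2)%R with
  (exp (Re z) ^ 2 * (Rsqr (sin (Im z)) + Rsqr (cos (Im z))))%R by (unfold Rsqr; ring).
rewrite sin2_cos2, Rmult_1_r. apply sqrt_pow2. left. apply exp_pos.
Qed.

Definition nm (tau : C) : C := Cexp (PI * Ci * tau).

Lemma Cmod_nm tau : Cmod (nm tau) = exp (- PI * Im tau).
Proof. unfold nm. rewrite Cmod_Cexp. f_equal. destruct tau. simpl. ring. Qed.

Lemma nm_disc tau : (0 < Im tau)%R -> (Cmod (nm tau) < 1)%R.
Proof.
intros H. rewrite Cmod_nm, <- exp_0. apply exp_increasing. pose proof PI_RGT_0. nra.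
Qed.

Lemma nome_nm tau : nome tau = nm tau ^ 2.
Proof.
unfold nome, nm. rewrite <- Cexp_mul_nat. f_equal. simpl INR. rewrite RtoC_plus. ring.
Qed.

Lemma nm_pow_Z tau (k : Z) : (0 <= k)%Z -> Cexp (PI * Ci * tau * RtoC (IZR k)) = nm tau ^ Z.to_nat k.
Proof.
intros H. unfold nm. rewrite <- Cexp_mul_nat, INR_IZR_INZ, Z2Nat.id by auto. f_equal. ring.
Qed.

Lemma theta3_nm tau : (0 < Im tau)%R -> theta3 tau = T 0 (nm tau).
Proof.
intros H. pose proof (nm_disc tau H) as Hp. apply is_sum_CSeriesZ.
- apply (abs_summable_le _ (fun n => nm tau ^ Z.to_nat (n * n))); [|now apply T0_abs].
  intros n. rewrite <- nm_pow_Z, mult_IZR by nia. simpl pow. rewrite Rmult_1_r. lra.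
- generalize (is_sum_T0 _ Hp). apply is_sum_ext. intros n.
  rewrite <- nm_pow_Z, mult_IZR by nia. simpl pow. now rewrite Rmult_1_r.
Qed.

Lemma theta2_nm tau : (0 < Im tau)%R -> theta2 tau = Cexp (PI * Ci * tau / 4) * Psi (nm tau).
Proof.
intros H. pose proof (nm_disc tau H) as Hp.
assert (E : forall n, Cexp (PI * Ci * tau * RtoC ((IZR n + 1 / 2) ^ 2)) =
  Cexp (PI * Ci * tau / 4) * nm tau ^ Z.to_nat (n * n + n)).
{ intros n. rewrite <- nm_pow_Z, <- Cexp_add by nia. f_equal. rewrite plus_IZR, mult_IZR.
  replace ((IZR n + 1 / 2) ^ 2)%R with (1 / 4 + (IZR n * IZR n + IZR n))%R by field.
  rewrite RtoC_plus, RtoC_div by lra. field. }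
apply is_sum_CSeriesZ.
- apply (abs_summable_le _ (fun n => Cexp (PI * Ci * tau / 4) * nm tau ^ Z.to_nat (n * n + n))).
  + intros n. rewrite E. lra.
  + apply abs_summable_scal. now apply Psi_abs.
- refine (is_sum_ext _ _ _ _ (is_sum_scal _ _ (Cexp (PI * Ci * tau / 4)) (is_sum_Psi _ Hp))).
  intros n. now rewrite E.
Qed.

Lemma modular_lambda_nm tau : (0 < Im tau)%R -> modular_lambda tau = lam (nm tau).
Proof.
intros H. pose proof (nm_disc tau H) as Hp. unfold modular_lambda, lam.
rewrite theta3_nm, theta2_nm by auto.
(* A square root of the nome, as [Jacobi_quartic] requires. *)
set (s := Cexp (PI * Ci * tau / 2)).
assert (Es : nm tau = s ^ 2).
{ unfold nm, s. rewrite <- Cexp_mul_nat. f_equal. simpl INR. rewrite RtoC_plus. field. }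
assert (Hs : (Cmod s < 1)%R).
{ apply Rnot_le_lt. intros Hle. rewrite Es, Cmod_pow in Hp. nra. }
assert (Hs0 : s <> 0).
{ intros E. assert (E2 : Cmod s = 0%R) by (rewrite E; apply Cmod_0).
  unfold s in E2. rewrite Cmod_Cexp in E2. pose proof (exp_pos (Re (PI * Ci * tau / 2))). lra. }
assert (E4 : Cexp (PI * Ci * tau / 4) ^ 4 = nm tau).
{ rewrite <- Cexp_mul_nat. unfold nm. f_equal. simpl INR. rewrite !RtoC_plus. field. }
transitivity (Cexp (PI * Ci * tau / 4) ^ 4 * Psi (nm tau) ^ 4 / T 0 (nm tau) ^ 4); [field; auto|].
rewrite E4. unfold th2. rewrite Es, Jacobi_quartic by auto. reflexivity.
Qed.

(** Openness in [Cconnected] refers to product balls; a product ball of radius [d / sqrt 2] lies in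
    the modulus ball of radius [d]. *)
Lemma near_locally (x : C) (P : C -> Prop) : near x P -> @locally C_UniformSpace x P.
Proof.
intros [d [Hd H]].
assert (H2 : (0 < d / sqrt 2)%R).
{ apply Rdiv_lt_0_compat; auto. apply sqrt_lt_R0. lra. }
exists (mkposreal _ H2). intros y Hy. apply H.
pose proof (C_NormedModule_mixin_compat2 _ _ _ Hy) as H3. simpl in H3.
change (Cmod (y - x) < sqrt 2 * (d / sqrt 2))%R in H3.
replace (sqrt 2 * (d / sqrt 2))%R with d in H3; auto.
field. apply Rgt_not_eq. apply sqrt_lt_R0. lra.
Qed.

Lemma locally_near (x : C) (P : C -> Prop) : @locally C_UniformSpace x P -> near x P.
Proof.
intros [eps H]. exists eps. split; [apply cond_pos|]. intros y Hy. apply H.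
now apply C_NormedModule_mixin_compat1.
Qed.

Lemma Cexp_ct z : ct Cexp z.
Proof.
assert (H1 : continuous (fun z : C => (exp (fst z) * cos (snd z))%R) z).
{ apply (continuous_mult (fun z : C => exp (fst z)) (fun z : C => cos (snd z))).
  - apply (continuous_comp (fun z : C => fst z) exp); [apply continuous_fst | apply continuous_exp].
  - apply (continuous_comp (fun z : C => snd z) cos); [apply continuous_snd | apply continuous_cos]. }
assert (H2 : continuous (fun z : C => (exp (fst z) * sin (snd z))%R) z).
{ apply (continuous_mult (fun z : C => exp (fst z)) (fun z : C => sin (snd z))).
  - apply (continuous_comp (fun z : C => fst z) exp); [apply continuous_fst | apply continuous_exp].
  - apply (continuous_comp (fun z : C => snd z) sin); [apply continuous_snd | apply continuous_sin]. }
intros eps He. assert (He2 : (0 < eps / 2)%R) by lra.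
pose proof (locally_near _ _ (H1 _ (locally_ball _ (mkposreal _ He2)))) as N1.
pose proof (locally_near _ _ (H2 _ (locally_ball _ (mkposreal _ He2)))) as N2.
generalize (near_and _ _ _ N1 N2). apply near_imp. intros y [B1 B2].
change (Rabs (exp (Re y) * cos (Im y) - exp (Re z) * cos (Im z)) < eps / 2)%R in B1.
change (Rabs (exp (Re y) * sin (Im y) - exp (Re z) * sin (Im z)) < eps / 2)%R in B2.
set (w := Cexp y - Cexp z).
apply Rle_lt_trans with (Rabs (Re w) + Rabs (Im w))%R.
- replace w with (RtoC (Re w) + Ci * RtoC (Im w)) at 1
    by (destruct w; apply injective_projections; simpl; ring).
  eapply Rle_trans; [apply Cmod_triangle|]. rewrite Cmod_mult, Cmod_Ci, !Cmod_R. lra.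
- unfold w, Cexp. simpl Re. simpl Im. unfold Rminus in *. lra.
Qed.

Lemma nm_ct tau : ct nm tau.
Proof.
apply (ct_comp Cexp (fun z => PI * Ci * z)); [apply Cexp_ct|].
apply ct_mult; [apply ct_const | apply ct_id].
Qed.

Lemma near_nm (P : C -> Prop) tau : near (nm tau) P -> near tau (fun z => P (nm z)).
Proof.
intros [d [Hd H]]. generalize (nm_ct tau d Hd). apply near_imp. intros y Hy. now apply H.
Qed.

(** The nomes near which [Pr] holds and those near which it fails pull back to two disjoint open
    sets covering [K], so only one of them meets [K]. *)
Lemma clopen_transfer (K : C -> Prop) (Pr : C -> Prop) z0 :
  Cconnected K -> (forall z, K z -> near (nm z) Pr \/ near (nm z) (fun q => ~ Pr q)) ->
  K z0 -> Pr (nm z0) -> forall z, K z -> Pr (nm z).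
Proof.
intros HK Hd H0 HP z Hz. apply NNPP. intros Hn.
destruct (HK (fun z => near (nm z) Pr) (fun z => near (nm z) (fun q => ~ Pr q))) as [y [_ [H1 H2]]].
- intros x Hx. apply near_locally. apply (near_nm (fun q => near q Pr)). now apply near_near.
- intros x Hx. apply near_locally. apply (near_nm (fun q => near q (fun q => ~ Pr q))). now apply near_near.
- auto.
- exists z0. split; auto. destruct (Hd z0 H0) as [H|H]; auto. destruct (near_self _ _ H HP).
- exists z. split; auto. destruct (Hd z Hz) as [H|H]; auto. destruct (Hn (near_self _ _ H)).
- exact (near_self _ _ H2 (near_self _ _ H1)).
Qed.

Lemma Cconnected_union (K1 K2 : C -> Prop) z : Cconnected K1 -> Cconnected K2 -> K1 z -> K2 z ->
  Cconnected (fun w => K1 w \/ K2 w).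
Proof.
intros H1 H2 Hz1 Hz2 U V HU HV Hc [u [Hu Uu]] [v [Hv Vv]].
assert (G : forall K, Cconnected K -> K z -> (forall w, K w -> K1 w \/ K2 w) ->
  (K u \/ K v) -> (U z -> K v) -> (V z -> K u) -> exists w, (K1 w \/ K2 w) /\ U w /\ V w).
{ intros K HK Kz Hsub _ Huz Hvz. destruct (HK U V HU HV) as [w [Kw [Uw Vw]]].
  - auto.
  - destruct (Hc z (or_introl Hz1)) as [Z|Z]; [now exists z | exists u; auto].
  - destruct (Hc z (or_introl Hz1)) as [Z|Z]; [exists v; auto | now exists z].
  - exists w; auto. }
destruct (Hc z (or_introl Hz1)) as [Z|Z].
- destruct Hv as [Hv|Hv].
  + destruct (H1 U V HU HV) as [w [Kw W]]; [auto | now exists z | now exists v | exists w; auto].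
  + destruct (H2 U V HU HV) as [w [Kw W]]; [auto | now exists z | now exists v | exists w; auto].
- destruct Hu as [Hu|Hu].
  + destruct (H1 U V HU HV) as [w [Kw W]]; [auto | now exists u | now exists z | exists w; auto].
  + destruct (H2 U V HU HV) as [w [Kw W]]; [auto | now exists u | now exists z | exists w; auto].
Qed.

Lemma C_lambda_infty_spread (K : C -> Prop) tau z : C_lambda_infty tau -> Cconnected K ->
  (forall x, K x -> lambda_disc x) -> K tau -> K z -> C_lambda_infty z.
Proof.
intros [_ H] HK Hs Ht Hz. split; [auto|]. intros M.
destruct (H M) as [w [[K' [HK' [Hs' [Ht' Hw]]]] HM]]. exists w. split; auto.
exists (fun x => K x \/ K' x). split; [now apply (Cconnected_union K K' tau)|].
split; [intros x [Hx|Hx]; auto | auto].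
Qed.

Lemma C_lambda_infty_induct (Pr : C -> Prop) : near 0 Pr ->
  (forall z, C_lambda_infty z -> near (nm z) Pr \/ near (nm z) (fun q => ~ Pr q)) ->
  forall tau, C_lambda_infty tau -> Pr (nm tau).
Proof.
intros [d [Hd H0]] Hcl tau Ht. destruct Ht as [HD HM] eqn:E. pose proof PI_RGT_0.
(* Beyond this height [Cmod (nm w) < d], so the component contains a point where the initial
   neighbourhood of 0 applies. *)
destruct (HM (- ln d / PI)%R) as [w [[K [HK [Hs [Kt Kw]]]] HI]].
apply (clopen_transfer K Pr w); auto.
- intros z Hz. apply Hcl. now apply (C_lambda_infty_spread K tau).
- apply H0. replace (nm w - 0) with (nm w) by ring. rewrite Cmod_nm.
  rewrite <- (exp_ln d) by auto. apply exp_increasing.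
  apply Rmult_lt_compat_l with (r := PI) in HI; auto.
  replace (PI * (- ln d / PI))%R with (- ln d)%R in HI by (field; lra). lra.
Qed.

Lemma lambda_disc_Om z : lambda_disc z -> Om (nm z).
Proof.
intros [[H _] Hl]. split; [now apply nm_disc|]. now rewrite <- modular_lambda_nm.
Qed.

Lemma C_lambda_infty_branch tau : C_lambda_infty tau -> branch (nm tau).
Proof.
apply C_lambda_infty_induct.
- apply near_branch; [apply Om_0 | apply branch_0].
- intros z [Hz _]. apply lambda_disc_Om in Hz. destruct (classic (branch (nm z))).
  + left. now apply near_branch.
  + right. now apply near_not_branch.
Qed.

(** [kappa n p = theta_4 / theta_3] at [p^(2^n)]; these are the square roots taken by the AGM. *)
Definition kappa (n : nat) (p : C) : C := T 0 (- p ^ (2 ^ n)) / T 0 (p ^ (2 ^ n)).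

Lemma kappa_ct n p : (Cmod p < 1)%R -> ct (kappa n) p.
Proof.
intros Hp. unfold kappa. pose proof (dbl_disc p n Hp) as Hx.
pose proof (cd_ct _ _ _ (cd_pow (fun y => y) p _ (2 ^ n) (cd_id p))) as C0.
assert (Ca : ct (fun y => T 0 (y ^ (2 ^ n))) p).
{ apply (ct_comp (T 0) (fun y => y ^ (2 ^ n))); auto. exact (cd_ct _ _ _ (cd_T 0 _ Hx)). }
assert (Cb : ct (fun y => T 0 (- y ^ (2 ^ n))) p).
{ apply (ct_comp (fun x => T 0 (- x)) (fun y => y ^ (2 ^ n))); auto. exact (cd_ct _ _ _ (cd_T_opp 0 _ Hx)). }
apply (ct_mult (fun y => T 0 (- y ^ (2 ^ n))) (fun y => / T 0 (y ^ (2 ^ n)))); auto.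
apply (ct_inv (fun y => T 0 (y ^ (2 ^ n)))); auto.
Qed.

Lemma kappa_0_quartic p : (Cmod p < 1)%R -> (kappa 0 p ^ 2) ^ 2 = 1 - lam p.
Proof.
intros Hp. rewrite one_sub_lam by auto. unfold kappa. simpl (2 ^ 0)%nat.
replace (p ^ 1) with p by ring. field. auto.
Qed.

Lemma kappa_quartic n p : (Cmod p < 1)%R -> kappa n p ^ 4 = 1 - lam (p ^ (2 ^ n)).
Proof.
intros Hp. pose proof (dbl_disc p n Hp). rewrite one_sub_lam by auto. unfold kappa. field. auto.
Qed.

(** [kappa (S n) ^ 2] is the geometric mean over the arithmetic mean of [theta_3^2] and [theta_4^2];
    the denominator is a nonzero theta quotient. *)
Lemma kappa_step n p : (Cmod p < 1)%R ->
  1 + kappa n p ^ 2 <> 0 /\ kappa (S n) p ^ 2 = 2 * kappa n p / (1 + kappa n p ^ 2).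
Proof.
intros Hp. pose proof (dbl_disc p n Hp) as Hx. unfold kappa. rewrite dbl_S.
set (x := p ^ 2 ^ n) in *.
pose proof (T0_nonzero x Hx) as N1. pose proof (T0_nonzero (x ^ 2) ltac:(auto)) as N2.
assert (E : 1 + (T 0 (- x) / T 0 x) ^ 2 = 2 * T 0 (x ^ 2) ^ 2 / T 0 x ^ 2).
{ rewrite <- T0_sq_add by auto. field. auto. }
rewrite E. split.
- intros Z. assert (Z2 : 2 * T 0 (x ^ 2) ^ 2 <> 0) by (apply Cmult_neq_0; auto; now apply Cpow_nz).
  apply Z2. replace (2 * T 0 (x ^ 2) ^ 2) with (2 * T 0 (x ^ 2) ^ 2 / T 0 x ^ 2 * T 0 x ^ 2) by (field; auto).
  rewrite Z. ring.
- transitivity (T 0 (- x ^ 2) ^ 2 / T 0 (x ^ 2) ^ 2); [field; auto|].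
  rewrite <- T0_mul_neg by auto. field. cnz.
Qed.

Lemma Re_sq_pos z : (0 < Re (z ^ 2))%R -> Re z <> 0%R.
Proof. destruct z as [x y]. simpl. intros H E. rewrite E in H. nra. Qed.

(** The real part equals [2 Re k (1 + |k|^2) / |1 + k^2|^2]. *)
Lemma Re_agm_step k : (0 < Re k)%R -> 1 + k ^ 2 <> 0 -> (0 < Re (2 * k / (1 + k ^ 2)))%R.
Proof.
intros Hk Hn. set (m := 1 + k ^ 2) in *.
assert (Hm : (0 < Re m * Re m + Im m * Im m)%R).
{ apply Cmod_gt_0 in Hn. pose proof (Cmod2_alt m). nra. }
replace (Re (2 * k / m)) with ((2 * (Re k * Re m + Im k * Im m)) / (Re m * Re m + Im m * Im m))%R.
- apply Rdiv_lt_0_compat; auto. unfold m. destruct k as [x y]. simpl in *.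
  replace (x * (1 + (x * (x * 1 - y * 0) - y * (x * 0 + y * 1))) + y * (0 + (x * (x * 0 + y * 1) + y * (x * 1 - y * 0))))%R
    with (x * (1 + x * x + y * y))%R by ring. nra.
- destruct k as [x y], m as [u v]. simpl in *. field. nra.
Qed.

Lemma sq_eq_pos x y : x ^ 2 = y ^ 2 -> (0 < Re x)%R -> (0 < Re y)%R -> x = y.
Proof.
intros E Hx Hy.
assert (H : x + y <> 0).
{ intros Z. apply (f_equal Re) in Z. destruct x, y; simpl in *. lra. }
replace x with ((x ^ 2 - y ^ 2) / (x + y) + y) by (field; auto). rewrite E. field; auto.
Qed.

(** Every square root lies in the right half-plane. The separate first clause is there because
    [kappa 0] is a fourth root of [1 - lambda], reached by two extractions. *)
Definition kappa_pos (p : C) : Prop := (0 < Re (kappa 0 p ^ 2))%R /\ forall n, (0 < Re (kappa n p))%R.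

Lemma near_Re_pos f p : ct f p -> Re (f p) <> 0%R ->
  near p (fun q => (0 < Re (f q))%R) \/ near p (fun q => ~ (0 < Re (f q))%R).
Proof.
intros Hf Hn.
assert (B : near p (fun q => (Rabs (Re (f q) - Re (f p)) < Rabs (Re (f p)))%R)).
{ generalize (Hf _ (Rabs_pos_lt _ Hn)). apply near_imp. intros q Hq.
  eapply Rle_lt_trans; [|exact Hq]. apply (re_le_Cmod (f q - f p)). }
destruct (Rlt_le_dec 0 (Re (f p))) as [H|H]; [left|right]; revert B; apply near_imp; intros q Hq.
- rewrite (Rabs_pos_eq (Re (f p))) in Hq by lra. apply Rabs_def2 in Hq. lra.
- rewrite (Rabs_left1 (Re (f p))) in Hq by lra. apply Rabs_def2 in Hq. lra.
Qed.

Lemma near_Re_pos_0 f : ct f 0 -> f 0 = 1 -> near 0 (fun q => (0 < Re (f q))%R).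
Proof.
intros Hf H1. destruct (near_Re_pos f 0 Hf) as [H|H]; auto.
- rewrite H1. simpl. lra.
- apply near_self in H. rewrite H1 in H. simpl in H. lra.
Qed.

Lemma kappa_at_0 n : kappa n 0 = 1.
Proof.
unfold kappa. assert (E : 0 ^ (2 ^ n) = 0).
{ replace (2 ^ n)%nat with (S (pred (2 ^ n))); [rewrite Cpow_S; ring|].
  assert (0 < 2 ^ n)%nat by (induction n; simpl; lia). lia. }
rewrite E, Copp_0, T0_at_0. field.
Qed.

(** Each real part is 1 at the cusp and can change sign only by vanishing. That is excluded because
    the square has positive real part: [|lambda| < 1] starts the chain at [1 - lambda], and
    [Re_agm_step] continues it. *)
Lemma C_lambda_infty_kappa tau : C_lambda_infty tau -> kappa_pos (nm tau).
Proof.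
assert (Hdisc : forall z, C_lambda_infty z -> Om (nm z)) by (intros z [Hz _]; now apply lambda_disc_Om).
assert (Csq : forall p, (Cmod p < 1)%R -> ct (fun q => kappa 0 q ^ 2) p).
{ intros p Hp. apply (ct_ext (fun q => kappa 0 q * kappa 0 q)).
  - intros; ring.
  - apply ct_mult; now apply kappa_ct. }
assert (Hsq : forall z, C_lambda_infty z -> (0 < Re (kappa 0 (nm z) ^ 2))%R).
{ apply (C_lambda_infty_induct (fun p => (0 < Re (kappa 0 p ^ 2)%C)%R)).
  - apply (near_Re_pos_0 (fun q => kappa 0 q ^ 2)); auto. rewrite kappa_at_0. ring.
  - intros z Hz. destruct (Hdisc z Hz) as [H1 H2].
    apply (near_Re_pos (fun q => kappa 0 q ^ 2)); auto.
    apply Re_sq_pos. rewrite kappa_0_quartic by auto.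
    pose proof (re_le_Cmod (lam (nm z))) as H. pose proof (Rle_abs (Re (lam (nm z)))).
    replace (Re (1 - lam (nm z))) with (1 - Re (lam (nm z)))%R by reflexivity. lra. }
assert (Hn : forall n z, C_lambda_infty z -> (0 < Re (kappa n (nm z)))%R).
{ induction n as [|n IH]; apply (C_lambda_infty_induct (fun p => (0 < Re (kappa _ p))%R)).
  - apply near_Re_pos_0; [now apply kappa_ct | apply kappa_at_0].
  - intros z Hz. destruct (Hdisc z Hz) as [H1 H2]. apply near_Re_pos; [now apply kappa_ct|].
    apply Re_sq_pos. now apply Hsq.
  - apply near_Re_pos_0; [now apply kappa_ct | apply kappa_at_0].
  - intros z Hz. destruct (Hdisc z Hz) as [H1 H2]. apply near_Re_pos; [now apply kappa_ct|].
    apply Re_sq_pos. destruct (kappa_step n (nm z) H1) as [N ->]. apply Re_agm_step; auto. }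
intros Ht. split; auto.
Qed.

(** Each [kappa] is a root of a quantity fixed by its predecessor, and positivity of the real part
    leaves one choice. *)
Lemma kappa_determined p q : (Cmod p < 1)%R -> (Cmod q < 1)%R -> kappa_pos p -> kappa_pos q ->
  lam p = lam q -> forall n, kappa n p = kappa n q.
Proof.
intros Hp Hq [P1 P2] [Q1 Q2] E. induction n as [|n IH].
- apply sq_eq_pos; auto. apply sq_eq_pos; auto. rewrite !kappa_0_quartic by auto. now rewrite E.
- apply sq_eq_pos; auto. destruct (kappa_step n p Hp) as [_ ->], (kappa_step n q Hq) as [_ ->].
  now rewrite IH.
Qed.

Lemma cd_lam_0 : cd lam 0 16.
Proof.
unfold lam. eapply cd_eq; [apply (cd_div th2 (fun p => T 0 p ^ 4) 0 16); [apply cd_th2_0 | cd_auto; auto|]|].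
- rewrite T0_at_0. intros Z. ring_simplify in Z. apply RtoC_inj in Z. lra.
- cbv beta. rewrite th2_at_0, T0_at_0. field.
Qed.

(** Equal [kappa] means equal [lambda] at all iterated squares. Since [lambda] behaves like [16 p]
    near 0, the ratio of the moduli of these squares stays bounded away from 0, whereas it would
    tend to 0. *)
Lemma kappa_radius p q : (Cmod p < 1)%R -> (Cmod q < 1)%R ->
  (forall n, kappa n p = kappa n q) -> ~ (Cmod p < Cmod q)%R.
Proof.
intros Hp Hq E Hlt.
destruct (cd_at_0 _ _ cd_lam_0 lam_at_0) as [phi [F1 [F2 F3]]].
(* Tolerance 8 around 16 confines the moduli of [phi] to the range from 8 to 24; their quotient 3 is
   the origin of the threshold [1/3] below. *)
pose proof (near_and _ _ _ F3 (F1 8%R ltac:(lra))) as HN.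
destruct (dbl_near _ p Hp HN) as [N1 H1]. destruct (dbl_near _ q Hq HN) as [N2 H2].
pose proof (Cmod_ge_0 p) as Pp.
set (r := (Cmod p / Cmod q)%R).
assert (Hr : (0 <= r < 1)%R).
{ unfold r. split; [apply Rmult_le_pos; [lra | left; apply Rinv_0_lt_compat; lra]|].
  apply Rmult_lt_reg_r with (Cmod q); [lra|]. unfold Rdiv. rewrite Rmult_assoc, Rinv_l; lra. }
destruct (pow_lt_1_zero r) with (y := (1/3)%R) as [N3 H3]; [rewrite Rabs_pos_eq; lra | lra |].
set (n := max N1 (max N2 N3)).
destruct (H1 n ltac:(lia)) as [A1 A2]. destruct (H2 n ltac:(lia)) as [B1 B2].
specialize (H3 (2 ^ n)%nat ltac:(pose proof (pow2_ge n); lia)).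
rewrite Rabs_pos_eq in H3 by (apply pow_le; lra).
assert (EL : lam (p ^ 2 ^ n) = lam (q ^ 2 ^ n)).
{ replace (lam (p ^ 2 ^ n)) with (1 - kappa n p ^ 4) by (rewrite kappa_quartic by auto; ring).
  rewrite E, kappa_quartic by auto. ring. }
rewrite A1, B1 in EL. apply (f_equal Cmod) in EL. rewrite !Cmod_mult, !Cmod_pow in EL.
set (u := phi (p ^ 2 ^ n)) in *. set (w := phi (q ^ 2 ^ n)) in *. rewrite F2 in A2, B2.
assert (Hu : (Cmod u <= 24)%R).
{ replace u with (u - 16 + 16) by ring. eapply Rle_trans; [apply Cmod_triangle|].
  rewrite (Cmod_R 16), (Rabs_pos_eq 16) by lra. lra. }
assert (Hw : (8 <= Cmod w)%R).
{ assert (Cmod 16 <= Cmod w + Cmod (w - 16))%R.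
  { replace (RtoC 16) with (w + - (w - 16)) at 1 by ring. eapply Rle_trans; [apply Cmod_triangle|].
    rewrite Cmod_opp. lra. }
  rewrite (Cmod_R 16), (Rabs_pos_eq 16) in H by lra. lra. }
assert (Epq : (Cmod p ^ 2 ^ n = r ^ 2 ^ n * Cmod q ^ 2 ^ n)%R).
{ rewrite <- Rpow_mult_distr. f_equal. unfold r. field. lra. }
rewrite Epq in EL.
assert (Hq0 : (0 < Cmod q ^ 2 ^ n)%R) by (apply pow_lt; lra).
assert (EL2 : (r ^ 2 ^ n * Cmod u = Cmod w)%R).
{ apply Rmult_eq_reg_l with (Cmod q ^ 2 ^ n)%R; [|lra]. rewrite <- EL. ring. }
pose proof (pow_le r (2 ^ n) (proj1 Hr)). pose proof (Cmod_ge_0 u). nra.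
Qed.

(** * Real nomes *)

Lemma is_sum_real {I} (f : I -> C) l : (forall i, Im (f i) = 0%R) -> is_sum f l -> Im l = 0%R.
Proof.
intros Hf Hl.
assert (E : l = Cconj l).
{ apply (is_sum_unique f); auto. intros eps He. destruct (Hl eps He) as [L0 H0].
  exists L0. intros L HN Hi. rewrite <- (Cmod_conj (lsum f L - Cconj l)).
  replace (Cconj (lsum f L - Cconj l)) with (lsum f L - l); [now apply H0|].
  assert (G : Im (lsum f L) = 0%R).
  { clear -Hf. induction L as [|i L IH]; [reflexivity|].
    change (Im (f i) + Im (lsum f L) = 0)%R. rewrite IH, Hf. ring. }
  destruct (lsum f L) as [x y], l as [u v]. simpl in G. subst y. unfold Cconj. simpl.
  apply injective_projections; simpl; ring. }
apply (f_equal Im) in E. destruct l as [x y]. simpl in *. lra.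
Qed.

Lemma T_real j (x : R) : (Rabs x < 1)%R -> Im (T j (RtoC x)) = 0%R.
Proof.
intros Hx. apply (is_sum_real _ _) with (2 := is_sum_T j x ltac:(now rewrite Cmod_R)).
intros n. rewrite <- RtoC_pow, <- RtoC_mult. reflexivity.
Qed.

Lemma real_C z : Im z = 0%R -> z = RtoC (Re z).
Proof. destruct z; simpl; intros ->; reflexivity. Qed.

(** The values are real and nonzero, and [kappa_step] reads [2 k = k'^2 (1 + k^2)], so each one is
    positive because its successor is real and nonzero. *)
Lemma kappa_pos_real (x : R) : (0 < x < 1)%R -> kappa_pos (RtoC x).
Proof.
intros Hx. assert (Hp : (Cmod (RtoC x) < 1)%R) by (rewrite Cmod_R, Rabs_pos_eq; lra).
assert (Hreal : forall n, exists k : R, k <> 0%R /\ kappa n (RtoC x) = RtoC k).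
{ intros n. unfold kappa. pose proof (dbl_disc _ n Hp) as Hd.
  pose proof (T0_nonzero _ Hd) as N1. pose proof (T0_nonzero (- _) (disc_opp _ Hd)) as N2.
  rewrite <- RtoC_pow in *. rewrite <- RtoC_opp in *. rewrite Cmod_R in Hd.
  rewrite (real_C _ (T_real 0 _ Hd)) in N1 |- *.
  rewrite (real_C (T 0 (RtoC (- x ^ 2 ^ n)))) in N2 |- * by (apply T_real; now rewrite Rabs_Ropp).
  set (u := Re (T 0 (RtoC (- x ^ 2 ^ n)))) in *. set (w := Re (T 0 (RtoC (x ^ 2 ^ n)))) in *.
  assert (u <> 0%R) by (intros ->; now apply N2). assert (w <> 0%R) by (intros ->; now apply N1).
  exists (u / w)%R. split; [|now rewrite RtoC_div].
  intros Z. apply H. replace u with (u / w * w)%R by (field; auto). rewrite Z. ring. }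
assert (Hpos : forall n, (0 < Re (kappa n (RtoC x)))%R).
{ intros n. destruct (Hreal n) as [k [Hk Ek]]. destruct (Hreal (S n)) as [k' [Hk' Ek']].
  destruct (kappa_step n _ Hp) as [N E]. rewrite Ek, Ek' in E. rewrite Ek in N |- *. simpl.
  assert (N' : (1 + k ^ 2 <> 0)%R) by nra.
  rewrite <- !RtoC_pow, <- RtoC_plus, <- RtoC_mult, <- RtoC_div in E by auto.
  apply RtoC_inj in E.
  assert (E2 : (k' ^ 2 * (1 + k ^ 2) = 2 * k)%R) by (rewrite E; field; auto).
  assert (0 < k' ^ 2)%R by (apply pow2_gt_0; auto). nra. }
split; auto. destruct (Hreal 0%nat) as [k [Hk ->]]. rewrite <- RtoC_pow. simpl.
assert (0 < k ^ 2)%R by (apply pow2_gt_0; auto). simpl in H. lra.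
Qed.

(** * The Gaussian integral *)

Local Open Scope R_scope.

Lemma exp_monotone x y : x <= y -> exp x <= exp y.
Proof. intros [H| ->]; [left; now apply exp_increasing | right; auto]. Qed.

Definition gauss (x : R) : R := RInt (fun u => exp (- u ^ 2)) 0 x.

Lemma gauss_cont u : continuous (fun u => exp (- u ^ 2)) u.
Proof.
apply (@ex_derive_continuous _ R_NormedModule). auto_derive. auto.
Qed.

Lemma gauss_derive x : is_derive gauss x (exp (- x ^ 2)).
Proof.
apply (is_derive_RInt (fun u => exp (- u ^ 2)) gauss 0 x).
- apply filter_forall. intros y. apply (@RInt_correct R_CompleteNormedModule).
  apply (@ex_RInt_continuous R_CompleteNormedModule). intros; apply gauss_cont.
- apply gauss_cont.
Qed.

Lemma gauss_0 : gauss 0 = 0.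
Proof. unfold gauss. apply (@RInt_point R_CompleteNormedModule). Qed.

(** Its integral over [t] from 0 to 1 has derivative opposite to that of [gauss x ^ 2], and at
    [x = 0] it is the arctangent integral [PI / 4]. *)
Definition gaux (x t : R) : R := exp (- (x ^ 2 * (1 + t ^ 2))) / (1 + t ^ 2).

Lemma one_sq_pos t : 0 < 1 + t ^ 2.
Proof. pose proof (pow2_ge_0 t). lra. Qed.

Lemma gaux_derive_x x t : is_derive (fun x => gaux x t) x (-2 * x * exp (- (x ^ 2 * (1 + t ^ 2)))).
Proof.
unfold gaux. pose proof (one_sq_pos t).
auto_derive; [lra|]. simpl. field. simpl in H. lra.
Qed.

Lemma gaux_cont_t x t : continuous (gaux x) t.
Proof.
apply (@ex_derive_continuous _ R_NormedModule). unfold gaux. pose proof (one_sq_pos t).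
auto_derive. simpl in H. lra.
Qed.

Lemma gaux_int_derive x :
  is_derive (fun x => RInt (gaux x) 0 1) x (RInt (fun t => -2 * x * exp (- (x ^ 2 * (1 + t ^ 2)))) 0 1).
Proof.
assert (H : is_derive (fun x => RInt (fun t => gaux x t) 0 1) x (RInt (fun t => Derive (fun u => gaux u t) x) 0 1)).
{ apply is_derive_RInt_param.
  - apply filter_forall. intros y t _. eexists. apply gaux_derive_x.
  - intros t _. apply (continuity_2d_pt_ext (fun u v => -2 * u * exp (- (u ^ 2 * (1 + v ^ 2))))).
    { intros u v. symmetry. apply is_derive_unique. apply gaux_derive_x. }
    apply continuity_2d_pt_mult.
    + apply continuity_2d_pt_mult; [apply continuity_2d_pt_const | apply continuity_2d_pt_id1].
    + apply (continuity_1d_2d_pt_comp exp (fun u v => - (u ^ 2 * (1 + v ^ 2)))).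
      { apply derivable_continuous_pt, derivable_pt_exp. }
      apply continuity_2d_pt_opp. apply continuity_2d_pt_mult.
      * apply (continuity_2d_pt_ext (fun u _ => u * u)); [intros; ring|].
        apply continuity_2d_pt_mult; apply continuity_2d_pt_id1.
      * apply continuity_2d_pt_plus; [apply continuity_2d_pt_const|].
        apply (continuity_2d_pt_ext (fun _ v => v * v)); [intros; ring|].
        apply continuity_2d_pt_mult; apply continuity_2d_pt_id2.
  - apply filter_forall. intros y. apply (@ex_RInt_continuous R_CompleteNormedModule). intros; apply gaux_cont_t. }
erewrite RInt_ext in H; [exact H|]. intros t _. cbv beta. apply is_derive_unique. apply gaux_derive_x.
Qed.

(** Substitution [u = x t], after splitting off [exp (- x ^ 2)]. *)
Lemma gaux_int_gauss x :
  RInt (fun t => -2 * x * exp (- (x ^ 2 * (1 + t ^ 2)))) 0 1 = -2 * exp (- x ^ 2) * gauss x.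
Proof.
pose proof (@RInt_comp_lin R_CompleteNormedModule (fun u => exp (- u ^ 2)) x 0 0 1) as H.
replace (x * 0 + 0) with 0 in H by ring. replace (x * 1 + 0) with x in H by ring.
unfold gauss. rewrite <- H.
2:{ apply (@ex_RInt_continuous R_CompleteNormedModule). intros; apply gauss_cont. }
change (-2 * exp (- x ^ 2) * RInt (fun y => scal x (exp (- (x * y + 0) ^ 2))) 0 1)
  with (scal (-2 * exp (- x ^ 2)) (RInt (fun y => scal x (exp (- (x * y + 0) ^ 2))) 0 1)).
rewrite <- (@RInt_scal R_CompleteNormedModule).
- apply RInt_ext. intros t _.
  change (-2 * x * exp (- (x ^ 2 * (1 + t ^ 2))) = -2 * exp (- x ^ 2) * (x * exp (- (x * t + 0) ^ 2))).
  replace (- (x ^ 2 * (1 + t ^ 2))) with (- x ^ 2 + - (x * t + 0) ^ 2) by ring.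
  rewrite exp_plus. ring.
- apply (@ex_RInt_continuous R_CompleteNormedModule). intros z _.
  apply (@ex_derive_continuous _ R_NormedModule).
  apply (ex_derive_ext (fun y => x * exp (- (x * y + 0) ^ 2))); [reflexivity|]. auto_derive. auto.
Qed.

Lemma gauss_identity x : gauss x ^ 2 + RInt (gaux x) 0 1 = PI / 4.
Proof.
set (K := fun x => gauss x ^ 2 + RInt (gaux x) 0 1).
assert (HK : forall y, is_derive K y 0).
{ intros y. unfold K. evar_last.
  - apply (is_derive_plus (fun x => gauss x ^ 2) (fun x => RInt (gaux x) 0 1)).
    + apply (is_derive_pow gauss 2 y _ (gauss_derive y)).
    + apply gaux_int_derive.
  - rewrite gaux_int_gauss. simpl. unfold plus. simpl. ring. }
assert (E : K x = K 0).
{ destruct (MVT_gen K 0 x (fun _ => 0)) as [c [_ Hc]].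
  - intros; apply HK.
  - intros y _. apply derivable_continuous_pt. exists 0. apply is_derive_Reals, HK.
  - lra. }
change (K x = PI / 4). rewrite E. unfold K. rewrite gauss_0.
assert (EI : is_RInt (gaux 0) 0 1 (atan 1 - atan 0)).
{ apply (is_RInt_derive atan).
  - intros t _. evar_last; [apply is_derive_atan|]. unfold gaux.
    replace (- (0 ^ 2 * (1 + t ^ 2))) with 0 by ring. rewrite exp_0.
    pose proof (one_sq_pos t). unfold Rsqr. simpl in *. field. lra.
  - intros t _. apply gaux_cont_t. }
rewrite (is_RInt_unique _ _ _ _ EI), atan_1, atan_0. ring.
Qed.

Lemma gauss_bounds x : 0 <= x -> 0 <= gauss x /\ PI / 4 - exp (- x ^ 2) <= gauss x ^ 2 <= PI / 4.
Proof.
intros Hx. assert (Hex : forall a b, ex_RInt (gaux x) a b).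
{ intros. apply (@ex_RInt_continuous R_CompleteNormedModule). intros; apply gaux_cont_t. }
split.
- unfold gauss. apply RInt_ge_0; auto.
  + apply (@ex_RInt_continuous R_CompleteNormedModule). intros; apply gauss_cont.
  + intros; left; apply exp_pos.
- rewrite <- (gauss_identity x).
  assert (0 <= RInt (gaux x) 0 1).
  { apply RInt_ge_0; auto; [lra|]. intros t _. unfold gaux. pose proof (one_sq_pos t).
    apply Rmult_le_pos; [left; apply exp_pos | left; now apply Rinv_0_lt_compat]. }
  assert (RInt (gaux x) 0 1 <= RInt (fun _ => exp (- x ^ 2)) 0 1).
  { apply RInt_le; auto; [lra | apply ex_RInt_const |]. intros t _. unfold gaux. pose proof (one_sq_pos t).
    pose proof (pow2_ge_0 t). pose proof (pow2_ge_0 x). pose proof (exp_pos (- (x ^ 2 * (1 + t ^ 2)))).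
    apply Rle_trans with (exp (- (x ^ 2 * (1 + t ^ 2)))).
    - unfold Rdiv. rewrite <- (Rmult_1_r (exp (- (x ^ 2 * (1 + t ^ 2))))) at 2.
      apply Rmult_le_compat_l; [lra|]. rewrite <- Rinv_1. apply Rinv_le_contravar; lra.
    - apply exp_monotone. nra. }
  rewrite RInt_const in H0. change (scal (1 - 0) (exp (- x ^ 2))) with ((1 - 0) * exp (- x ^ 2)) in H0. lra.
Qed.

Lemma is_sum_ge {I} (f : I -> R) (l : C) L : (forall i, 0 <= f i) -> NoDup L ->
  is_sum (fun i => RtoC (f i)) l -> rsum f L <= Re l.
Proof.
intros Hf HN Hl. apply Rnot_lt_le. intros Hlt.
destruct (Hl (rsum f L - Re l) ltac:(lra)) as [L0 H0].
set (M := nodupI (L0 ++ L)). assert (HM : NoDup M) by apply NoDup_nodup.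
specialize (H0 M HM). assert (Hi : incl L0 M) by (intros i Hi; apply nodup_In, in_app_iff; auto).
specialize (H0 Hi). assert (Hi2 : incl L M) by (intros i Hi2; apply nodup_In, in_app_iff; auto).
pose proof (rsum_incl f L M Hf HN Hi2).
assert (E : lsum (fun i => RtoC (f i)) M = RtoC (rsum f M)).
{ clear. induction M as [|i M IH]; simpl; auto. rewrite IH. now rewrite RtoC_plus. }
rewrite E in H0. pose proof (re_le_Cmod (RtoC (rsum f M) - l)%C) as HR.
pose proof (Rle_abs (Re (RtoC (rsum f M) - l)%C)) as HA.
replace (Re (RtoC (rsum f M) - l)%C) with (rsum f M - Re l) in HA, HR by (destruct l; reflexivity). lra.
Qed.

Definition nome_im (t : R) : R := exp (- (PI * t)).
Definition th3r (t : R) : R := Re (T 0 (RtoC (nome_im t))).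
Definition th4r (t : R) : R := Re (T 0 (RtoC (- nome_im t))).

Lemma nome_im_bounds t : 0 < t -> 0 < nome_im t < 1.
Proof.
intros Ht. unfold nome_im. split; [apply exp_pos|]. rewrite <- exp_0. apply exp_increasing.
pose proof PI_RGT_0. nra.
Qed.

Lemma exp_mult_nat (n : nat) x : exp (INR n * x) = exp x ^ n.
Proof.
induction n as [|n IH]; [simpl; rewrite Rmult_0_l; apply exp_0|].
rewrite S_INR. simpl. rewrite <- IH, <- exp_plus. f_equal. ring.
Qed.

Lemma nome_im_pow t (n : nat) : nome_im t ^ n = exp (- (PI * t * INR n)).
Proof. unfold nome_im. rewrite <- exp_mult_nat. f_equal. ring. Qed.

(** The theta series is a Riemann sum of the Gaussian. *)
Lemma th3r_bounds s : 0 < s -> 1 / sqrt s - 1 <= th3r s <= 1 / sqrt s + 1.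
Proof.
intros Hs. pose proof PI_RGT_0 as HPI. pose proof (nome_im_bounds s Hs) as Hx.
assert (Hp : Cmod (RtoC (nome_im s)) < 1) by (rewrite Cmod_R, Rabs_pos_eq; lra).
set (f := fun y => exp (- (PI * s * y ^ 2))).
set (w := sqrt (PI * s)).
assert (Hw : 0 < w) by (apply sqrt_lt_R0; nra).
assert (Hw2 : w ^ 2 = PI * s) by (unfold w; simpl; rewrite Rmult_1_r; apply sqrt_sqrt; nra).
(* The antiderivative of [f] vanishing at 0, obtained by rescaling with [w = sqrt (PI s)]. *)
set (H := fun y => gauss (w * y) / w).
assert (HD : forall y, is_derive H y (f y)).
{ intros y. apply (is_derive_ext (fun y => / w * gauss (w * y))); [intros t; change (/ w * gauss (w * t) = gauss (w * t) / w); field; lra|].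
  evar_last.
  - apply (is_derive_scal (fun y => gauss (w * y)) y (/ w)).
    apply (is_derive_comp gauss (fun y => w * y)); [apply gauss_derive|].
    apply (is_derive_scal (fun y => y) y w 1). apply (@is_derive_id R_AbsRing).
  - unfold f. replace (- (PI * s * y ^ 2)) with (- (w * y) ^ 2) by (rewrite <- Hw2; ring).
    change (/ w * (w * 1 * exp (- (w * y) ^ 2)) = exp (- (w * y) ^ 2)). field. lra. }
assert (Hstep : forall n : nat, f (INR n + 1) <= H (INR n + 1) - H (INR n) <= f (INR n)).
{ intros n. pose proof (pos_INR n).
  destruct (MVT_gen H (INR n) (INR n + 1) f) as [c [Hc Ec]].
  - intros; apply HD.
  - intros y _. apply derivable_continuous_pt. exists (f y). apply is_derive_Reals, HD.
  - rewrite Rmin_left, Rmax_right in Hc by lra.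
    rewrite Ec. replace (f c * (INR n + 1 - INR n)) with (f c) by ring.
    assert (0 <= PI * s) by nra.
    unfold f. split; apply exp_monotone, Ropp_le_contravar, Rmult_le_compat_l; auto; apply pow_incr; lra. }
assert (H0 : H 0 = 0) by (unfold H; rewrite Rmult_0_r, gauss_0; field; lra).
set (g := fun n : nat => f (INR n + 1)).
assert (Hup : forall N, rsum g (seq 0 N) <= H (INR N)).
{ induction N as [|N IH]; [simpl; rewrite H0; lra|].
  rewrite seq_S, rsum_app, S_INR. change (rsum g [(0 + N)%nat]) with (f (INR N + 1) + 0).
  destruct (Hstep N). lra. }
assert (Hlow : forall N, H (INR N) <= 1 + rsum g (seq 0 N)).
(* The term [f (INR N)] is needed for the induction: the right side is then the left-endpoint sum,
   whose first term is [f 0 = 1]. *)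
{ intros N. assert (G : H (INR N) <= 1 + rsum g (seq 0 N) - f (INR N)).
  { induction N as [|N IH].
    - simpl. rewrite H0. unfold f. replace (- (PI * s * (0 * (0 * 1)))) with 0 by ring.
      replace (- (PI * s * 0 ^ 2)) with 0 by ring. rewrite exp_0. lra.
    - rewrite seq_S, rsum_app, S_INR. change (rsum g [(0 + N)%nat]) with (f (INR N + 1) + 0).
      destruct (Hstep N). lra. }
  pose proof (exp_pos (- (PI * s * INR N ^ 2))). unfold f in *. lra. }
assert (Hnn : forall n, 0 <= g n) by (intros; left; apply exp_pos).
(* The integral of [f] over the positive half-line. *)
set (q := 1 / (2 * sqrt s)).
assert (Hsq : 0 < sqrt s) by now apply sqrt_lt_R0.
assert (Hsq2 : sqrt s ^ 2 = s) by (simpl; rewrite Rmult_1_r; apply sqrt_sqrt; lra).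
assert (Hq : 0 < q) by (unfold q; apply Rdiv_lt_0_compat; lra).
assert (Hq2 : q ^ 2 = 1 / (4 * s)).
{ unfold q. rewrite <- Hsq2 at 2. field. lra. }
assert (HH : forall N, 0 <= H (INR N) /\ q ^ 2 - exp (- (w * INR N) ^ 2) / (PI * s) <= H (INR N) ^ 2 <= q ^ 2).
{ intros N. pose proof (pos_INR N). destruct (gauss_bounds (w * INR N)) as [B1 [B2 B3]]; [nra|].
  assert (E : H (INR N) ^ 2 = gauss (w * INR N) ^ 2 / (PI * s)) by (unfold H; rewrite <- Hw2; field; lra).
  assert (Hi : 0 < / (PI * s)) by (apply Rinv_0_lt_compat; nra).
  split; [unfold H; apply Rmult_le_pos; auto; left; now apply Rinv_0_lt_compat|].
  rewrite E, Hq2. replace (1 / (4 * s)) with (PI / 4 * / (PI * s)) by (field; lra).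
  unfold Rdiv at 2 3. split; nra. }
assert (Hub : forall L, NoDup L -> rsum g L <= q).
{ apply rsum_nat_le; auto. intros N. eapply Rle_trans; [apply Hup|]. destruct (HH N) as [P1 [P2 P3]].
  apply Rnot_lt_le. intros Hlt. nra. }
pose proof (is_sum_Z_fold _ _ (T0_abs _ Hp) (is_sum_T0 _ Hp)) as HS.
set (l := (T 0 (RtoC (nome_im s)) - RtoC (nome_im s) ^ Z.to_nat (0 * 0))%C) in HS.
assert (HS2 : is_sum (fun k => RtoC (2 * g k)) l).
{ revert HS. apply is_sum_ext. intros k.
  replace (- Z.of_nat (S k) * - Z.of_nat (S k))%Z with (Z.of_nat (S k) * Z.of_nat (S k))%Z by ring.
  rewrite <- RtoC_pow, <- RtoC_plus. f_equal. rewrite nome_im_pow. unfold g, f.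
  rewrite INR_IZR_INZ, Z2Nat.id, mult_IZR, <- INR_IZR_INZ, S_INR by nia.
  replace (- (PI * s * ((INR k + 1) * (INR k + 1)))) with (- (PI * s * (INR k + 1) ^ 2)) by ring. ring. }
assert (El : th3r s = 1 + Re l).
{ unfold th3r, l. generalize (T 0 (RtoC (nome_im s))). intros [u v]. simpl. ring. }
assert (U : Re l <= 2 * q).
{ eapply Rle_trans; [apply Rle_abs|]. eapply Rle_trans; [apply re_le_Cmod|].
  apply (is_sum_bound _ _ _ HS2). intros L HN.
  eapply Rle_trans; [|apply Rmult_le_compat_l with (r := 2); [lra | apply (Hub L HN)]].
  rewrite <- rsum_scal. apply rsum_le. intros i. specialize (Hnn i). rewrite Cmod_R, Rabs_pos_eq; lra. }
assert (Hl : forall N, 2 * H (INR N) <= 2 + Re l).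
{ intros N. assert (rsum (fun k => 2 * g k) (seq 0 N) <= Re l).
  { apply is_sum_ge; auto; [intros i; specialize (Hnn i); lra | apply seq_NoDup]. }
  rewrite rsum_scal in H1. specialize (Hlow N). lra. }
assert (Hq1 : q <= 1 + Re l / 2).
{ set (m := 1 + Re l / 2). assert (Hm : forall N, H (INR N) <= m) by (intros N; specialize (Hl N); unfold m; lra).
  assert (Hm0 : 0 <= m) by (specialize (Hm 0%nat); simpl in Hm; lra).
  apply Rnot_lt_le. intros Hlt.
  assert (Hd : 0 < (q ^ 2 - m ^ 2) * (PI * s)) by (apply Rmult_lt_0_compat; nra).
  set (d := (q ^ 2 - m ^ 2) * (PI * s)) in *.
  (* Chosen so that [z = (w (N + 1))^2] exceeds [1 / d]; then [exp z > 1 + z] gives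
     [exp (- z) < d]. *)
  destruct (INR_unbounded (1 / (d * w ^ 2))) as [N HN].
  destruct (HH (S N)) as [P1 [P2 P3]]. specialize (Hm (S N)).
  assert (Hexp : exp (- (w * INR (S N)) ^ 2) < d).
  { rewrite exp_Ropp. set (z := (w * INR (S N)) ^ 2).
    assert (Hz : 1 / d < z).
    { apply Rlt_le_trans with (w ^ 2 * INR (S N)).
      - apply Rmult_lt_reg_r with (/ w ^ 2); [apply Rinv_0_lt_compat; nra|].
        replace (w ^ 2 * INR (S N) * / w ^ 2) with (INR (S N)) by (field; lra).
        replace (1 / d * / w ^ 2) with (1 / (d * w ^ 2)) by (field; lra). rewrite S_INR. lra.
      - unfold z. rewrite Rpow_mult_distr. apply Rmult_le_compat_l; [nra|].
        rewrite S_INR. pose proof (pos_INR N). nra. }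
    assert (0 < 1 / d) by (apply Rdiv_lt_0_compat; lra).
    pose proof (exp_ineq1 z ltac:(lra)).
    rewrite <- (Rinv_inv d). apply Rinv_lt_contravar; [|unfold Rdiv in *; lra].
    apply Rmult_lt_0_compat; [unfold Rdiv in *; lra | apply exp_pos]. }
  assert (exp (- (w * INR (S N)) ^ 2) / (PI * s) < q ^ 2 - m ^ 2).
  { apply Rmult_lt_reg_r with (PI * s); [nra|]. unfold Rdiv. rewrite Rmult_assoc, Rinv_l, Rmult_1_r by nra. exact Hexp. }
  assert (H (INR (S N)) ^ 2 <= m ^ 2) by (apply pow_incr; auto). lra. }
replace (1 / sqrt s) with (2 * q) by (unfold q; field; lra). lra.
Qed.

(** * The inversion of theta_3 on the imaginary axis *)

Fixpoint agm (n : nat) (x y : R) : R :=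
  match n with
  | O => x
  | S m => agm m ((x + y) / 2) (sqrt (x * y))
  end.

Lemma agm_homog n c x y : 0 <= c -> 0 <= x -> 0 <= y -> agm n (c * x) (c * y) = c * agm n x y.
Proof.
revert x y; induction n as [|n IH]; intros x y Hc Hx Hy; [reflexivity|]. simpl.
replace ((c * x + c * y) / 2) with (c * ((x + y) / 2)) by field.
replace (c * x * (c * y)) with ((c * c) * (x * y)) by ring.
rewrite sqrt_mult by nra. rewrite (sqrt_square c) by auto.
apply IH; auto; [lra | apply sqrt_pos].
Qed.

Lemma agm_mono n x y x' y' : 0 <= x <= x' -> 0 <= y <= y' -> agm n x y <= agm n x' y'.
Proof.
revert x y x' y'; induction n as [|n IH]; intros x y x' y' Hx Hy; [simpl; lra|]. simpl. apply IH.
- lra.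
- split; [apply sqrt_pos|]. apply sqrt_le_1; nra.
Qed.

(** A strict inequality must survive the limit. After one step both entries have grown by a factor
    of at least [rho > 1], and homogeneity carries this factor through all later steps. *)
Lemma agm_strict x y y' : 0 < x -> 0 < y < y' ->
  exists rho, 1 < rho /\ forall n, rho * agm (S n) x y <= agm (S n) x y'.
Proof.
intros Hx Hy.
set (u := (x + y) / 2). set (u' := (x + y') / 2). set (v := sqrt (x * y)). set (v' := sqrt (x * y')).
assert (Hu : 0 < u < u') by (unfold u, u'; lra).
assert (Hv : 0 < v < v') by (unfold v, v'; split; [apply sqrt_lt_R0; nra | apply sqrt_lt_1; nra]).
exists (Rmin (u' / u) (v' / v)).
assert (H1 : Rmin (u' / u) (v' / v) * u <= u').
{ apply Rle_trans with (u' / u * u); [apply Rmult_le_compat_r; [lra | apply Rmin_l] | right; field; lra]. }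
assert (H2 : Rmin (u' / u) (v' / v) * v <= v').
{ apply Rle_trans with (v' / v * v); [apply Rmult_le_compat_r; [lra | apply Rmin_r] | right; field; lra]. }
assert (H3 : 1 < Rmin (u' / u) (v' / v)).
{ apply Rmin_glb_lt.
  - apply Rmult_lt_reg_r with u; [lra|]. replace (u' / u * u) with u' by (field; lra). lra.
  - apply Rmult_lt_reg_r with v; [lra|]. replace (v' / v * v) with v' by (field; lra). lra. }
split; auto. intros n. simpl. fold u v u' v'. rewrite <- agm_homog by lra.
apply agm_mono; (split; [apply Rmult_le_pos; lra | assumption]).
Qed.

Lemma agm_lim_strict (x y y' l l' : R) : 0 < x -> 0 < y < y' -> 0 < l ->
  is_lim_seq (fun n => agm n x y) l -> is_lim_seq (fun n => agm n x y') l' -> l < l'.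
Proof.
intros Hx Hy Hl H H'. destruct (agm_strict x y y' Hx Hy) as [rho [Hr Hle]].
apply is_lim_seq_incr_1 in H, H'.
apply (is_lim_seq_scal_l _ rho) in H. simpl in H.
pose proof (is_lim_seq_le _ _ _ _ Hle H H') as E. simpl in E. nra.
Qed.

Lemma real_nome_disc t : 0 < t -> Cmod (RtoC (nome_im t)) < 1.
Proof. intros Ht. pose proof (nome_im_bounds t Ht). rewrite Cmod_R, Rabs_pos_eq; lra. Qed.

Lemma th3r_C t : 0 < t -> T 0 (RtoC (nome_im t)) = RtoC (th3r t).
Proof. intros Ht. apply real_C, T_real. rewrite <- Cmod_R. now apply real_nome_disc. Qed.

Lemma th4r_C t : 0 < t -> T 0 (- RtoC (nome_im t))%C = RtoC (th4r t).
Proof.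
intros Ht. rewrite <- RtoC_opp. apply real_C, T_real. rewrite Rabs_Ropp, <- Cmod_R. now apply real_nome_disc.
Qed.

Lemma nome_im_dbl t : (RtoC (nome_im t) ^ 2)%C = RtoC (nome_im (2 * t)).
Proof. rewrite <- RtoC_pow, nome_im_pow. f_equal. unfold nome_im. f_equal. simpl. ring. Qed.

Lemma th3r_pos t : 0 < t -> 0 < th3r t.
Proof.
intros Ht. pose proof (nome_im_bounds t Ht).
apply Rlt_le_trans with (rsum (fun n : Z => nome_im t ^ Z.to_nat (n * n)) [0%Z]); [simpl; lra|].
apply is_sum_ge.
- intros i. apply pow_le. lra.
- repeat constructor; auto.
- generalize (is_sum_T0 _ (real_nome_disc t Ht)). apply is_sum_ext. intros n. now rewrite RtoC_pow.
Qed.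

Lemma th4r_pos t : 0 < t -> 0 < th4r t.
Proof.
intros Ht. destruct (kappa_pos_real (nome_im t) (nome_im_bounds t Ht)) as [_ H]. specialize (H 0%nat).
unfold kappa in H. simpl (2 ^ 0)%nat in H. pose proof (th3r_pos t Ht).
replace (RtoC (nome_im t) ^ 1)%C with (RtoC (nome_im t)) in H by ring.
rewrite th3r_C, th4r_C, <- RtoC_div in H by lra. simpl in H.
replace (th4r t) with (th4r t / th3r t * th3r t) by (field; lra). now apply Rmult_lt_0_compat.
Qed.

Definition tA (t : R) : R := th3r t ^ 2.
Definition tB (t : R) : R := th4r t ^ 2.
(** [theta_2^2] on the imaginary axis, obtained as the positive root in Jacobi's identity. *)
Definition tC (t : R) : R := sqrt (tA t ^ 2 - tB t ^ 2).

Lemma tA_dbl t : 0 < t -> tA (2 * t) = (tA t + tB t) / 2.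
Proof.
intros Ht. pose proof (T0_sq_add _ (real_nome_disc t Ht)) as E.
rewrite nome_im_dbl, th4r_C, !th3r_C in E by lra.
rewrite <- !RtoC_pow, <- RtoC_plus, <- RtoC_mult in E. apply RtoC_inj in E. unfold tA, tB. lra.
Qed.

Lemma tB_dbl t : 0 < t -> tB (2 * t) = sqrt (tA t * tB t).
Proof.
intros Ht. pose proof (T0_mul_neg _ (real_nome_disc t Ht)) as E.
rewrite nome_im_dbl, !th4r_C, th3r_C in E by lra.
rewrite <- !RtoC_pow, <- RtoC_mult in E. apply RtoC_inj in E. unfold tA, tB.
rewrite <- E. replace (th3r t ^ 2 * th4r t ^ 2) with (th3r t * th4r t * (th3r t * th4r t)) by ring.
rewrite sqrt_square; auto. pose proof (th3r_pos t Ht). pose proof (th4r_pos t Ht). nra.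
Qed.

Lemma tA_pos t : 0 < t -> 0 < tA t.
Proof. intros Ht. unfold tA. pose proof (th3r_pos t Ht). nra. Qed.

Lemma tB_pos t : 0 < t -> 0 < tB t.
Proof. intros Ht. unfold tB. pose proof (th4r_pos t Ht). nra. Qed.

(** The inequality of the means at [t / 2] gives the weak form; equality would be a zero of
    [theta_2^4]. *)
Lemma tB_lt_tA t : 0 < t -> tB t < tA t.
Proof.
intros Ht. assert (Hh : 0 < t / 2) by lra.
pose proof (tA_dbl (t / 2) Hh) as E1. pose proof (tB_dbl (t / 2) Hh) as E2.
replace (2 * (t / 2)) with t in E1, E2 by field.
pose proof (tA_pos (t / 2) Hh) as PA. pose proof (tB_pos (t / 2) Hh) as PB.
pose proof (tA_pos t Ht). pose proof (tB_pos t Ht).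
assert (Hle : tB t <= tA t).
{ rewrite E1, E2. rewrite <- (sqrt_square ((tA (t / 2) + tB (t / 2)) / 2)) by lra.
  apply sqrt_le_1; [nra | nra |]. pose proof (pow2_ge_0 (tA (t / 2) - tB (t / 2))). nra. }
destruct Hle as [|E]; auto. exfalso.
apply (th2_nonzero _ (real_nome_disc t Ht)).
- apply RtoC_nz. pose proof (nome_im_bounds t Ht). lra.
- unfold th2. rewrite th3r_C, th4r_C by lra. rewrite <- !RtoC_pow, <- RtoC_minus. f_equal.
  unfold tA, tB in E. nra.
Qed.

Lemma tC_sq t : 0 < t -> 0 < tC t /\ tC t ^ 2 = tA t ^ 2 - tB t ^ 2.
Proof.
intros Ht. pose proof (tB_lt_tA t Ht). pose proof (tB_pos t Ht).
assert (0 < tA t ^ 2 - tB t ^ 2) by nra. unfold tC. split; [now apply sqrt_lt_R0|].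
apply pow2_sqrt. lra.
Qed.

Lemma tC_dbl t : 0 < t -> tC (2 * t) = (tA t - tB t) / 2.
Proof.
intros Ht. pose proof (tB_lt_tA t Ht). pose proof (tB_pos t Ht).
unfold tC. rewrite tA_dbl, tB_dbl by auto.
replace (sqrt (tA t * tB t) ^ 2) with (tA t * tB t) by (rewrite pow2_sqrt; nra).
replace (((tA t + tB t) / 2) ^ 2 - tA t * tB t) with ((tA t - tB t) / 2 * ((tA t - tB t) / 2)) by field.
apply sqrt_square. lra.
Qed.

(** For the pair [theta_3^2], [theta_2^2] a mean step runs in the opposite direction: it halves [t],
    up to the scale [1 / 2]. *)
Lemma tA_half t : 0 < t -> (tA t + tC t) / 2 = tA (t / 2) / 2.
Proof.
intros Ht. replace t with (2 * (t / 2)) at 1 2 by field. rewrite tA_dbl, tC_dbl by lra. field.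
Qed.

Lemma tC_half t : 0 < t -> sqrt (tA t * tC t) = tC (t / 2) / 2.
Proof.
intros Ht. assert (Hh : 0 < t / 2) by lra. destruct (tC_sq (t / 2) Hh) as [P E].
replace t with (2 * (t / 2)) at 1 2 by field. rewrite tA_dbl, tC_dbl by lra.
replace ((tA (t / 2) + tB (t / 2)) / 2 * ((tA (t / 2) - tB (t / 2)) / 2)) with
  (tC (t / 2) / 2 * (tC (t / 2) / 2)).
- apply sqrt_square. lra.
- replace (tC (t / 2) / 2 * (tC (t / 2) / 2)) with (tC (t / 2) ^ 2 / 4) by field. rewrite E. field.
Qed.

Lemma agm_tB n t : 0 < t -> agm n (tA t) (tB t) = tA (2 ^ n * t).
Proof.
revert t; induction n as [|n IH]; intros t Ht; simpl; [f_equal; ring|].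
rewrite <- tA_dbl, <- tB_dbl, IH by lra. f_equal. ring.
Qed.

Lemma agm_tC n t : 0 < t -> agm n (tA t) (tC t) = tA (t / 2 ^ n) / 2 ^ n.
Proof.
revert t; induction n as [|n IH]; intros t Ht; simpl; [unfold Rdiv; rewrite Rinv_1, !Rmult_1_r; auto|].
assert (Hh : 0 < t / 2) by lra.
rewrite tA_half, tC_half by auto.
replace (tA (t / 2) / 2) with (/ 2 * tA (t / 2)) by field.
replace (tC (t / 2) / 2) with (/ 2 * tC (t / 2)) by field.
rewrite agm_homog, IH; [ | auto | lra | left; now apply tA_pos | left; now apply tC_sq].
assert (2 ^ n <> 0) by (apply pow_nonzero; lra).
replace (t / 2 / 2 ^ n) with (t / (2 * 2 ^ n)) by (field; auto). field; auto.
Qed.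

Lemma agm_tB_lim t : 0 < t -> is_lim_seq (fun n => agm n (tA t) (tB t)) 1.
Proof.
intros Ht. apply (is_lim_seq_ext (fun n => th3r (2 ^ n * t) * th3r (2 ^ n * t))).
{ intros n. rewrite agm_tB by auto. unfold tA. ring. }
assert (H : is_lim_seq (fun n => th3r (2 ^ n * t)) 1).
{ intros P [eps HP].
  destruct (dbl_near _ _ (real_nome_disc t Ht) (cd_ct _ _ _ (cd_T 0 0 Cmod_0_lt_1) eps (cond_pos eps)))
    as [N HN].
  exists N. intros n Hn. apply HP. specialize (HN n Hn). cbv beta in HN.
  rewrite T0_at_0 in HN.
  assert (E : (RtoC (nome_im t) ^ 2 ^ n)%C = RtoC (nome_im (2 ^ n * t))).
  { rewrite <- RtoC_pow, nome_im_pow. unfold nome_im. do 2 f_equal. rewrite pow_INR. simpl INR.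
    replace (1 + 1) with 2 by ring. ring. }
  rewrite E, th3r_C, <- RtoC_minus, Cmod_R in HN.
  - exact HN.
  - apply Rmult_lt_0_compat; auto. apply pow_lt; lra. }
pose proof (is_lim_seq_mult' _ _ _ _ H H) as G. now rewrite Rmult_1_r in G.
Qed.

Lemma half_pow_lim : is_lim_seq (fun n => / 2 ^ n) 0.
Proof.
apply (is_lim_seq_ext (fun n => (/ 2) ^ n)); [intros; apply pow_inv|].
apply is_lim_seq_geom. rewrite Rabs_pos_eq; lra.
Qed.

(** The iterates are [(1 / t) (sqrt s theta_3(s))^2] at [s = t / 2^n], and the Riemann sum bounds
    send [sqrt s theta_3(s)] to 1 as [s] tends to 0. *)
Lemma agm_tC_lim t : 0 < t -> is_lim_seq (fun n => agm n (tA t) (tC t)) (1 / t).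
Proof.
intros Ht.
assert (Hs : forall n, 0 < t / 2 ^ n) by (intros; apply Rdiv_lt_0_compat; auto; apply pow_lt; lra).
set (w := fun n => sqrt (t / 2 ^ n) * th3r (t / 2 ^ n)).
apply (is_lim_seq_ext (fun n => (1 / t) * (w n * w n))).
{ intros n. rewrite agm_tC by auto. unfold w, tA. specialize (Hs n).
  replace (sqrt (t / 2 ^ n) * th3r (t / 2 ^ n) * (sqrt (t / 2 ^ n) * th3r (t / 2 ^ n))) with
    (sqrt (t / 2 ^ n) * sqrt (t / 2 ^ n) * th3r (t / 2 ^ n) ^ 2) by ring.
  rewrite sqrt_sqrt by lra. field. split; [apply pow_nonzero; lra | lra]. }
assert (Hr : is_lim_seq (fun n => sqrt (t / 2 ^ n)) 0).
{ rewrite <- sqrt_0. apply (is_lim_seq_continuous sqrt (fun n => t / 2 ^ n) 0).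
  - apply continuity_pt_sqrt. lra.
  - replace 0 with (t * 0) by ring. apply (is_lim_seq_scal_l _ t 0 half_pow_lim). }
assert (Hw : is_lim_seq w 1).
{ apply (is_lim_seq_le_le (fun n => 1 - sqrt (t / 2 ^ n)) _ (fun n => 1 + sqrt (t / 2 ^ n))).
  - intros n. specialize (Hs n). destruct (th3r_bounds _ Hs) as [B1 B2].
    assert (Hq : 0 < sqrt (t / 2 ^ n)) by now apply sqrt_lt_R0.
    unfold w. set (r := sqrt (t / 2 ^ n)) in *. set (v := th3r (t / 2 ^ n)) in *.
    replace (1 - r) with (r * (1 / r - 1)) by (field; lra).
    replace (1 + r) with (r * (1 / r + 1)) by (field; lra).
    split; apply Rmult_le_compat_l; lra.
  - pose proof (is_lim_seq_minus' _ _ _ _ (is_lim_seq_const 1) Hr) as G. now rewrite Rminus_0_r in G.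
  - pose proof (is_lim_seq_plus' _ _ _ _ (is_lim_seq_const 1) Hr) as G. now rewrite Rplus_0_r in G. }
pose proof (is_lim_seq_scal_l _ (1 / t) _ (is_lim_seq_mult' _ _ _ _ Hw Hw)) as G. simpl in G.
replace (1 / t * (1 * 1)) with (1 / t) in G by (field; lra). exact G.
Qed.

Lemma agm_ratio_lim (x y l : R) : 0 < x -> 0 <= y -> is_lim_seq (fun n => agm n x y) l ->
  is_lim_seq (fun n => agm n 1 (y / x)) (l / x).
Proof.
intros Hx Hy H. apply (is_lim_seq_ext (fun n => / x * agm n x y)).
- intros n. assert (Hi : 0 < / x) by now apply Rinv_0_lt_compat.
  rewrite <- agm_homog by lra. f_equal; [field; lra | unfold Rdiv; ring].
- replace (l / x) with (/ x * l) by (unfold Rdiv; ring). apply (is_lim_seq_scal_l _ (/ x) l H).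
Qed.

(** Both sides have the same pair of arithmetic-geometric means up to scale, and
    [M(1, k') / M(1, k)] determines [k]. *)
Lemma th_inversion t : 0 < t -> tB (/ t) / tA (/ t) = tC t / tA t /\ tA (/ t) = t * tA t.
Proof.
intros Ht. assert (Hi : 0 < / t) by now apply Rinv_0_lt_compat.
pose proof (tA_pos t Ht) as PA. pose proof (tA_pos _ Hi) as PA'.
pose proof (tB_pos t Ht) as PB. pose proof (tB_pos _ Hi) as PB'.
destruct (tC_sq t Ht) as [PC EC]. destruct (tC_sq _ Hi) as [PC' EC'].
pose proof (agm_ratio_lim _ _ _ PA (Rlt_le _ _ PB) (agm_tB_lim t Ht)) as L1.
pose proof (agm_ratio_lim _ _ _ PA (Rlt_le _ _ PC) (agm_tC_lim t Ht)) as L2.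
pose proof (agm_ratio_lim _ _ _ PA' (Rlt_le _ _ PB') (agm_tB_lim _ Hi)) as L3.
pose proof (agm_ratio_lim _ _ _ PA' (Rlt_le _ _ PC') (agm_tC_lim _ Hi)) as L4.
set (A := tA t) in *. set (A' := tA (/ t)) in *.
set (k' := tB t / A) in *. set (k := tC t / A) in *.
set (l' := tB (/ t) / A') in *. set (l := tC (/ t) / A') in *.
assert (Ek : k ^ 2 + k' ^ 2 = 1).
{ unfold k, k'. replace ((tC t / A) ^ 2 + (tB t / A) ^ 2) with ((tC t ^ 2 + tB t ^ 2) / A ^ 2) by (field; lra).
  rewrite EC. unfold A. field. unfold A in PA. lra. }
assert (El : l ^ 2 + l' ^ 2 = 1).
{ unfold l, l'. replace ((tC (/ t) / A') ^ 2 + (tB (/ t) / A') ^ 2) with ((tC (/ t) ^ 2 + tB (/ t) ^ 2) / A' ^ 2) by (field; lra).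
  rewrite EC'. unfold A'. field. unfold A' in PA'. lra. }
assert (Pk : 0 < k) by (now apply Rdiv_lt_0_compat). assert (Pk' : 0 < k') by (now apply Rdiv_lt_0_compat).
assert (Pl : 0 < l) by (now apply Rdiv_lt_0_compat). assert (Pl' : 0 < l') by (now apply Rdiv_lt_0_compat).
assert (Q1 : 0 < 1 / A) by (apply Rdiv_lt_0_compat; lra).
assert (Q2 : 0 < 1 / t / A) by (repeat apply Rdiv_lt_0_compat; lra).
assert (Q3 : 0 < 1 / A') by (apply Rdiv_lt_0_compat; lra).
assert (Q4 : 0 < 1 / / t / A') by (repeat apply Rdiv_lt_0_compat; lra).
assert (R1 : 1 / A = t * (1 / t / A)) by (field; lra).
assert (R2 : 1 / / t / A' = t * (1 / A')) by (field; lra).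
assert (Kl : k = l').
(* Writing [M] for the limit, [M(1, k') = t M(1, k)] and [M(1, l) = t M(1, l')]. If [k < l'], the
   circle relations give [l < k'], and monotonicity of [M] yields contradictory inequalities. *)
{ destruct (Rtotal_order k l') as [H|[H|H]]; auto; exfalso.
  - assert (H' : l < k') by nra.
    pose proof (agm_lim_strict 1 k l' _ _ Rlt_0_1 (conj Pk H) Q2 L2 L3) as I1.
    pose proof (agm_lim_strict 1 l k' _ _ Rlt_0_1 (conj Pl H') Q4 L4 L1) as I2.
    rewrite R1, R2 in I2. nra.
  - assert (H' : k' < l) by nra.
    pose proof (agm_lim_strict 1 l' k _ _ Rlt_0_1 (conj Pl' H) Q3 L3 L2) as I1.
    pose proof (agm_lim_strict 1 k' l _ _ Rlt_0_1 (conj Pk' H') Q1 L1 L4) as I2.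
    rewrite R1, R2 in I2. nra. }
split; [auto|].
rewrite <- Kl in L3. apply is_lim_seq_unique in L2, L3. rewrite L2 in L3. injection L3 as E.
replace A' with (/ (1 / A')) by (field; lra). rewrite <- E. field. lra.
Qed.

Lemma th3r_derive t : 0 < t -> is_derive th3r t (- PI * Re (T 2 (RtoC (nome_im t)))).
Proof.
intros Ht. pose proof (real_nome_disc t Ht) as Hp.
evar_last.
- apply (is_derive_comp (fun y => Re (T 0 (RtoC y))) nome_im).
  + apply cd_real_derive. now apply cd_T.
  + unfold nome_im. auto_derive; [auto|]. reflexivity.
- rewrite <- (mul_dT 0) by auto. fold (nome_im t). unfold scal. simpl. unfold mult. simpl.
  change (exp (- (PI * t))) with (nome_im t).
  destruct (dT 0 (RtoC (nome_im t))) as [u v]. simpl. ring.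
Qed.

Definition p_i : C := RtoC (nome_im 1).

Lemma p_i_disc : Cmod p_i < 1.
Proof. apply real_nome_disc. lra. Qed.

(** At the fixed point [t = 1] of the inversion, [theta_4^2 = theta_2^2]. *)
Lemma lam_p_i : lam p_i = (1 / 2)%C.
Proof.
destruct (th_inversion 1 ltac:(lra)) as [E _]. rewrite Rinv_1 in E.
destruct (tC_sq 1 ltac:(lra)) as [_ EC]. pose proof (tA_pos 1 ltac:(lra)) as PA.
assert (E2 : tB 1 = tC 1).
{ apply (f_equal (fun z => z * tA 1)) in E.
  replace (tB 1 / tA 1 * tA 1) with (tB 1) in E by (field; lra).
  replace (tC 1 / tA 1 * tA 1) with (tC 1) in E by (field; lra). exact E. }
rewrite <- E2 in EC. unfold lam, th2, p_i. rewrite th3r_C, th4r_C by lra.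
pose proof (th3r_pos 1 ltac:(lra)).
rewrite <- !RtoC_pow, <- RtoC_minus, <- !RtoC_div; [|lra | apply pow_nonzero; lra].
f_equal. unfold tA, tB in EC.
replace (th4r 1 ^ 4) with (th3r 1 ^ 4 / 2) by nra. field. lra.
Qed.

(** Obtained by differentiating [tA (/ t) = t * tA t] at [t = 1]. As [lambda = 1/2] there,
    [E2 = 12 v3], so this is the value [3 / PI] of [E2] at [i]. *)
Lemma v3_p_i : v3 p_i = RtoC (1 / (4 * PI)).
Proof.
pose proof PI_RGT_0 as HPI.
pose proof (th3r_pos 1 ltac:(lra)) as P3.
pose proof (th3r_derive 1 ltac:(lra)) as D.
set (g := - PI * Re (T 2 (RtoC (nome_im 1)))) in *.
assert (DA : is_derive tA 1 (2 * th3r 1 * g)).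
{ unfold tA. evar_last; [apply (is_derive_pow th3r 2 1 g D)|]. simpl. ring. }
assert (D1 : is_derive (fun t => tA (/ t)) 1 (- (2 * th3r 1 * g))).
{ evar_last.
  - apply (is_derive_comp tA Rinv 1).
    + rewrite Rinv_1. exact DA.
    + apply (is_derive_inv (fun t => t) 1 1); [apply (@is_derive_id R_AbsRing) | lra].
  - unfold scal. simpl. unfold mult. simpl. field. }
assert (D2 : is_derive (fun t => t * tA t) 1 (tA 1 + 2 * th3r 1 * g)).
{ evar_last.
  - apply (is_derive_mult (fun t => t) tA 1); [apply (@is_derive_id R_AbsRing) | exact DA | intros; apply Rmult_comm].
  - unfold plus, mult, one. simpl. ring. }
assert (E : tA 1 + 2 * th3r 1 * g = - (2 * th3r 1 * g)).
{ apply is_derive_unique in D1. rewrite <- D1.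
  symmetry. apply is_derive_unique.
  apply (is_derive_ext_loc (fun t => t * tA t)); auto.
  exists (mkposreal (1/2) ltac:(lra)). intros y Hy. change (Rabs (y - 1) < 1/2) in Hy.
  apply Rabs_def2 in Hy. symmetry. apply th_inversion. lra. }
assert (E2 : Re (T 2 (RtoC (nome_im 1))) = th3r 1 / (4 * PI)).
{ unfold tA, g in E.
  assert (E' : th3r 1 = 4 * PI * Re (T 2 (RtoC (nome_im 1)))).
  { apply Rmult_eq_reg_l with (th3r 1); [|lra]. nra. }
  rewrite E' at 1. field. lra. }
unfold v3, p_i. rewrite th3r_C by lra.
rewrite (real_C (T 2 (RtoC (nome_im 1)))).
- rewrite E2, <- RtoC_div by lra. f_equal. field. lra.
- apply T_real. rewrite <- Cmod_R. apply real_nome_disc. lra.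
Qed.

(** * The identity *)

Local Open Scope C_scope.

(** On the imaginary axis [0 < theta_4 < theta_3], so [lambda = 1 - (theta_4 / theta_3)^4] lies
    between 0 and 1. *)
Lemma Om_real (x : R) : (0 <= x < 1)%R -> Om (RtoC x).
Proof.
intros [[H0| <-] H1]; [|exact Om_0].
pose proof PI_RGT_0 as HPI.
set (t := (- ln x / PI)%R).
assert (Ht : (0 < t)%R).
{ unfold t. apply Rdiv_lt_0_compat; auto. assert (ln x < 0)%R; [|lra].
  rewrite <- ln_1. now apply ln_increasing. }
assert (E : x = nome_im t).
{ unfold nome_im, t. replace (- (PI * (- ln x / PI)))%R with (ln x) by (field; lra). now rewrite exp_ln. }
rewrite E. split; [now apply real_nome_disc|].
replace (lam (RtoC (nome_im t))) with (RtoC (1 - (tB t / tA t) ^ 2)).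
- rewrite Cmod_R. pose proof (tB_pos t Ht). pose proof (tA_pos t Ht). pose proof (tB_lt_tA t Ht).
  assert (0 < tB t / tA t < 1)%R.
  { split; [now apply Rdiv_lt_0_compat|]. apply Rmult_lt_reg_r with (tA t); auto.
    replace (tB t / tA t * tA t)%R with (tB t) by (field; lra). lra. }
  apply Rabs_def1; nra.
- replace (lam (RtoC (nome_im t))) with (1 - (1 - lam (RtoC (nome_im t)))) by ring.
  rewrite one_sub_lam by now apply real_nome_disc.
  rewrite th3r_C, th4r_C by auto. pose proof (th3r_pos t Ht).
  rewrite <- !RtoC_pow, <- RtoC_div, <- RtoC_minus by (apply pow_nonzero; lra).
  f_equal. unfold tA, tB. field. lra.
Qed.

(** The real segment from 0 to [p_i] stays in [Om]. The Wronskian is propagated along it first,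
    since constancy of [Rt] requires its vanishing. *)
Lemma branch_p_i : branch p_i.
Proof.
pose proof (nome_im_bounds 1 ltac:(lra)) as Hx.
assert (Hseg : forall x s, seg 0 (RtoC x) s = RtoC (s * x)).
{ intros x s. unfold seg. rewrite RtoC_mult. ring. }
assert (HO : forall x s, (0 <= x < 1)%R -> (0 <= s <= 1)%R -> Om (seg 0 (RtoC x) s)).
{ intros x s H1 H2. rewrite Hseg. apply Om_real. nra. }
assert (Hnz : forall x s, (0 < x < 1)%R -> (0 < s < 1)%R -> seg 0 (RtoC x) s <> 0).
{ intros x s H1 H2. rewrite Hseg. apply RtoC_nz. nra. }
destruct branch_0 as [W0 R0].
assert (HW : forall x, (0 < x < 1)%R -> Wr (RtoC x) = 0).
{ intros x H1. rewrite <- W0. symmetry. apply pd_const_segment.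
  - intros s Hs. exists 0. apply pd_Wr, HO; lra.
  - intros s Hs. split; [now apply Hnz | apply pd_Wr, HO; lra]. }
split; [now apply HW|].
rewrite <- R0. symmetry. apply pd_const_segment.
- intros s Hs. eexists. apply pd_Rt, HO; lra.
- intros s Hs. split; [now apply Hnz|]. eapply pd_eq; [apply pd_Rt, HO; lra|].
  unfold p_i. rewrite Hseg. apply HW. nra.
Qed.

(** The second equation is the formula for the derivative of [F^2], because
    [12 v3 = E2 - (1 - 2 lambda) theta_3^4]. *)
Lemma branch_F p : Om p -> branch p ->
  hyp (lam p) = T 0 p ^ 2 /\ lam p * (1 - lam p) * (2 * hyp (lam p) * dhyp (lam p)) = 4 * v3 p.
Proof.
intros [H1 H2] [HW HR]. pose proof (T0_nonzero p H1) as N.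
assert (E : hyp (lam p) = T 0 p ^ 2).
{ unfold Rt in HR. replace (hyp (lam p)) with (hyp (lam p) / T 0 p ^ 2 * T 0 p ^ 2) by (field; auto).
  rewrite HR. ring. }
split; auto. unfold Wr in HW. rewrite E in *.
transitivity (2 * (lam p * (1 - lam p) * dhyp (lam p) * T 0 p ^ 2 - 2 * T 0 p ^ 2 * v3 p / T 0 p ^ 2) + 4 * v3 p);
  [field; auto | rewrite HW; ring].
Qed.

(** Roots of the three factors have modulus 1 or 2; for the quadratic one [x^3 = -1]. *)
Lemma one_sub_nz x : (Cmod x < 1)%R -> 1 + x <> 0 /\ 2 - x <> 0 /\ x ^ 2 - x + 1 <> 0.
Proof.
intros Hx.
assert (C1 : forall z, (Cmod z < 1)%R -> z <> - (1)).
{ intros z Hz E. rewrite E, Cmod_opp, Cmod_1 in Hz. lra. }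
repeat split.
- intros E. apply (C1 x Hx). replace x with (1 + x - 1) by ring. rewrite E. ring.
- intros E. assert (E2 : x = 2) by (replace x with (2 - (2 - x)) by ring; rewrite E; ring).
  rewrite E2, Cmod_R, Rabs_pos_eq in Hx; lra.
- intros E. apply (C1 (x ^ 3)); [apply Cmod_pow_lt_1; auto; lia|].
  replace (x ^ 3) with ((x + 1) * (x ^ 2 - x + 1) - 1) by ring. rewrite E. ring.
Qed.

(** The only point where [E6] vanishes: there [1 - 2 lambda] vanishes as well, and [tau] has the
    imaginary part of [i], where [E2* = 0]. *)
Lemma v3_half tau : C_lambda_infty tau -> lam (nm tau) = (1 / 2)%C ->
  4 * v3 (nm tau) = RtoC (1 / (PI * Im tau)).
Proof.
intros Ht Hl. assert (HO : Om (nm tau)) by (destruct Ht as [Hd _]; now apply lambda_disc_Om).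
pose proof (C_lambda_infty_branch tau Ht) as Hb.
assert (HOi : Om p_i) by (apply Om_real; pose proof (nome_im_bounds 1 ltac:(lra)); lra).
destruct (branch_F _ HO Hb) as [_ E1]. destruct (branch_F _ HOi branch_p_i) as [_ E2].
(* On the branch [4 v3] depends on [lambda] alone, so its value can be taken at [i]. *)
rewrite lam_p_i, <- Hl, E1 in E2. rewrite E2, v3_p_i.
pose proof (kappa_pos_real (nome_im 1) (nome_im_bounds 1 ltac:(lra))) as Ki.
pose proof (C_lambda_infty_kappa tau Ht) as Kt.
assert (HI : Im tau = 1%R).
{ pose proof (kappa_determined (nm tau) p_i (proj1 HO) p_i_disc Kt Ki ltac:(rewrite lam_p_i; auto)) as E.
  pose proof (kappa_radius _ _ (proj1 HO) p_i_disc E) as N1.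
  pose proof (kappa_radius _ _ p_i_disc (proj1 HO) (fun n => eq_sym (E n))) as N2.
  assert (Em : Cmod (nm tau) = Cmod p_i) by lra.
  rewrite Cmod_nm in Em. unfold p_i in Em. pose proof (nome_im_bounds 1 ltac:(lra)) as Hb1.
  rewrite Cmod_R, Rabs_pos_eq in Em by lra. unfold nome_im in Em. apply exp_inv in Em.
  pose proof PI_RGT_0. nra. }
rewrite HI, <- RtoC_mult. f_equal. field. apply Rgt_not_eq, PI_RGT_0.
Qed.

Lemma period_identity tau : C_lambda_infty tau ->
  let lambda := modular_lambda tau in
  (1 - 2 * lambda) * (hyp lambda ^ 2 / 6) *
      (2 + (lambda + 1) * (lambda - 2) / (lambda ^ 2 - lambda + 1) * s2 tau)
    + lambda * (1 - lambda) * (2 * hyp lambda * dhyp lambda) = RtoC (1 / (PI * Im tau)).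
Proof.
intros Ht lambda. pose proof (proj1 Ht) as Hd.
assert (HI : (0 < Im tau)%R) by (destruct Hd as [[H _] _]; exact H).
assert (HO : Om (nm tau)) by now apply lambda_disc_Om.
destruct (branch_F _ HO (C_lambda_infty_branch tau Ht)) as [EF ED].
subst lambda. rewrite modular_lambda_nm by auto.
rewrite ED. set (p := nm tau) in *. pose proof (proj1 HO) as Hp. pose proof (proj2 HO) as Hl.
destruct (classic (lam p = 1 / 2)) as [Hh|Hh].
{ rewrite Hh. unfold p in *. rewrite v3_half by auto. field.
}
destruct (one_sub_nz _ Hl) as [N1 [N2 N3]].
assert (N4 : 1 - 2 * lam p <> 0).
{ intros E. apply Hh. replace (lam p) with ((1 - (1 - 2 * lam p)) / 2) by field. rewrite E. field. }
pose proof (T0_nonzero p Hp) as N.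
unfold s2, E2star, E2, E4, E6. rewrite nome_nm. fold p.
rewrite E2_theta, E4_theta, E6_theta by auto.
(* Everything is rewritten through [lambda], [theta_3], [v3] and [1 / (PI Im tau)]; the identity is
   then rational. *)
assert (Ev : v4 p = v3 p - th2 p / 4) by (rewrite <- v3_sub_v4 by auto; ring).
assert (Ea : th2 p = lam p * T 0 p ^ 4) by (unfold lam; field; auto).
assert (Ec : T 0 (- p) ^ 4 = (1 - lam p) * T 0 p ^ 4) by (rewrite one_sub_lam by auto; field; auto).
replace (T 0 (- p) ^ 8) with ((T 0 (- p) ^ 4) ^ 2) by ring.
rewrite Ev, Ea, Ec, EF.
replace (RtoC (3 / (PI * Im tau))) with (3 * RtoC (1 / (PI * Im tau))).
2:{ rewrite <- RtoC_mult. f_equal. field. pose proof PI_RGT_0. lra. }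
set (y := RtoC (1 / (PI * Im tau))). set (l := lam p) in *. set (b := T 0 p) in *.
pose proof (Cpow_nz b 4 N) as Nb.
field. repeat split; auto; intros Z;
  [apply (Cmult_neq_0 _ _ N4 Nb) | apply (Cmult_neq_0 _ _ N2 Nb) | apply (Cmult_neq_0 _ _ N1 Nb)];
  rewrite <- Z; ring.
Qed.

Theorem mainTheorem12 (a b c d : Z) (tau : C)
  (ha : (0 < a)%Z)
  (hcoprime : Z.gcd (Z.gcd a b) c = 1%Z)
  (hd : (- d = b ^ 2 - 4 * a * c)%Z)
  (hroot : RtoC (IZR a) * tau ^ 2 + RtoC (IZR b) * tau + RtoC (IZR c) = 0)
  (htau : tau = (- RtoC (IZR b) + Csqrt_real (IZR (- d))) / (2 * RtoC (IZR a)))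
  (hC : C_lambda_infty tau) :
  let lambda := modular_lambda tau in
  let F2 := fun x : C => hyp2F1 (RtoC (1 / 2)) (RtoC (1 / 2)) 1 x ^ 2 in
  exists dF2 : C,
    is_derive (K := C_AbsRing) (V := C_NormedModule) F2 lambda dF2 /\
    (1 - 2 * lambda) * (F2 lambda / 6) *
      (2 + (lambda + 1) * (lambda - 2) / (lambda ^ 2 - lambda + 1) * s2 tau)
    + lambda * (1 - lambda) * dF2
    = RtoC (2 * IZR a / (PI * sqrt (IZR d))).
Proof.
intros lambda F2. exists (2 * hyp lambda * dhyp lambda).
destruct (proj1 hC) as [[HI _] Hl].
split.
- apply cd_is_derive. change F2 with (fun x => hyp x ^ 2).
  eapply cd_eq; [apply (cd_pow hyp), cd_hyp, Hl | numsimp; ring].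
- change (F2 lambda) with (hyp lambda ^ 2). unfold lambda. rewrite period_identity by exact hC.
  apply f_equal.
  assert (Ha : (0 < IZR a)%R) by now apply IZR_lt.
  assert (E : Im tau = (sqrt (IZR d) / (2 * IZR a))%R).
  { rewrite htau. rewrite <- RtoC_mult, <- RtoC_opp. unfold Cdiv. rewrite <- RtoC_inv by lra.
    unfold Csqrt_real. rewrite opp_IZR, Ropp_involutive. simpl. field. lra. }
  rewrite E in *. pose proof PI_RGT_0.
  (* Positivity of [d] is read off from [0 < Im tau]: for [d <= 0] the real [sqrt] would be 0. *)
  assert (sqrt (IZR d) <> 0)%R.
  { intros Z. rewrite Z in HI. unfold Rdiv in HI. rewrite Rmult_0_l in HI. lra. }
  field. repeat split; auto; lra.
Qed.
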